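(* Let $m\ge 2$, $k\ge 2$, and let $G = \mathbb{Z}_m \wr F_k$ be a lamplighter group over a tree, acting on its Cayley graph $X$ with the word metric $d$ associated to the standard generating set. Let $\mu$ be a probability measure on $G$ with finite first moment and such that the support of $\mu$ does not fix any (nonempty) finite set of ends of $F_k$. Then there exists $A > 0$ such that for each $x \in G$ and almost every sample path $(w_n)$ of the random walk determined by $\mu$ there exists a geodesic ray $\gamma : [0, \infty) \to X$ such that $$\lim_{n \to \infty}\frac{d(w_n x , \gamma(An))}{n} = 0.$$
   Context: $F_k$ is the free group on $a_1,\dots,a_k$; $\mathbb{T}$ is the vertex set of its Cayley graph for these generators, a homogeneous tree of degree $2k$, with identity vertex $e$. $\mathcal{C}$ is the group of finitely supported functions (configurations) $f:\mathbb{T}\to\mathbb{Z}_m$, on which $F_k$ acts by $T_h(f)(y):=f(h^{-1}y)$. The wreath product is the semidirect product $\mathbb{Z}_m\wr F_k := F_k\ltimes\mathcal{C}$, with elements written $(y,f)$, $y\in F_k=\mathbb{T}$, $f\in\mathcal{C}$, and product $(y,f)(y',f')=(yy',f+T_yf')$. The standard generating set consists of $(a_r^{\pm1},0)$, $1\le r\le k$, and $(e,\pm\delta_e)$, where $\delta_e$ equals $1$ at $e$ and $0$ elsewhere. $X$ is the Cayley graph: its vertex set is $\mathbb{T}\times\mathcal{C}$, and $(y,f)$, $(y',f')$ are joined by an edge iff either $f=f'$ and $y,y'$ are adjacent in the tree, or $y=y'$, $f$ and $f'$ agree off $y$, and $f(y)-f'(y)=\pm1$ in $\mathbb{Z}_m$.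 $G$ acts on $X$ by left multiplication; a geodesic ray is an isometric embedding of $[0,\infty)$ in $X$ (edges having length 1). $G$ acts on the tree, and on its space of ends $\partial\mathbb{T}$ (the ends of $F_k$), through the projection $G\to F_k$. The support of $\mu$ fixes a set $E\subset\partial\mathbb{T}$ if $gE=E$ for all $g\in\mathrm{supp}\,\mu$. Random walk: $\mathbb{P}=\mu^{\mathbb{N}}$ is the product measure on sequences $(g_1,g_2,\dots)\in G^{\mathbb{N}}$, $w_n := g_1\cdots g_n$; ''almost every'' is with respect to $\mathbb{P}$. Finite first moment: $\int_G d(x,gx)\,d\mu(g)<\infty$ for some $x\in X$. *)

(* Defs.v *)
From HB Require Import structures.
From mathcomp Require Import all_boot all_order all_algebra finmap.
From mathcomp Require Import all_classical all_reals all_analysis.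
Import Order.TTheory GRing.Theory Num.Theory.
Import numFieldNormedType.Exports.

Set Implicit Arguments.
Unset Strict Implicit.
Unset Printing Implicit Defensive.

Local Open Scope classical_set_scope.
Local Open Scope fset_scope.
Local Open Scope ring_scope.

(* [(r, false)] is the letter a_r, and [(r, true)] is its inverse. *)
Definition letter (k : nat) := ('I_k * bool)%type.

Definition linv k (a : letter k) : letter k := (a.1, ~~ a.2).

Definition reduced k : pred (seq (letter k)) :=
  sorted (fun a b => b != linv a).

Definition free_group (k : nat) := {w : seq (letter k) | reduced w}.

HB.instance Definition _ k := [isSub of free_group k for @proj1_sig _ _].
HB.instance Definition _ k := [Countable of free_group k by <:].

Section FreeGroup.
Variable k : nat.
Implicit Types (a b : letter k) (u v w : seq (letter k)) (x y z : free_group k).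

(* Left multiplication of a reduced word by a letter. *)
Definition cancel_cons a w : seq (letter k) :=
  if w is b :: w' then (if b == linv a then w' else a :: w) else [:: a].

Definition rmul u v : seq (letter k) := foldr cancel_cons v u.

Definition rinv w : seq (letter k) := rev (map (@linv k) w).

Lemma linvK : involutive (@linv k).
Proof. by case=> r b; rewrite /linv /= negbK. Qed.

Lemma cancel_cons_reduced a w : reduced w -> reduced (cancel_cons a w).
Proof.
case: w => [|b w] //=; case: eqP => [_|/eqP nb] red_bw /=.
  exact: path_sorted red_bw.
by rewrite nb red_bw.
Qed.

Lemma rmul_reduced u v : reduced v -> reduced (rmul u v).
Proof. by move=> rv; elim: u => //= a u IHu; apply: cancel_cons_reduced. Qed.

Lemma cancel_consK a w :
  reduced w -> cancel_cons (linv a) (cancel_cons a w) = w.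
Proof.
case: w => [|b w] /=; first by rewrite linvK eqxx.
case: eqP => [-> |_ _] /=; last by rewrite linvK eqxx.
by case: w => [|c w] //= /andP[/negPf-> _].
Qed.

Lemma cancel_consVK a w :
  reduced w -> cancel_cons a (cancel_cons (linv a) w) = w.
Proof. by move=> /(@cancel_consK (linv a)); rewrite linvK. Qed.

Lemma rmul_cons a u v :
  reduced v -> rmul (cancel_cons a u) v = cancel_cons a (rmul u v).
Proof.
move=> rv; case: u => [|b u] //=; case: eqP => [->|_] //=.
by rewrite cancel_consVK // rmul_reduced.
Qed.

Lemma rmulA u v w : reduced w -> rmul u (rmul v w) = rmul (rmul u v) w.
Proof. by move=> rw; elim: u => //= a u ->; rewrite rmul_cons. Qed.

Lemma rmul_nil w : reduced w -> rmul w [::] = w.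
Proof.
elim: w => //= a w IHw p; rewrite IHw; last exact: path_sorted p.
by case: w p {IHw} => //= b w /andP[/negPf-> _].
Qed.

Lemma rmulV w v : reduced v -> rmul (rinv w) (rmul w v) = v.
Proof.
move=> rv; elim: w => [|a w IHw] //=.
rewrite /rinv map_cons rev_cons -cats1 /rmul foldr_cat /=.
by rewrite cancel_consK // rmul_reduced.
Qed.

Lemma rinvK : involutive rinv.
Proof.
by move=> w; rewrite /rinv map_rev revK (mapK linvK).
Qed.

Lemma rinv_reduced w : reduced w -> reduced (rinv w).
Proof.
rewrite /reduced /rinv rev_sorted sorted_map; apply: sub_sorted => a b /=.
by apply: contra => /eqP ->; rewrite linvK.
Qed.

Definition free_one : free_group k := exist _ [::] isT.
Definition free_mul x y : free_group k :=
  exist _ (rmul (val x) (val y)) (rmul_reduced _ (valP y)).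
Definition free_inv x : free_group k :=
  exist _ (rinv (val x)) (rinv_reduced (valP x)).

Lemma free_mulA : associative free_mul.
Proof. by move=> x y z; apply: val_inj; rewrite /= rmulA // (valP z). Qed.

Lemma free_mul1 : left_id free_one free_mul.
Proof. by move=> x; apply: val_inj. Qed.

Lemma free_mul1r : right_id free_one free_mul.
Proof. by move=> x; apply: val_inj; rewrite /= rmul_nil // (valP x). Qed.

Lemma free_mulV : left_inverse free_one free_inv free_mul.
Proof.
move=> x; apply: val_inj => /=.
by rewrite -[in RHS](@rmulV (val x) [::] isT) rmul_nil // (valP x).
Qed.

Lemma free_mulVr : right_inverse free_one free_inv free_mul.
Proof.
move=> x; rewrite -{1}[x](_ : free_inv (free_inv x) = x) ?free_mulV //.
by apply: val_inj; rewrite /= rinvK.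
Qed.

HB.instance Definition _ := isGroup.Build (free_group k)
  free_mulA free_mul1 free_mul1r free_mulV free_mulVr.

Definition free_gen (r : 'I_k) : free_group k := exist _ [:: (r, false)] isT.

End FreeGroup.

Section CayleyGraph.
Variables (R : realType) (G : groupType) (S : {pred G}).
Implicit Types g h : G.

Definition cayley_adj : rel G := fun g h => (g^-1 * h)%g \in S.

Lemma cayley_adjM g : {mono *%g g : u v / cayley_adj u v}.
Proof. by move=> u v; rewrite /cayley_adj invgM -mulgA mulKg. Qed.

(* The length of a shortest edge path; the convention [inf set0 = 0] plays no
   role when [S] generates [G]. *)
Definition graph_dist g h : R :=
  inf [set (size p)%:R | p in [set p | path cayley_adj g p /\ last g p = h]].

(* [EdgePoint g h _ t _] is the interior point at distance [t] from [g] of the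
   edge [gh]; for symmetric [S] it has the second name
   [EdgePoint h g _ (1 - t) _], and [cayley_dist] does not separate the two. *)
Inductive cayley_point :=
| Vertex (g : G)
| EdgePoint (g h : G) (gh : cayley_adj g h) (t : R) (t01 : 0 < t < 1).

Definition cayley_act g (p : cayley_point) : cayley_point :=
  match p with
  | Vertex h => Vertex (g * h)%g
  | EdgePoint u v uv t t01 =>
      EdgePoint (etrans (cayley_adjM g u v) uv) t01
  end.

Definition exits (p : cayley_point) : seq (G * R) :=
  match p with
  | Vertex g => [:: (g, 0)]
  | EdgePoint g h _ t _ => [:: (g, t); (h, 1 - t)]
  end.

(* Lengths of the shortest connections between [p] and [q] leaving through
   given ends of their edges. *)
Definition outer_lengths (p q : cayley_point) : set R :=
  [set l | exists2 a, a \in exits p & exists2 b, b \in exits q &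
     l = a.2 + graph_dist a.1 b.1 + b.2].

(* Length of the segment joining two points inside a common edge. *)
Definition inner_lengths (p q : cayley_point) : set R :=
  match p, q with
  | EdgePoint g h _ s _, EdgePoint g' h' _ t _ =>
      [set l | [/\ g = g', h = h' & l = `|s - t|]] `|`
      [set l | [/\ g = h', h = g' & l = `|s - (1 - t)|]]
  | _, _ => set0
  end.

(* The length metric for edges of length 1; the infimum is over a finite
   nonempty set. *)
Definition cayley_dist (p q : cayley_point) : R :=
  inf (outer_lengths p q `|` inner_lengths p q).

(* Only the restriction of [gamma] to [0, +oo) matters. *)
Definition geodesic_ray (gamma : R -> cayley_point) : Prop :=
  forall s t : R, 0 <= s -> 0 <= t ->
    cayley_dist (gamma s) (gamma t) = `|s - t|.

End CayleyGraph.

Arguments Vertex {R G S} g.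

Section Ends.
Variable k : nat.
Implicit Types (r s : nat -> free_group k) (xi : set (nat -> free_group k)).

Definition tree_gens : {pred free_group k} :=
  [pred y | [exists i, (y == free_gen i) || (y == (free_gen i)^-1%g)]].

Definition tree_adj : rel (free_group k) := cayley_adj tree_gens.

Definition tree_ray r : Prop :=
  injective r /\ forall n, tree_adj (r n) (r n.+1).

(* Two rays of a tree have the same end iff they eventually coincide, up to a
   shift of the parameter; an end is an equivalence class of rays. *)
Definition cofinal r s : Prop :=
  exists i j, forall n, r (i + n)%N = s (j + n)%N.

Definition is_end xi : Prop :=
  exists2 r, tree_ray r & xi = [set s | tree_ray s /\ cofinal r s].

Definition end_act (h : free_group k) xi : set (nat -> free_group k) :=
  [set (fun n => (h * r n)%g) | r in xi].

End Ends.

Definition configuration (m k : nat) := {fsfun free_group k -> 'Z_m with 0}.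

HB.instance Definition _ m k := Choice.on (configuration m k).

Section Configuration.
Variables m k : nat.
Implicit Types (f g : configuration m k) (h y : free_group k).

Definition conf_zero : configuration m k := [fsfun with 0].
Definition conf_opp f : configuration m k :=
  [fsfun y in finsupp f => - f y | 0].
Definition conf_add f g : configuration m k :=
  [fsfun y in finsupp f `|` finsupp g => f y + g y | 0].

Lemma conf_zeroE y : conf_zero y = 0.
Proof. by rewrite fsfunE. Qed.

Lemma conf_oppE f y : conf_opp f y = - f y.
Proof. by rewrite fsfunE; case: finsuppP => // _; rewrite oppr0. Qed.

Lemma conf_addE f g y : conf_add f g y = f y + g y.
Proof.
rewrite fsfunE inE; case: finsuppP => _; case: finsuppP => _ //=.
by rewrite addr0.
Qed.

Lemma conf_addA : associative conf_add.
Proof. by move=> f g h; apply/fsfunP => y; rewrite !conf_addE addrA. Qed.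

Lemma conf_addC : commutative conf_add.
Proof. by move=> f g; apply/fsfunP => y; rewrite !conf_addE addrC. Qed.

Lemma conf_add0 : left_id conf_zero conf_add.
Proof. by move=> f; apply/fsfunP => y; rewrite conf_addE conf_zeroE add0r. Qed.

Lemma conf_addN : left_inverse conf_zero conf_opp conf_add.
Proof.
by move=> f; apply/fsfunP => y; rewrite conf_addE conf_oppE conf_zeroE addNr.
Qed.

HB.instance Definition _ := GRing.isZmodule.Build (configuration m k)
  conf_addA conf_addC conf_add0 conf_addN.

Definition conf_delta h : configuration m k := [fsfun y in [fset h] => 1 | 0].

Definition conf_shift h f : configuration m k :=
  [fsfun y in [fset (h * z)%g | z in finsupp f] => f (h^-1 * y)%g | 0].

Lemma conf_deltaE h y : conf_delta h y = if y == h then 1 else 0.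
Proof. by rewrite fsfunE inE. Qed.

Lemma conf_shiftE h f y : conf_shift h f y = f (h^-1 * y)%g.
Proof.
rewrite fsfunE; case: ifPn => // /imfsetP hy; case: finsuppP => // fy.
by case: hy; exists (h^-1 * y)%g; rewrite //= mulVKg.
Qed.

Lemma conf_shift1 f : conf_shift 1%g f = f.
Proof. by apply/fsfunP => y; rewrite conf_shiftE invg1 mul1g. Qed.

Lemma conf_shiftM h h' f :
  conf_shift (h * h')%g f = conf_shift h (conf_shift h' f).
Proof. by apply/fsfunP => y; rewrite !conf_shiftE invgM mulgA. Qed.

Lemma conf_shiftD h : {morph conf_shift h : f g / f + g}.
Proof.
by move=> f g; apply/fsfunP => y; rewrite conf_shiftE !conf_addE !conf_shiftE.
Qed.

Lemma conf_shift0 h : conf_shift h 0 = 0.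
Proof. by apply/fsfunP => y; rewrite conf_shiftE !conf_zeroE. Qed.

Lemma conf_shiftN h : {morph conf_shift h : f / - f}.
Proof.
by move=> f; apply/fsfunP => y; rewrite conf_shiftE !conf_oppE conf_shiftE.
Qed.

End Configuration.

Definition lamplighter (m k : nat) := (free_group k * configuration m k)%type.

HB.instance Definition _ m k := Choice.on (lamplighter m k).

Section Lamplighter.
Variables m k : nat.
Implicit Types x y z : lamplighter m k.

Definition lamp_one : lamplighter m k := (1%g, 0).
Definition lamp_mul x y : lamplighter m k :=
  ((x.1 * y.1)%g, x.2 + conf_shift x.1 y.2).
Definition lamp_inv x : lamplighter m k :=
  ((x.1)^-1%g, - conf_shift (x.1)^-1%g x.2).

Lemma lamp_mulA : associative lamp_mul.
Proof.
by move=> x y z; rewrite /lamp_mul /= mulgA conf_shiftD conf_shiftM addrA.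
Qed.

Lemma lamp_mul1 : left_id lamp_one lamp_mul.
Proof. by case=> y f; rewrite /lamp_mul /= mul1g conf_shift1 add0r. Qed.

Lemma lamp_mul1r : right_id lamp_one lamp_mul.
Proof. by case=> y f; rewrite /lamp_mul /= mulg1 conf_shift0 addr0. Qed.

Lemma lamp_mulV : left_inverse lamp_one lamp_inv lamp_mul.
Proof. by case=> y f; rewrite /lamp_mul /= mulVg addNr. Qed.

Lemma lamp_mulVr : right_inverse lamp_one lamp_inv lamp_mul.
Proof.
case=> y f; rewrite /lamp_mul /= mulgV conf_shiftN -conf_shiftM mulgV.
by rewrite conf_shift1 subrr.
Qed.

HB.instance Definition _ := isGroup.Build (lamplighter m k)
  lamp_mulA lamp_mul1 lamp_mul1r lamp_mulV lamp_mulVr.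
HB.instance Definition _ := isPointed.Build (lamplighter m k) 1%g.
HB.instance Definition _ := @isMeasurable.Build default_measure_display
  (lamplighter m k) discrete_measurable discrete_measurable0
  discrete_measurableC discrete_measurableU.

(* The Cayley graph of this generating set is described explicitly in
   [lamp_adjE] below. *)
Definition lamp_gens : {pred lamplighter m k} :=
  [pred g : lamplighter m k |
     [exists i, (g == (free_gen i, 0)) || (g == ((free_gen i)^-1%g, 0))]
     || (g == (1%g, conf_delta m 1%g)) || (g == (1%g, - conf_delta m 1%g))].

Lemma lamp_adjE x y :
  cayley_adj lamp_gens x y <->
  x.2 = y.2 /\ tree_adj x.1 y.1 \/
  [/\ x.1 = y.1, forall v, v != x.1 -> x.2 v = y.2 v &
      x.2 x.1 - y.2 x.1 = 1 \/ x.2 x.1 - y.2 x.1 = -1].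
Proof.
case: x y => [x f] [y g].
have [q -> adjE] : exists2 q : lamplighter m k,
    cayley_adj lamp_gens (x, f) (y, g) = (q \in lamp_gens) &
    forall s c, (q == (s, c)) = (y == x * s)%g && (g == f + conf_shift x c).
  exists (((x, f) : lamplighter m k)^-1 * (y, g))%g => // s c.
  rewrite -(inj_eq (mulgI ((x, f) : lamplighter m k))) mulVKg.
  exact: xpair_eqE.
have shiftE v (z : configuration m k) : (forall u, u != x -> f u = g u) ->
    g x - f x = z 1%g -> (forall u, u != 1%g -> z u = 0) ->
    g v = (f + conf_shift x z : configuration m k) v.
  move=> fg gx z0; rewrite conf_addE conf_shiftE.
  have [->|vx] := eqVneq v x; first by rewrite mulVg -gx addrC subrK.
  by rewrite z0 ?fg ?addr0 // -(inj_eq (mulgI x)) mulVKg mulg1.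
have delta0 (u : free_group k) : u != 1%g -> conf_delta m 1%g u = 0.
  by rewrite conf_deltaE => /negPf ->.
rewrite /tree_adj /cayley_adj !inE /=.
under eq_existsb do rewrite !adjE /= conf_shift0 addr0.
rewrite !adjE mulg1; split.
  move=> /orP[/orP[/existsP[i]|]|].
  - by rewrite -andb_orl => /andP[yi /eqP->]; left; split=> //;
      apply/existsP; exists i; move: yi => /orP[]/eqP->; rewrite mulKg eqxx ?orbT.
  - move=> /andP[/eqP-> /eqP->]; right; split=> [//|v vx|].
      rewrite conf_addE conf_shiftE delta0 ?addr0 //.
      by rewrite -(inj_eq (mulgI x)) mulVKg mulg1.
    right; rewrite conf_addE conf_shiftE mulVg conf_deltaE eqxx.
    by rewrite opprD addrA subrr sub0r.
  - move=> /andP[/eqP-> /eqP->]; right; split=> [//|v vx|].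
      rewrite conf_addE conf_shiftE conf_oppE delta0 ?oppr0 ?addr0 //.
      by rewrite -(inj_eq (mulgI x)) mulVKg mulg1.
    left; rewrite conf_addE conf_shiftE mulVg conf_oppE conf_deltaE eqxx.
    by rewrite opprD opprK addrA subrr add0r.
case=> [[-> /existsP[i xy]]|[<- fg fgx]].
  apply/orP; left; apply/orP; left; apply/existsP; exists i.
  by rewrite -andb_orl eqxx andbT; move: xy => /orP[]/eqP <-;
    rewrite mulVKg eqxx ?orbT.
rewrite eqxx /=; case: fgx => gfx.
  apply/orP; right; apply/eqP/fsfunP => v; apply: shiftE => //.
    by rewrite conf_oppE conf_deltaE eqxx -gfx opprB.
  by move=> u u1; rewrite conf_oppE delta0 ?oppr0.
apply/orP; left; apply/orP; right; apply/eqP/fsfunP => v; apply: shiftE => //.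
by rewrite conf_deltaE eqxx -[1]opprK -gfx opprB.
Qed.

End Lamplighter.

Arguments lamp_gens : clear implicits.

Section ProductMeasure.
Context (d : measure_display) (T : measurableType d) (R : realType).

Definition coordinate_sets : set (set (nat -> T)) :=
  [set C | exists i A, measurable A /\ C = [set w | A (w i)]].

Definition sequence_space := g_sigma_algebraType coordinate_sets.

(* [P = mu^N]: a probability on the product sigma-algebra is determined by its
   values on finite-dimensional boxes. *)
Definition is_power_measure (mu : probability T R)
    (P : probability sequence_space R) : Prop :=
  forall (n : nat) (A : nat -> set T), (forall i, measurable (A i)) ->
    P [set w | forall i, (i < n)%N -> A i (w i)] =
    (\prod_(i < n) mu (A i))%E.

End ProductMeasure.

Section RandomWalk.
Variables (m k : nat) (R : realType).
Implicit Types mu : probability (lamplighter m k) R.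

(* The first increment g_1 is [g 0]. *)
Definition walk (g : nat -> lamplighter m k) (n : nat) : lamplighter m k :=
  (\prod_(i < n) g i)%g.

Definition supp mu : set (lamplighter m k) := [set g | mu [set g] != 0%E].

Definition fixes_ends (A : set (lamplighter m k))
    (E : set (set (nat -> free_group k))) : Prop :=
  forall g, A g -> [set end_act g.1 xi | xi in E] = E.

Definition finite_first_moment mu : Prop :=
  exists x : cayley_point R (lamp_gens m k),
    (\int[mu]_g (cayley_dist x (cayley_act g x))%:E < +oo)%E.

End RandomWalk.

(* Main.v *)
(* Write w_n = (y_n, f_n).

   Deterministic part.  Assume |y_n|/n -> l > 0, |w_n|/n -> A and that the
   averages of |g_i| converge.  In the tree, the prefix of length j of y_n is
   eventually a fixed vertex c_j, and the steps |g_i| = o(i) are too short to leave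
   the cone of words starting with c_j, so the lamps outside this cone freeze as
   well.  Let p_j be c_j together with the frozen lamps.  As c_j is a cut vertex,
   d(1, p_i) + d(p_i, p_j) = d(1, p_j) for i <= j, so a geodesic ray passes through
   all the p_j, and d(1, p_j) + d(p_j, w_n) = |w_n| when j is settled at time n.
   Taking j slightly below l n, at time (1 - e) n neither the walk nor its lamps
   have reached the cone of c_j, so d(p_j, w_n) is at most the length of the
   increments between (1 - e) n and n, which is O(e n).

   Probabilistic part.  The three limits follow from Kingman's theorem for the
   shift, proved by the covering argument of Katznelson and Weiss, the ergodicity
   of the shift coming from the independence of boxes.  For l > 0: if all elements
   of the projected support commuted, they would fix a common end, so there are
   noncommuting p, q in it.  For a large n the words p^i q^n p^(4-i), i < 5, have
   distinct initial parts and distinct final parts and so play ping-pong.  The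
   n+4-step operator then contracts l^2 of the free group, return probabilities
   decay exponentially, and y_n cannot stay in a ball of small linear radius. *)
From HB Require Import structures.
Require Import Defs.
From mathcomp Require Import all_boot all_order all_algebra finmap.
From mathcomp Require Import all_classical all_reals all_analysis.
From mathcomp Require Import measurable_realfun.
From mathcomp Require Import zify ring lra.
Import Order.TTheory GRing.Theory Num.Theory.
Import numFieldNormedType.Exports.

Set Implicit Arguments.
Unset Strict Implicit.
Unset Printing Implicit Defensive.

Local Open Scope classical_set_scope.
Local Open Scope ring_scope.

(** * Words and powers in the free group *)

(** Two devices carry the estimates. In the free group the length [lcp] of the longest common prefix
    is the Gromov product at the identity, so cancellation becomes linear arithmetic in word
    lengths. In the Cayley graph a distance is bounded below by a function of pairs that obeys the
    triangle inequality and is at most 1 on edges, so cut vertices are checked one edge at a time.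
    The words p^i q^n p^(4-i) all have n+4 factors, so they are atoms of one and the same
    convolution power. For five translates of a function the trivial bound on the squared norm of
    their sum is 25 times the squared norm of the function; ping-pong lowers this to 20, and the
    missing fifth yields the spectral gap. The ergodic theorems work with one constant c at a time:
    the zero-one law makes c either an almost sure asymptotic lower bound or almost surely undercut
    at some time, and in the second case the covering argument turns the pathwise inequality into
    one between expectations. *)

Section FreeGroupWords.
Variable k : nat.
Implicit Types (a b : letter k) (u v w : seq (letter k)) (p q r x y z : free_group k).
Local Open Scope nat_scope.

Fixpoint lcp u v : nat :=
  match u, v with
  | a :: u', b :: v' => if a == b then (lcp u' v').+1 else 0
  | _, _ => 0
  end.

Lemma lcp_leql u v : lcp u v <= size u.
Proof. by elim: u v => [|a u IH] [|b v] //=; case: eqP => // _; apply: IH. Qed.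

Lemma lcpC u v : lcp u v = lcp v u.
Proof. by elim: u v => [|a u IH] [|b v] //=; rewrite eq_sym IH. Qed.

Lemma lcp_leqr u v : lcp u v <= size v.
Proof. by rewrite lcpC lcp_leql. Qed.

Lemma lcp_take u v n : (n <= lcp u v) =
  [&& n <= size u, n <= size v & take n u == take n v].
Proof.
elim: n u v => [|n IH] [|a u] [|b v] //=; first by rewrite andbF.
rewrite !ltnS eqseq_cons; case: eqP => _ /=; first by rewrite ltnS IH.
by rewrite !andbF.
Qed.

Lemma lcp_ultra u v w n : n <= lcp u v -> n <= lcp v w -> n <= lcp u w.
Proof.
by rewrite !lcp_take => /and3P[-> _ /eqP ->] /and3P[_ -> /eqP ->] /=.
Qed.

Lemma lcp_cat u v w : lcp u w < size u -> lcp (u ++ v) w = lcp u w.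
Proof.
elim: u w => [|a u IH] [|b w] //=; case: eqP => //= _.
by rewrite ltnS => /IH ->.
Qed.

Lemma prefix_lcp u v : prefix u v = (size u <= lcp u v).
Proof.
by elim: u v => [|a u IH] [|b v] //=; case: eqP => //=.
Qed.

Lemma reduced_catP u v : reduced (u ++ v) -> reduced u /\ reduced v.
Proof.
move=> r; split; first by have := take_sorted (size u) r; rewrite take_size_cat.
by have := drop_sorted (size u) r; rewrite drop_size_cat.
Qed.

Lemma rmul_cat u v : reduced (u ++ v) -> rmul u v = u ++ v.
Proof.
elim: u => //= a u IH r; rewrite IH; last exact: path_sorted r.
by case: (u ++ v) r => [|b w] //= /andP[/negPf ->].
Qed.

Lemma size_cancel_cons a w : size (cancel_cons a w) <= (size w).+1.
Proof. by case: w => [|b w] //=; case: eqP => //= _; lia. Qed.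

Lemma size_rmul u v : size (rmul u v) <= size u + size v.
Proof.
elim: u => //= a u IH; have := size_cancel_cons a (rmul u v); lia.
Qed.

Lemma size_rinv u : size (rinv u) = size u.
Proof. by rewrite /rinv size_rev size_map. Qed.

Lemma reduced_rinv_cat u v : reduced u -> reduced v -> lcp u v = 0 ->
  reduced (rinv u ++ v).
Proof.
case: u => [//|a u]; case: v => [|b v] /=.
  by move=> ru _ _; rewrite cats0; apply: rinv_reduced.
move=> ru rv; have : reduced (rinv (a :: u)) by apply: rinv_reduced.
rewrite /rinv /= rev_cons; case: eqP => // nab r _.
case E: (rcons _ _) r => [|c s].
  by move/(congr1 size): E; rewrite size_rcons.
rewrite /reduced /= => r; rewrite cat_path r /= rv andbT.
have -> : last c s = last (linv a) (c :: s) by [].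
rewrite -E last_rcons linvK; exact/eqP/nesym.
Qed.

(** Cancellation consumes exactly the common prefix: once it is dropped, the two remainders start
    with different letters. *)
Lemma rmul_rinv u v : reduced u -> reduced v ->
  rmul (rinv u) v = rinv (drop (lcp u v) u) ++ drop (lcp u v) v.
Proof.
elim: u v => [|a u IH] [|b v] ru rv //.
  by rewrite drop0 cats0 rmul_nil //; apply: rinv_reduced.
have [E|N] := eqVneq a b; last first.
  rewrite /= (negPf N) !drop0 rmul_cat //; apply: reduced_rinv_cat => //=.
  by rewrite (negPf N).
subst b; rewrite /= eqxx /= -IH; [|exact: path_sorted ru|exact: path_sorted rv].
rewrite /rinv /= rev_cons -cats1 /rmul foldr_cat /=.
by rewrite linvK eqxx.
Qed.

Definition flen x := size (val x).

Lemma flenM x y : flen (x * y)%g <= flen x + flen y.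
Proof. exact: size_rmul. Qed.

Lemma flenV x : flen x^-1%g = flen x.
Proof. exact: size_rinv. Qed.

Lemma flen1 : flen 1%g = 0.
Proof. by []. Qed.

Lemma flen0 x : flen x = 0 -> x = 1%g.
Proof. by move=> /size0nil x0; apply: val_inj. Qed.

(** This makes [lcp] the Gromov product of x and y seen from the identity. *)
Lemma flenVM x y :
  flen (x^-1 * y)%g + (lcp (val x) (val y)).*2 = flen x + flen y.
Proof.
rewrite /flen; change (val (x^-1 * y)%g) with (rmul (rinv (val x)) (val y)).
rewrite rmul_rinv ?(valP x) ?(valP y) // size_cat size_rinv !size_drop.
have := lcp_leql (val x) (val y); have := lcp_leqr (val x) (val y); lia.
Qed.

(** As u is strictly shorter than v, at least the last letter of v survives the cancellation and
    shields w. *)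
Lemma rmul_catr u v w : reduced u -> reduced (v ++ w) -> size u < size v ->
  rmul u (v ++ w) = rmul u v ++ w.
Proof.
move=> ru rvw uv; have [rv _] := reduced_catP rvw.
have rr := rinv_reduced ru.
rewrite -[u]rinvK !rmul_rinv //.
have lt : lcp (rinv u) v < size v.
  by apply: leq_ltn_trans (lcp_leql _ _) _; rewrite size_rinv.
rewrite ![lcp (rinv u) _]lcpC lcp_cat lcpC //.
by rewrite drop_cat lt catA.
Qed.

Definition free_word (w : seq (letter k)) (r : reduced w) : free_group k := exist _ w r.

(** * Powers, cyclically reduced words and conjugation *)

Definition rpow u n := flatten (nseq n u).

Definition cyc_reduced u := (u != [::]) && reduced (u ++ u).

Lemma rpowS u n : rpow u n.+1 = u ++ rpow u n.
Proof. by []. Qed.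

Lemma size_rpow u n : size (rpow u n) = n * size u.
Proof. by elim: n => // n IH; rewrite rpowS size_cat IH mulSn. Qed.

Lemma rpowSr u n : rpow u n.+1 = rpow u n ++ u.
Proof.
elim: n => [|n IH]; first by rewrite /rpow /= cats0.
by rewrite rpowS IH catA -rpowS IH.
Qed.

Lemma reduced_rpow u n : cyc_reduced u -> reduced (rpow u n).
Proof.
case: u => [//|a u] /andP[_]; rewrite /reduced /= cat_path => /andP[pu /= /andP[la _]].
elim: n => // -[|n] IH; rewrite rpowS /= ?cats0 //.
by rewrite cat_path pu /= la /=; move: IH.
Qed.

Lemma val_expg x n : cyc_reduced (val x) -> val (x ^+ n)%g = rpow (val x) n.
Proof.
move=> cx; elim: n => [|n IH] //; rewrite expgS.
change (val (x * x ^+ n)%g) with (rmul (val x) (val (x ^+ n)%g)).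
by rewrite IH rmul_cat //; apply: (reduced_rpow n.+1 cx).
Qed.

Lemma flen_expg_cyc x n : cyc_reduced (val x) -> flen (x ^+ n)%g = n * flen x.
Proof. by move=> cx; rewrite /flen val_expg // size_rpow. Qed.

Lemma flen_cyc_gt0 x : cyc_reduced (val x) -> 0 < flen x.
Proof. by case/andP; rewrite /flen; case: (val x). Qed.

Lemma free_mulE x y : val (x * y)%g = rmul (val x) (val y).
Proof. by []. Qed.

(* If [x r^n] followed the axis [r r r ...] for too long, then both [x r^n0] and
   [x r^(n0+1)] would be prefixes of it; prefixes whose lengths differ by the
   period differ by [r] on the left, whence [x r = r x]. *)
Lemma lcp_cyc_noncommuting x r : cyc_reduced (val r) -> (x * r <> r * x)%g ->
  exists C, forall n, lcp (val (r ^+ n)%g) (val (x * r ^+ n)%g) <= C.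
Proof.
move=> cr nc; set w := val r; set L := size w; set n0 := (flen x).+1.
have L0 : 0 < L by apply: (flen_cyc_gt0 cr).
pose W := rmul (val x) (rpow w n0.+1); pose W' := rmul (val x) (rpow w n0).
have xn0 : size (val x) < size (rpow w n0).
  by rewrite size_rpow -/L /n0 /flen; nia.
have EW : W = W' ++ w.
  by rewrite /W rpowSr rmul_catr -?rpowSr // ?(valP x) //; apply: reduced_rpow.
(* For n at most [n0] the second summand already exceeds the length of r^n. For larger n, [W] is a
   prefix of x r^n, and a longer common prefix would make it a prefix of r^n as well. *)
exists (size W + n0.+1 * L) => n; rewrite free_mulE val_expg // -/w.
have [le|lt] := leqP n n0.
  by apply: leq_trans (lcp_leql _ _) _; rewrite size_rpow -/L; nia.
rewrite leqNgt; apply/negP => big; apply: nc.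
have {big} : size W <= lcp (rpow w n) (rmul (val x) (rpow w n)) by lia.
have -> : rpow w n = rpow w n0.+1 ++ rpow w (n - n0.+1).
  by rewrite /rpow -flatten_cat -nseqD subnKC.
rewrite rmul_catr ?(valP x) // -?/W; first last.
- by apply: leq_trans xn0 _; rewrite !size_rpow leq_mul2r leqnSn orbT.
- by rewrite /rpow -flatten_cat -nseqD subnKC //; apply: reduced_rpow.
have <- : rpow w n = rpow w n0.+1 ++ rpow w (n - n0.+1).
  by rewrite /rpow -flatten_cat -nseqD subnKC.
rewrite lcp_take => /and3P[le _ /eqP]; rewrite take_size_cat // => tW.
case: n lt le tW => // m lt le tW.
have sW : size W = L + size W' by rewrite EW size_cat addnC.
have leW' : size W' <= size (rpow w m).
  by move: le; rewrite sW !size_rpow -/L mulSn leq_add2l.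
have tW' : W' = take (size W') (rpow w m).
  transitivity (take (size W') W); first by rewrite EW take_size_cat.
  by rewrite -tW take_takel ?sW ?leq_addl // rpowSr takel_cat.
have EW2 : W = w ++ W'.
  rewrite -[LHS]tW rpowS take_cat sW -/L ltnNge leq_addr /= addKn.
  by rewrite [in RHS]tW'.
have rW : reduced W by apply: rmul_reduced; apply: reduced_rpow.
apply: (mulIg (r ^+ n0)%g); rewrite -!mulgA -expgS; apply: val_inj.
rewrite !free_mulE !val_expg // -/W' (@rmul_cat w (rpow w n0)); last first.
  exact: (reduced_rpow n0.+1 cr).
by rewrite -rpowS -/W rmul_cat -EW2.
Qed.

(** A reduced word that is not cyclically reduced starts with a letter and ends with its inverse;
    stripping both conjugates it to a shorter word. *)
Lemma cyc_reduced_conj x : x <> 1%g ->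
  exists c r, cyc_reduced (val r) /\ x = (c * r * c^-1)%g.
Proof.
have [n] := ubnP (flen x); elim: n x => // n IH x ltn x1.
have [cx|ncx] := boolP (cyc_reduced (val x)).
  by exists 1%g, x; split=> //; rewrite invg1 mulg1 mul1g.
have [w Ew] : exists w, val x = w by exists (val x).
have rx := valP x; rewrite Ew in ncx rx.
case: w rx ncx Ew => [|a w] rx ncx Ew; first by case: x1; apply: val_inj.
have la : last a w = linv a.
  apply/eqP; apply: contraNT ncx => nla; rewrite /cyc_reduced /reduced /=.
  rewrite cat_path /=; move: (rx); rewrite /reduced /= => ->; rewrite andbT.
  by apply: contra nla => /eqP E; rewrite [in linv a]E linvK.
case/lastP: w rx la {ncx} Ew => [|v b] rx /=.
  by move=> E; have := congr1 snd E; rewrite /=; case: a.2.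
rewrite last_rcons => ->; rewrite -cats1 -cat1s catA => Ew'.
have Ew : val x = ([:: a] ++ v) ++ [:: linv a] := Ew'.
have rw : reduced (([:: a] ++ v) ++ [:: linv a]) by rewrite -Ew; exact: (valP x).
have [rav _] := reduced_catP rw.
have [_ rv] := reduced_catP rav.
pose A := free_word (w := [:: a]) isT; pose V := free_word rv.
have Ex : x = (A * V * A^-1)%g.
  apply: val_inj; rewrite !free_mulE Ew -(rmul_cat rw) (rmul_cat (u := val A)) //.
have V1 : V <> 1%g.
  move=> V1; apply: x1; by rewrite Ex V1 mulg1 mulgV.
case: (IH V _ V1) => [|c [r [cr EV]]].
  by move: ltn; rewrite /flen Ew !size_cat /=; lia.
by exists (A * c)%g, r; split=> //; rewrite Ex EV invgM !mulgA.
Qed.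

Lemma expg_conj (x c : free_group k) n : ((c * x * c^-1) ^+ n = c * x ^+ n * c^-1)%g.
Proof.
elim: n => [|n IH]; first by rewrite !expg0 mulg1 mulgV.
by rewrite !expgS IH !mulgA mulgVK.
Qed.

Lemma flen_conj_le (x c : free_group k) : flen (c * x * c^-1)%g <= flen x + (flen c).*2.
Proof.
have := flenM (c * x)%g (c^-1)%g; have := flenM c x; rewrite flenV; lia.
Qed.

Lemma flen_conj_ge (x c : free_group k) : flen x <= flen (c * x * c^-1)%g + (flen c).*2.
Proof.
have := flen_conj_le (c * x * c^-1)%g c^-1%g.
by rewrite invgK flenV !mulgA mulVg mul1g mulgVK.
Qed.

(** Conjugation changes lengths by a bounded amount, and the n-th power of the cyclically reduced
    core has at least n letters. *)
Lemma flen_expg_ge x : x <> 1%g -> exists C, forall n, n <= flen (x ^+ n)%g + C.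
Proof.
move=> /cyc_reduced_conj[c [r [cr ->]]]; exists (flen c).*2 => n.
rewrite expg_conj; apply: leq_trans (flen_conj_ge _ c).
rewrite flen_expg_cyc //; have := flen_cyc_gt0 cr; nia.
Qed.

Local Ltac flen_lia :=
  repeat match goal with H : context [flen _] |- _ => move: H end;
  repeat match goal with |- context [lcp ?x ?y] => move: (lcp x y) => ? end;
  repeat match goal with |- context [flen ?x] => move: (flen x) => ? end;
  lia.

Lemma conj_noncommuting (x y c : free_group k) : (x * y <> y * x)%g ->
  ((c^-1 * x * c) * (c^-1 * y * c) <> (c^-1 * y * c) * (c^-1 * x * c))%g.
Proof.
move=> nc; rewrite !mulgA !mulgK => E; apply: nc.
by apply: (mulgI c^-1%g); apply: (mulIg c); rewrite !mulgA.
Qed.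

(** Conjugate q to a cyclically reduced r and x to x'. The length of r^-n x' r^n falls short of
    2|r^n| by at most |x'| plus twice the common prefix of r^n and x' r^n, which is bounded since x'
    and r do not commute. *)
Lemma flen_conj_expg q x : (x * q <> q * x)%g -> exists C, forall n,
  (flen (q ^+ n)%g).*2 <= flen ((q ^+ n)^-1 * x * q ^+ n)%g + C.
Proof.
move=> nc; have q1 : q <> 1%g by move=> q1; apply: nc; rewrite q1 mulg1 mul1g.
have [c [r [cr Eq]]] := cyc_reduced_conj q1.
pose x' := (c^-1 * x * c)%g.
have nc' : (x' * r <> r * x')%g.
  by have := conj_noncommuting (c := c) nc; rewrite Eq !mulgA mulVg !mul1g !mulgVK.
have [C HC] := lcp_cyc_noncommuting cr nc'.
exists (C.*2 + flen x' + ((flen c).*2).*2 + (flen c).*2) => n.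
have := HC n; have := flenVM (r ^+ n)%g (x' * r ^+ n)%g.
have := flenM (x'^-1)%g (x' * r ^+ n)%g; rewrite mulKg flenV.
have := flen_conj_le (r ^+ n)%g c; rewrite -expg_conj -Eq.
have -> : ((r ^+ n)^-1 * (x' * r ^+ n) =
    c^-1 * ((q ^+ n)^-1 * x * q ^+ n) * c^-1^-1)%g.
  by rewrite Eq expg_conj /x' !invgM !invgK !mulgA mulVg mul1g mulgVK.
have := flen_conj_le ((q ^+ n)^-1 * x * q ^+ n)%g c^-1%g.
rewrite flenV; flen_lia.
Qed.

(* Otherwise [p^-n q p^n = q] for all multiples [n] of [d], against the linear
   growth of its length. *)
Lemma expg_noncommuting p q d : (p * q <> q * p)%g -> 0 < d ->
  (p ^+ d * q <> q * p ^+ d)%g.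
Proof.
move=> nc d0 c; have p1 : p <> 1%g by move=> p1; apply: nc; rewrite p1 mulg1 mul1g.
have [C HC] := flen_conj_expg (nesym nc).
have [D HD] := flen_expg_ge p1.
have := HC (d * (D + C + flen q).+1); have := HD (d * (D + C + flen q).+1).
set n := d * _.
have /commuteX cn : commute q (p ^+ d)%g by exact: esym.
have -> : ((p ^+ n)^-1 * q * p ^+ n)%g = q.
  by rewrite -mulgA /n expgnA cn mulKg.
have : (D + C + flen q).+1 <= n by rewrite leq_pmull.
flen_lia.
Qed.


(** Write s_i for the i-th word. Up to powers of p at both ends, s_h^-1 s_j is q^-n p^(j-h) q^n, of
    length at least 2|q^n| minus a constant by [flen_conj_expg]. As |s_i| is |q^n| up to a constant,
    common prefixes stay bounded while |s_i| grows with n. The inverses are treated alike, through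
    q^n p^(j-h) q^-n. *)
Lemma ping_pong p q : (p * q <> q * p)%g -> exists n l : nat,
  forall i, i < 5 -> l.*2 <= flen (p ^+ i * q ^+ n * p ^+ (4 - i))%g /\
  forall j, j < 5 -> i != j ->
    lcp (val (p ^+ i * q ^+ n * p ^+ (4 - i))%g)
        (val (p ^+ j * q ^+ n * p ^+ (4 - j))%g) < l /\
    lcp (val (p ^+ i * q ^+ n * p ^+ (4 - i))^-1%g)
        (val (p ^+ j * q ^+ n * p ^+ (4 - j))^-1%g) < l.
Proof.
move=> nc.
have flenX i : i < 5 -> flen (p ^+ i)%g <= 4 * flen p.
  have : flen (p ^+ i)%g <= i * flen p.
    by elim: i => // i IH; rewrite expgS mulSn; have := flenM p (p ^+ i)%g; flen_lia.
  by move=> le lt5; apply: leq_trans le _; rewrite leq_mul2r -ltnS lt5 orbT.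
have ncV d : 0 < d -> (p ^+ d * q^-1 <> q^-1 * p ^+ d)%g.
  move=> d0 c; apply: (expg_noncommuting nc d0).
  by apply: (mulgI q^-1%g); apply: (mulIg q^-1%g); rewrite mulKg mulgA c !mulgK.
have [C HC] : exists C, forall d n, 0 < d < 5 ->
    (flen (q ^+ n)%g).*2 <= flen ((q ^+ n)^-1 * p ^+ d * q ^+ n)%g + C /\
    (flen (q ^+ n)%g).*2 <= flen (q ^+ n * p ^+ d * (q ^+ n)^-1)%g + C.
  have H d : exists C, forall n, 0 < d ->
    (flen (q ^+ n)%g).*2 <= flen ((q ^+ n)^-1 * p ^+ d * q ^+ n)%g + C /\
    (flen (q ^+ n)%g).*2 <= flen (q ^+ n * p ^+ d * (q ^+ n)^-1)%g + C.
    case: d => [|d]; first by exists 0.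
    have [C1 H1] := flen_conj_expg (expg_noncommuting (d := d.+1) nc isT).
    have [C2 H2] := flen_conj_expg (@ncV d.+1 isT).
    exists (C1 + C2) => n _; have := H1 n; have := H2 n.
    by rewrite expVgn invgK flenV; flen_lia.
  have [C1 H1] := H 1; have [C2 H2] := H 2; have [C3 H3] := H 3; have [C4 H4] := H 4.
  exists (C1 + C2 + C3 + C4) => -[|[|[|[|[|//]]]]] n //= _.
  - by have [] := H1 n isT; flen_lia.
  - by have [] := H2 n isT; flen_lia.
  - by have [] := H3 n isT; flen_lia.
  - by have [] := H4 n isT; flen_lia.
have q1 : q <> 1%g by move=> q1; apply: nc; rewrite q1 mulg1 mul1g.
have [D HD] := flen_expg_ge q1.
(* The multiples of |p| absorb the powers p^i with i < 5, each of length at most 4|p|; 100 is not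
   sharp. [D] is the defect in the linear growth of |q^n|. *)
pose l := (C + 100 * flen p).+1.
pose n := l.*2 + D + 100 * flen p; exists n, l.
have qn : l.*2 + 100 * flen p <= flen (q ^+ n)%g by have := HD n; rewrite /n; flen_lia.
pose s i := (p ^+ i * q ^+ n * p ^+ (4 - i))%g.
have s_le i : i < 5 -> flen (s i) <= flen (q ^+ n)%g + 8 * flen p.
  move=> i5; have := flenM (p ^+ i * q ^+ n)%g (p ^+ (4 - i))%g.
  have := flenM (p ^+ i)%g (q ^+ n)%g; have := flenX i i5.
  have : 4 - i < 5 by flen_lia.
  by move=> /flenX; rewrite /s; flen_lia.
move=> i i5; split.
  have := flenM ((p ^+ i)^-1 * s i)%g (p ^+ (4 - i))^-1%g.
  have -> : ((p ^+ i)^-1 * s i * (p ^+ (4 - i))^-1)%g = (q ^+ n)%g.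
    by rewrite /s !mulgA mulVg mul1g mulgK.
  have := flenM (p ^+ i)^-1%g (s i); rewrite !flenV.
  have : 4 - i < 5 by flen_lia.
  by move: (flenX i i5) => ? /flenX; rewrite -/(s i); flen_lia.
rewrite -/(s i).
suff H j h : h < j -> j < 5 -> lcp (val (s h)) (val (s j)) < l /\
    lcp (val (s h)^-1%g) (val (s j)^-1%g) < l.
  move=> j j5; rewrite neq_ltn => /orP[ij|ji]; first exact: H.
  by rewrite lcpC [X in _ /\ (X < _)]lcpC; apply: H.
move=> hj j5; have h5 : h < 5 by apply: ltn_trans j5.
have [c1 c2] : (flen (q ^+ n)%g).*2 <= flen ((q ^+ n)^-1 * p ^+ (j - h) * q ^+ n)%g + C /\
    (flen (q ^+ n)%g).*2 <= flen (q ^+ n * p ^+ (j - h) * (q ^+ n)^-1)%g + C.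
  by apply: HC; flen_lia.
have Ej : (p ^+ j = p ^+ h * p ^+ (j - h))%g by rewrite -expgnDr subnKC // ltnW.
have E4 : (p ^+ (4 - h) = p ^+ (j - h) * p ^+ (4 - j))%g.
  by rewrite -expgnDr; congr (p ^+ _)%g; lia.
have E1 : ((q ^+ n)^-1 * p ^+ (j - h) * q ^+ n =
    p ^+ (4 - h) * ((s h)^-1 * s j) * (p ^+ (4 - j))^-1)%g.
  by rewrite /s Ej !invgM !mulgA mulgV mul1g mulgVK mulgK.
have E2 : (q ^+ n * p ^+ (j - h) * (q ^+ n)^-1 =
    (p ^+ h)^-1 * ((s h)^-1^-1 * (s j)^-1) * p ^+ j)%g.
  by rewrite /s E4 invgK !invgM !mulgA mulVg mul1g mulgK mulgVK.
have h4 : 4 - h < 5 by flen_lia.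
have j4 : 4 - j < 5 by flen_lia.
have := flenX _ h4; have := flenX _ j4; have := flenX _ h5; have := flenX _ j5.
have := s_le _ h5; have := s_le _ j5.
have := flenVM (s h) (s j); have := flenVM (s h)^-1%g (s j)^-1%g; rewrite !flenV.
move: c1 c2; rewrite E1 E2.
have := flenM (p ^+ (4 - h) * ((s h)^-1 * s j))%g (p ^+ (4 - j))^-1%g.
have := flenM (p ^+ (4 - h))%g ((s h)^-1 * s j)%g.
have := flenM ((p ^+ h)^-1 * ((s h)^-1^-1 * (s j)^-1))%g (p ^+ j)%g.
have := flenM ((p ^+ h)^-1)%g ((s h)^-1^-1 * (s j)^-1)%g.
rewrite !flenV /l; flen_lia.
Qed.

End FreeGroupWords.

(** * Ends fixed by the support *)

Section TreeRays.
Variable k : nat.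
Implicit Types (a b : letter k) (u v w : seq (letter k)) (c p q r x y z : free_group k).
Local Open Scope nat_scope.

Definition free_letter a : free_group k := free_word (w := [:: a]) isT.

Lemma tree_gensE x : (x \in @tree_gens k) = (flen x == 1).
Proof.
apply/idP/idP => [/existsP[i /orP[]/eqP -> //]|].
have [w Ew] : exists w, val x = w by exists (val x).
rewrite /flen Ew; case: w Ew => [|[i b] [|//]] // Ew _.
apply/existsP; exists i; apply/orP.
by case: b Ew => Ew; [right|left]; apply/eqP/val_inj; rewrite Ew.
Qed.

Lemma tree_adj_sym x y : tree_adj x y -> tree_adj y x.
Proof. by rewrite /tree_adj /cayley_adj !tree_gensE -flenV invgM invgK. Qed.

Lemma tree_adjM p x y : tree_adj (p * x)%g (p * y)%g = tree_adj x y.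
Proof. by rewrite /tree_adj /cayley_adj invgM -mulgA mulKg. Qed.

Lemma tree_adj_rcons x y a : val y = rcons (val x) a -> tree_adj x y.
Proof.
move=> Ey; rewrite /tree_adj /cayley_adj tree_gensE.
have := flenVM x y; have : size (val x) <= lcp (val x) (val y).
  by rewrite -prefix_lcp Ey -cats1 prefix_prefix.
have := lcp_leql (val x) (val y).
rewrite {3}/flen Ey size_rcons -Ey /flen.
move: (size _) (size _) (lcp _ _) => *; lia.
Qed.

Lemma tree_adjP x y : tree_adj x y ->
  (exists a, val y = rcons (val x) a) \/ (exists a, val x = rcons (val y) a).
Proof.
rewrite /tree_adj /cayley_adj tree_gensE => /eqP l1.
have := flenVM x y; rewrite l1.
have := lcp_leql (val x) (val y); have := lcp_leqr (val x) (val y).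
move=> l2 l3 E.
have rc u v : size v = (size u).+1 -> size u <= lcp u v -> exists a, v = rcons u a.
  case/lastP: v => [//|v a]; rewrite size_rcons => -[suv].
  by rewrite -prefix_lcp prefixE -cats1 -suv take_size_cat // => /eqP <-; exists a; rewrite cats1.
have [lt|le] := ltnP (flen x) (flen y).
  by left; apply: rc; move: E lt l2 l3; rewrite /flen; move: (size _) (size _) (lcp _ _) => *; lia.
right; apply: rc; rewrite ?(lcpC (val y)); move: E le l2 l3; rewrite /flen; move: (size _) (size _) (lcp _ _) => *; lia.
Qed.

Lemma flen_adj x y : tree_adj x y -> flen y <= (flen x).+1.
Proof.
by move=> /tree_adjP[] [a E]; rewrite /flen E size_rcons // ltnW.
Qed.

Section Axis.
Variables (c r : free_group k).
Hypothesis cr : cyc_reduced (val r).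

Let L0 : 0 < size (val r). Proof. exact: flen_cyc_gt0 cr. Qed.

Lemma take_rpow m n : n <= m -> take n (rpow (val r) m) = take n (rpow (val r) n).
Proof.
move=> nm; rewrite -(subnKC nm) /rpow nseqD flatten_cat takel_cat //.
by rewrite size_rpow; nia.
Qed.

Lemma reduced_take n w : reduced w -> reduced (take n w).
Proof. by move=> rw; apply: (proj1 (@reduced_catP _ _ (drop n w) _)); rewrite cat_take_drop. Qed.

(** The ray r r r ... from the identity: r is nonempty, so r^n has at least n letters. *)
Definition axis_ray n : free_group k :=
  free_word (reduced_take n (reduced_rpow n cr)).

Lemma val_axis_ray m n : n <= m -> val (axis_ray n) = take n (rpow (val r) m).
Proof. by move=> nm; rewrite take_rpow. Qed.

Lemma flen_axis_ray n : flen (axis_ray n) = n.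
Proof. by rewrite /flen size_takel // size_rpow; nia. Qed.

Lemma axis_rayS n : exists a, val (axis_ray n.+1) = rcons (val (axis_ray n)) a.
Proof.
have [a _] : exists a : letter k, true by case: (val r) L0 => // a w _; exists a.
exists (nth a (rpow (val r) n.+1) n).
rewrite (@val_axis_ray n.+1) // (@val_axis_ray n.+1 n) // (take_nth a) //.
by rewrite size_rpow; nia.
Qed.

Lemma axis_ray_tree_ray : tree_ray (fun n => (c * axis_ray n)%g).
Proof.
split; last by move=> n; rewrite tree_adjM; have [a] := axis_rayS n; apply: tree_adj_rcons.
by move=> i j /mulgI/(congr1 (@flen k)); rewrite !flen_axis_ray.
Qed.

Lemma axis_ray_mulS p n : flen p < n ->
  flen (p * axis_ray n.+1)%g = (flen (p * axis_ray n)%g).+1.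
Proof.
move=> pn; rewrite /flen !free_mulE; have [a Ea] := axis_rayS n.
have : reduced (val (axis_ray n.+1)) by exact: valP.
rewrite Ea -cats1 => red.
rewrite rmul_catr ?(valP p) //; last by rewrite -!/(flen _) flen_axis_ray.
by rewrite size_cat addn1.
Qed.

(** Since p r^t = r^t p, the word of p r^t agrees with that of r^t except for at most the last |p|
    letters of r^t. For t = n + 2|p| the agreement covers the initial part of p r^t that comes from
    the n-th point of the axis. *)
Lemma axis_ray_mul p n : (p * r = r * p)%g -> flen p < n ->
  (p * axis_ray n)%g = axis_ray (flen (p * axis_ray n)%g).
Proof.
move=> pr pn; set M := flen _.
pose t := n + (flen p).*2.
have prt : (p * r ^+ t = r ^+ t * p)%g by apply: commuteX.
have tn : n <= t by rewrite leq_addr.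
have Er : val (r ^+ t)%g = val (axis_ray n) ++ drop n (rpow (val r) t).
  by rewrite val_expg // (val_axis_ray tn) cat_take_drop.
have Ep : val (p * r ^+ t)%g = val (p * axis_ray n)%g ++ drop n (rpow (val r) t).
  rewrite free_mulE Er rmul_catr ?(valP p) //; last by rewrite -!/(flen _) flen_axis_ray.
  by rewrite -Er; exact: (valP (r ^+ t)%g).
have Mle : M <= flen p + n by have := flenM p (axis_ray n); rewrite flen_axis_ray.
have M_lcp : M <= lcp (val (r ^+ t)%g) (val (p * r ^+ t)%g).
  have := flenVM (r ^+ t)%g (p * r ^+ t)%g.
  have := flenM (r ^+ t * p)%g p^-1%g; rewrite mulgK flenV.
  rewrite !prt mulKg flen_expg_cyc //.
  have := flen_cyc_gt0 cr; rewrite -/(flen r).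
  have : t <= t * flen r by rewrite leq_pmulr // (flen_cyc_gt0 cr).
  move: (t * flen r) (flen (_ * p)%g) (lcp _ _) => *; lia.
have Mt : M <= t by lia.
move: M_lcp; rewrite lcp_take => /and3P[_ _].
rewrite Ep take_size_cat // val_expg // -(val_axis_ray Mt) => /eqP E.
by apply: val_inj; rewrite -E.
Qed.

Lemma axis_ray_shift p : (p * r = r * p)%g ->
  exists i j, forall n, (p * axis_ray (i + n))%g = axis_ray (j + n).
Proof.
move=> pr; pose i := (flen p).+1; exists i, (flen (p * axis_ray i)%g) => n.
rewrite axis_ray_mul //; last by rewrite /i; lia.
congr axis_ray; elim: n => [|n IH]; first by rewrite !addn0.
by rewrite !addnS axis_ray_mulS ?IH // /i; lia.
Qed.

End Axis.

Lemma tree_ray_mul p (s : nat -> free_group k) :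
  tree_ray s -> tree_ray (fun n => (p * s n)%g).
Proof.
by move=> [si sa]; split=> [i j /mulgI/si//|n]; rewrite tree_adjM.
Qed.

(** The end is that of the axis of q: an element commuting with q shifts the axis along itself, up
    to an initial piece. *)
Lemma fixed_end (q : free_group k) : q <> 1%g -> exists2 xi, is_end xi &
  forall p, (p * q = q * p)%g -> end_act p xi = xi.
Proof.
move=> /cyc_reduced_conj[c [r [cr ->]]].
pose rho n := (c * axis_ray cr n)%g.
have rr : tree_ray rho by apply: axis_ray_tree_ray.
exists [set s | tree_ray s /\ cofinal rho s]; first by exists rho.
move=> p pq.
have [i [j pij]] : exists i j, forall n, (p * rho (i + n)%N = rho (j + n)%N)%g.
  have : ((c^-1 * p * c) * r = r * (c^-1 * p * c))%g.
    apply: (mulgI c); apply: (mulIg c^-1%g).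
    by move: pq; rewrite !mulgA mulgV mul1g mulgK.
  move=> /(axis_ray_shift cr)[i [j H]]; exists i, j => n.
  by rewrite /rho -H !mulgA mulgV mul1g.
apply/seteqP; split=> [_ [s [rs [a [b sab]]] <-]|s [rs [a [b sab]]]].
  split; first exact: tree_ray_mul.
  exists (j + a), (b + i) => n.
  by rewrite -!addnA -pij -sab; congr (p * rho _)%g; lia.
exists (fun n => p^-1 * s n)%g; last by apply/funext => n; rewrite mulVKg.
split; first exact: tree_ray_mul.
exists (i + a), (b + j) => n; rewrite -!addnA -sab.
apply: (mulgI p); rewrite mulVKg pij; congr rho; lia.
Qed.

End TreeRays.

Lemma noncommuting_support (R : realType) (m k : nat) (hk : (2 <= k)%N)
    (mu : probability (lamplighter m k) R)
    (hends : forall E : set (set (nat -> free_group k)),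
       E `<=` is_end (k := k) -> E !=set0 -> finite_set E ->
       ~ fixes_ends (supp mu) E) :
  exists g h, [/\ supp mu g, supp mu h & (g.1 * h.1 <> h.1 * g.1)%g].
Proof.
apply: contrapT => H.
have comm g h : supp mu g -> supp mu h -> (g.1 * h.1 = h.1 * g.1)%g.
  by move=> sg sh; apply: contrapT => nc; apply: H; exists g, h.
have [q q1 cq] : exists2 q : free_group k, q <> 1%g &
    forall g, supp mu g -> (g.1 * q = q * g.1)%g.
  have [[g sg g1]|N] := pselect (exists2 g, supp mu g & g.1 <> 1%g).
    by exists g.1 => // h sh; apply: comm.
  (* Here the projected support is trivial, so any nontrivial q will do. *)
  exists (free_letter (Ordinal (ltnW hk), false)).
    by move=> /(congr1 (@flen k)).
  move=> g sg; have -> : g.1 = 1%g by apply: contrapT => g1; apply: N; exists g.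
  by rewrite mulg1 mul1g.
have [xi exi fxi] := fixed_end q1.
apply: (hends [set xi]).
- by move=> _ ->.
- by exists xi.
- exact: finite_set1.
- move=> g sg; apply/seteqP; split=> [_ [_ -> <-]|_ ->] /=.
    by rewrite fxi //; apply: cq.
  by exists xi => //; rewrite fxi //; apply: cq.
Qed.

(** * Word metrics and geodesic rays *)

Lemma inf_eq_min (R : realType) (A : set R) (x : R) :
  A x -> (forall y, A y -> x <= y) -> inf A = x.
Proof.
move=> Ax lb; apply/eqP; rewrite eq_le; apply/andP; split.
  by apply: ge_inf => //; exists x.
by apply: lb_le_inf => //; exists x.
Qed.

Section CayleyMetric.
Variables (G : groupType) (S : {pred G}).
Implicit Types (g h u v w : G).

Definition reach n g h := exists p : seq G,
  [/\ path (cayley_adj S) g p, last g p = h & size p = n].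

(** Integer form of [graph_dist]. In a connected graph the minimum exists, so the default 0 of
    [xget] is not taken. *)
Definition gdist g h : nat :=
  xget 0%N [set n | reach n g h /\ forall i, reach i g h -> (n <= i)%N].

Hypothesis conn : forall g h, exists n, reach n g h.
Hypothesis adj_sym : forall g h, cayley_adj S g h -> cayley_adj S h g.

Lemma gdist_spec g h : reach (gdist g h) g h /\
  forall i, reach i g h -> (gdist g h <= i)%N.
Proof.
have [n0 r0] := conn g h.
have ex : exists n, `[< reach n g h >] by exists n0; apply/asboolP.
case: (ex_minnP ex) => n /asboolP rn minn.
rewrite /gdist; case: xgetP => [i _ [] //|/(_ n)[]].
by split=> // i ri; apply: minn; apply/asboolP.
Qed.

Lemma gdistP g h : reach (gdist g h) g h.
Proof. by case: (gdist_spec g h). Qed.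

Lemma gdist_le n g h : reach n g h -> (gdist g h <= n)%N.
Proof. by case: (gdist_spec g h) => _; apply. Qed.

Lemma gdistxx g : gdist g g = 0%N.
Proof. by apply/eqP; rewrite -leqn0; apply: gdist_le; exists [::]. Qed.

Lemma gdist_eq0 g h : gdist g h = 0%N -> g = h.
Proof. by have := gdistP g h => -[p [_ + +]] gh0; rewrite gh0; case: p. Qed.

Lemma gdist_triangle g h u : (gdist g u <= gdist g h + gdist h u)%N.
Proof.
have [p [pp lp <-]] := gdistP g h; have [q [pq lq <-]] := gdistP h u.
apply: gdist_le; exists (p ++ q); split; last by rewrite size_cat.
  by rewrite cat_path pp lp.
by rewrite last_cat lp.
Qed.

Lemma gdist_adj g h : cayley_adj S g h -> (gdist g h <= 1)%N.
Proof. by move=> a; apply: gdist_le; exists [:: h]; rewrite /= a. Qed.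

Lemma gdist_adj1 g h : gdist g h = 1%N -> cayley_adj S g h.
Proof.
by have := gdistP g h => -[p [+ + +]] E; rewrite E; case: p => [//|a [|//]] /= /andP[+ _] <-.
Qed.

(** Telescoping along a shortest path. Symmetry, left invariance, the bound on the growth of |y| and
    the splitting at a cut vertex are all instances. *)
Lemma gdist_ge (F : G -> G -> nat) : (forall g, F g g = 0%N) ->
  (forall g h u, (F g u <= F g h + F h u)%N) ->
  (forall g h, cayley_adj S g h -> (F g h <= 1)%N) ->
  forall g h, (F g h <= gdist g h)%N.
Proof.
move=> F0 Ft F1 g h; have [p [pp <- <-]] := gdistP g h.
elim: p g pp => [|a p IH] g /=; first by rewrite F0.
move=> /andP[ga pa]; apply: leq_trans (Ft _ a _) _.
by rewrite -add1n leq_add ?F1 ?IH.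
Qed.

Lemma gdistC g h : gdist g h = gdist h g.
Proof.
wlog suff H : g h / (gdist h g <= gdist g h)%N.
  by apply/eqP; rewrite eqn_leq !H.
apply: (@gdist_ge (fun g h => gdist h g)) => [|u v w|u v /adj_sym/gdist_adj //].
  exact: gdistxx.
by rewrite addnC gdist_triangle.
Qed.

Lemma gdistM g u v : gdist (g * u)%g (g * v)%g = gdist u v.
Proof.
have H w x y : (gdist (w * x)%g (w * y)%g <= gdist x y)%N.
  apply: (@gdist_ge (fun x y => gdist (w * x)%g (w * y)%g)) => [*|*|a b ab].
  - exact: gdistxx.
  - exact: gdist_triangle.
  - by apply: gdist_adj; rewrite cayley_adjM.
apply/eqP; rewrite eqn_leq H /=.
by have := H (g^-1)%g (g * u)%g (g * v)%g; rewrite !mulKg.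
Qed.

Variable R : realType.

Lemma graph_distE g h : graph_dist R S g h = (gdist g h)%:R.
Proof.
rewrite /graph_dist; apply: inf_eq_min.
  have [p [pp lp sp]] := gdistP g h.
  by exists p => //=; rewrite sp.
move=> _ [p /= [pp lp] <-]; rewrite ler_nat; apply: gdist_le.
by exists p.
Qed.

Notation point := (cayley_point R S).

Lemma outer_nonempty (p q : point) : outer_lengths p q !=set0.
Proof.
have exitsN0 (r : point) : exists a, a \in exits r.
  by case: r => [g|g h gh s s01]; [exists (g, 0)|exists (g, s)]; rewrite !inE eqxx.
have [a ap] := exitsN0 p; have [b bq] := exitsN0 q.
by eexists; exists a => //; exists b.
Qed.

Lemma exits_ge0 (p : point) a : a \in exits p -> 0 <= a.2.
Proof.
case: p => [g|g h gh s s01]; rewrite !inE.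
  by move=> /eqP -> /=.
have /andP[s0 s1] := s01.
by move=> /orP[] /eqP -> /=; rewrite ?subr_ge0 ltW.
Qed.

Lemma cayley_lengths_ge0 (p q : point) l :
  (outer_lengths p q `|` inner_lengths p q) l -> 0 <= l.
Proof.
case=> [[a ap [b bq ->]]|].
  by rewrite !addr_ge0 ?(exits_ge0 ap) ?(exits_ge0 bq) // graph_distE.
by case: p => [g|g h gh s s01]; case: q => [g'|g' h' gh' t t01] //= [] [_ _ ->].
Qed.

Lemma cayley_dist_ge0 (p q : point) : 0 <= cayley_dist p q.
Proof.
apply: lb_le_inf.
  by have [l ol] := outer_nonempty p q; exists l; left.
by move=> l /cayley_lengths_ge0.
Qed.

Lemma cayley_dist_le_exits (p q : point) a b : a \in exits p -> b \in exits q ->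
  cayley_dist p q <= a.2 + (gdist a.1 b.1)%:R + b.2.
Proof.
move=> ap bq; apply: ge_inf; first by exists 0 => l /cayley_lengths_ge0.
by left; exists a => //; exists b => //; rewrite graph_distE.
Qed.

(** Moves the base point of a displacement from any point of the graph to an end of its edge, at a
    cost of 1 on either side. *)
Lemma cayley_dist_act (p : point) : exists g, forall h,
  (gdist g (h * g)%g)%:R <= cayley_dist p (cayley_act h p) + 2.
Proof.
have [g Hg] : exists g, forall a, a \in exits p -> (gdist g a.1 <= 1)%N.
  case: p => [g|g h gh s s01]; exists g => a; rewrite !inE.
    by move=> /eqP ->; rewrite gdistxx.
  by move=> /orP[] /eqP ->; rewrite ?gdistxx // gdist_adj.
exists g => h; rewrite -lerBlDr; apply: lb_le_inf.
  by have [l ol] := outer_nonempty p (cayley_act h p); exists l; left.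
move=> l [[a ap [b bq ->]]|].
  have {}bq : exists2 b', b' \in exits p & b.1 = (h * b'.1)%g /\ b.2 = b'.2.
    case: p bq {Hg ap} => [u|u v uv s s01] /=; rewrite !inE.
      by move=> /eqP ->; exists (u, 0); rewrite ?inE.
    by move=> /orP[] /eqP ->; [exists (u, s)|exists (v, 1 - s)]; rewrite ?inE ?eqxx ?orbT.
  have [b' bp [b1 b2]] := bq.
  rewrite b1 b2 graph_distE.
  have a0 := exits_ge0 ap; have b0 := exits_ge0 bp.
  have : (gdist g (h * g)%g <= 1 + gdist a.1 (h * b'.1)%g + 1)%N.
    apply: leq_trans (gdist_triangle _ (h * b'.1)%g _) _.
    rewrite leq_add //; last by rewrite gdistM gdistC Hg.
    by apply: leq_trans (gdist_triangle _ a.1 _) _; rewrite leq_add ?Hg.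
  rewrite -(ler_nat R) !natrD; lra.
move=> il; have [lgh|_] := leqP (gdist g (h * g)%g) 1.
  have l0 : 0 <= l by apply: (@cayley_lengths_ge0 p (cayley_act h p)); right.
  by move: lgh; rewrite -(ler_nat R); lra.
move: il; case: p Hg => [//|u v uv s s01] /= Hg.
have gu : (gdist g u <= 1)%N by apply: (Hg (u, s)); rewrite inE eqxx.
have gv : (gdist g v <= 1)%N by apply: (Hg (v, 1 - s)); rewrite !inE eqxx orbT.
(* An inner length occurs only when h fixes or reverses the edge carrying the point, and then [g]
   moves by at most 2. *)
have big x y : (gdist g x <= 1)%N -> (gdist g y <= 1)%N -> x = (h * y)%g ->
    (gdist g (h * g)%g <= 2)%N.
  move=> gx gy E; apply: leq_trans (gdist_triangle _ x _) _.
  by rewrite -[2%N]/(1 + 1)%N leq_add // E gdistM gdistC.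
move=> [] [E1 E2 ->].
  have := big u u gu gu E1; rewrite -(ler_nat R); have := normr_ge0 (s - s); lra.
have := big u v gu gv E1; rewrite -(ler_nat R); have := normr_ge0 (s - (1 - s)); lra.
Qed.

Section Ray.
Variable v : nat -> G.
Hypothesis v_geodesic : forall i j, (i <= j)%N -> gdist (v i) (v j) = (j - i)%N.

Lemma ray_adj i : cayley_adj S (v i) (v i.+1).
Proof. by apply: gdist_adj1; rewrite v_geodesic // subSnn. Qed.

Lemma ray_dist i j : (gdist (v i) (v j))%:R = `|i%:R - j%:R| :> R.
Proof.
wlog ij : i j / (i <= j)%N.
  by move=> H; have [/H //|/ltnW/H] := leqP i j; rewrite gdistC distrC.
by rewrite v_geodesic // natrB // distrC ger0_norm // subr_ge0 ler_nat.
Qed.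

Lemma ray_inj i j : v i = v j -> i = j.
Proof.
move=> E; have := ray_dist i j; rewrite E gdistxx => /esym/eqP.
by rewrite normr_eq0 subr_eq0 eqr_nat => /eqP.
Qed.

(** [pselect] supplies the proof that [EdgePoint] takes as an argument; for t >= 0 the [Vertex]
    branch is reached exactly at integers. *)
Definition cayley_ray (t : R) : point :=
  let n := Num.truncn t in
  match pselect (0 < t - n%:R < 1) with
  | left t01 => EdgePoint (ray_adj n) t01
  | right _ => Vertex (v n)
  end.

Lemma cayley_rayP t : 0 <= t ->
  (exists n, t = n%:R /\ cayley_ray t = Vertex (v n)) \/
  (exists n (t01 : 0 < t - n%:R < 1), cayley_ray t = EdgePoint (ray_adj n) t01).
Proof.
move=> t0; rewrite /cayley_ray.
have /andP[le lt] := truncn_itv t0.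
case: pselect => [t01|N]; first by right; exists (Num.truncn t), t01.
left; exists (Num.truncn t); split => //; apply/eqP.
move: N; rewrite subr_gt0 ltrBlDr addrC natr1 lt andbT => /negP; rewrite -leNgt => ge.
by rewrite eq_le le ge.
Qed.

Lemma cayley_ray_exits t a : 0 <= t -> a \in exits (cayley_ray t) ->
  exists i, a = (v i, `|t - i%:R|).
Proof.
move=> /cayley_rayP[[n [-> ->]]|[n [t01 ->]]]; rewrite !inE.
  by move=> /eqP ->; exists n; rewrite subrr normr0.
have /andP[t0 t1] := t01.
move=> /orP[] /eqP ->; [exists n|exists n.+1]; congr pair.
  by rewrite ger0_norm // ltW.
by rewrite -natr1 distrC ger0_norm; lra.
Qed.

Lemma cayley_ray_exit_up t (N : nat) : 0 <= t -> t <= N%:R ->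
  exists i, [/\ (v i, i%:R - t) \in exits (cayley_ray t), (i <= N)%N & t <= i%:R].
Proof.
move=> /cayley_rayP[[n [-> ->]]|[n [t01 ->]]] tN.
  by exists n; rewrite !inE subrr eqxx lexx; split=> //; rewrite -(ler_nat R).
have /andP[t0 t1] := t01; exists n.+1; split; rewrite -?natr1; last by lra.
  by rewrite !inE; apply/orP; right; apply/eqP; congr pair; lra.
by rewrite -(ltr_nat R); lra.
Qed.

Lemma cayley_ray_exit_down t (N : nat) : 0 <= t -> N%:R <= t ->
  exists i, [/\ (v i, t - i%:R) \in exits (cayley_ray t), (N <= i)%N & i%:R <= t].
Proof.
move=> /cayley_rayP[[n [-> ->]]|[n [t01 ->]]] tN.
  by exists n; rewrite !inE subrr eqxx lexx; split=> //; rewrite -(ler_nat R).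
have /andP[t0 t1] := t01; exists n; split; last by lra.
  by rewrite !inE eqxx.
by rewrite -ltnS -(ltr_nat R) -natr1; lra.
Qed.

(** Each exit of the point at time t is some [v i] at distance |t - i|, so the triangle inequality
    on the real line bounds the outer lengths from below. The value |s - t| is an outer length if an
    integer lies between s and t, and an inner one otherwise. *)
Lemma geodesic_cayley_ray : geodesic_ray cayley_ray.
Proof.
move=> s t s0 t0; apply: inf_eq_min; last first.
  move=> l [[a /(cayley_ray_exits s0)[i ->] [b /(cayley_ray_exits t0)[j ->] ->]]|].
    rewrite /= graph_distE ray_dist -addrA.
    have -> : s - t = (s - i%:R) + ((i%:R - j%:R) + (j%:R - t)) by lra.
    apply: le_trans (ler_normD _ _) _; rewrite lerD2l.
    by apply: le_trans (ler_normD _ _) _; rewrite (distrC t).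
  have [[n [_ ->]] //|[n [s01 ->]]] := cayley_rayP s0.
  have [[n' [_ ->]] //|[n' [t01 ->]]] := cayley_rayP t0.
  (* The reversed edge would force n = n' + 1 and n + 1 = n'. *)
  case=> /= -[/ray_inj E1 /ray_inj E2 ->]; last by lia.
  by rewrite -E1; have -> : s - n%:R - (t - n%:R) = s - t by lra.
have mid N : s <= N%:R <= t \/ t <= N%:R <= s ->
    outer_lengths (cayley_ray s) (cayley_ray t) `|s - t|.
  case=> /andP[le1 le2].
    have [i [ei iN si]] := cayley_ray_exit_up s0 le1.
    have [j [ej Nj jt]] := cayley_ray_exit_down t0 le2.
    exists (v i, i%:R - s) => //; exists (v j, t - j%:R) => //=.
    have ij : (i%:R : R) <= j%:R by rewrite ler_nat (leq_trans iN).
    by rewrite graph_distE ray_dist !(distrC s) !(distrC i%:R) !ger0_norm; lra.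
  have [i [ei iN si]] := cayley_ray_exit_up t0 le1.
  have [j [ej Nj jt]] := cayley_ray_exit_down s0 le2.
  exists (v j, s - j%:R) => //; exists (v i, i%:R - t) => //=.
  have ij : (i%:R : R) <= j%:R by rewrite ler_nat (leq_trans iN).
  by rewrite graph_distE ray_dist !ger0_norm; lra.
have [[n [sn _]]|[n [s01 Es]]] := cayley_rayP s0.
  by left; apply: (mid n); rewrite sn lexx /= andbT; apply/orP; exact: le_total.
have [[n' [tn _]]|[n' [t01 Et]]] := cayley_rayP t0.
  by left; apply: (mid n'); rewrite tn lexx /= andbT; apply/orP; exact: le_total.
have /andP[s1 s2] := s01; have /andP[t1 t2] := t01.
have [E|] := eqVneq n n'.
  right; rewrite Es Et /=; left; subst n'; split=> //.
  by have -> : s - n%:R - (t - n%:R) = s - t by lra.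
rewrite neq_ltn => /orP[] lt; left.
  apply: (mid n'); left; apply/andP; split; last by lra.
  by move: lt; rewrite -(ler_nat R) -natr1; lra.
apply: (mid n); right; apply/andP; split; last by lra.
by move: lt; rewrite -(ler_nat R) -natr1; lra.
Qed.

Lemma cayley_dist_ray_le w t : 0 <= t ->
  cayley_dist (Vertex w) (cayley_ray t) <= (gdist w (v (Num.truncn t)))%:R + 1.
Proof.
move=> t0; have /andP[le lt] := truncn_itv t0.
have [i [ei iN it]] := cayley_ray_exit_down t0 le.
have w0 : (w, 0 : R) \in exits (Vertex w : point) by rewrite inE.
have := cayley_dist_le_exits w0 ei; rewrite /= add0r.
have -> : i = Num.truncn t.
  apply/eqP; rewrite eqn_leq iN andbT -ltnS -(ltr_nat R).
  exact: le_lt_trans lt.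
by move: lt; rewrite -natr1; lra.
Qed.

End Ray.
End CayleyMetric.

(** * The metric of the lamplighter group *)

(* [lia] distinguishes atoms that are only convertible; ssreflect matching does not. *)
Ltac atom_lia :=
  repeat match goal with
  | H : context [flen _] |- _ => move: H
  | H : context [size _] |- _ => move: H
  end;
  repeat match goal with
  | |- context [gdist ?x ?y ?z] => move: (gdist x y z) => ?
  | |- context [flen ?x] => move: (flen x) => ?
  | |- context [size ?x] => move: (size x) => ?
  end; lia.

Section LamplighterMetric.
Variables m k : nat.
Implicit Types (x y z : lamplighter m k) (f g h : configuration m k) (u v : free_group k).

Definition conf_single (u : free_group k) (c : 'Z_m) : configuration m k :=
  [fsfun z in [fset u]%fset => c | 0].

Lemma conf_singleE u c v : conf_single u c v = if v == u then c else 0.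
Proof. by rewrite fsfunE inE. Qed.

Definition conf_mix (A : pred (free_group k)) f g : configuration m k :=
  [fsfun u in (finsupp f `|` finsupp g)%fset => if A u then f u else g u | 0].

Lemma conf_mixE A f g u : conf_mix A f g u = if A u then f u else g u.
Proof.
rewrite fsfunE inE; case: finsuppP => fu; case: finsuppP => gu //=.
by case: ifP.
Qed.

Local Notation adj := (cayley_adj (@lamp_gens m k)).

Lemma lamp_adj_sym x y : adj x y -> adj y x.
Proof.
move=> /lamp_adjE H; apply/lamp_adjE; case: H => [[E /tree_adj_sym t]|[E ne d]].
  by left.
right; split=> // [u|]; rewrite -E; first by move=> /ne.
by case: d => d; [right|left]; rewrite -opprB d ?opprK.
Qed.

Let linked x y := exists n, reach (@lamp_gens m k) n x y.

Let linked_trans y x z : linked x y -> linked y z -> linked x z.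
Proof.
move=> [a [p [pp lp _]]] [b [q [pq lq _]]]; eexists; exists (p ++ q); split; last by [].
  by rewrite cat_path pp lp.
by rewrite last_cat lp.
Qed.

Let linked_adj x y : adj x y -> linked x y.
Proof. by move=> a; exists 1%N, [:: y]; rewrite /= a. Qed.

Let linked_refl x : linked x x.
Proof. by exists 0%N, [::]. Qed.

Let linked_tree f u v : linked (u, f) (v, f).
Proof.
have H w : linked (u, f) ((u * w)%g, f).
  have [n] := ubnP (flen w); elim: n w => // n IH w wn.
  have [w0 E0] : exists w0, val w = w0 by exists (val w).
  case/lastP: w0 E0 => [|w0 a] E0.
    by have -> : w = 1%g; [exact: val_inj | rewrite mulg1].
  have r0 : reduced w0.
    by have : reduced (val w) by [exact: valP]; rewrite E0 -cats1 => /reduced_catP[].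
  apply: (@linked_trans ((u * free_word r0)%g, f)).
    by apply: IH; move: wn; rewrite /flen E0 size_rcons.
  apply: linked_adj; apply/lamp_adjE; left; split=> //=.
  by rewrite tree_adjM; exact: (@tree_adj_rcons _ (free_word r0) w a E0).
by have := H (u^-1 * v)%g; rewrite mulVKg.
Qed.

Let linked_lamp f u (c : 'Z_m) : linked (u, f) (u, f + conf_single u c).
Proof.
rewrite -[c]natr_Zp; elim: (c : nat) => [|n IH].
  have -> : conf_single u 0%:R = 0.
    by apply/fsfunP => v; rewrite conf_singleE conf_zeroE; case: ifP.
  by rewrite addr0.
apply: linked_trans IH _; apply: linked_adj; apply/lamp_adjE; right; split=> //=.
  by move=> v /negPf nv; rewrite !conf_addE !conf_singleE nv.
right; rewrite !conf_addE !conf_singleE eqxx -natr1.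
by rewrite addrA opprD addrA subrr sub0r.
Qed.

(** The walker visits one after the other the finitely many places where the lamps differ. *)
Lemma lamp_conn x y : exists n, reach (@lamp_gens m k) n x y.
Proof.
case: x y => [u f] [v g]; apply: (linked_trans (linked_tree f u v)).
have [s] : exists s : seq (free_group k), forall w, w \notin s -> f w = g w.
  exists (enum_fset (finsupp f `|` finsupp g)%fset) => w.
  rewrite -[_ \in _]/(w \in (finsupp f `|` finsupp g)%fset) inE negb_or.
  by case: finsuppP => _ //=; case: finsuppP => _ //=.
elim: s f => [|z s IH] f fg.
  have -> : f = g by apply/fsfunP => w; apply: fg.
  exact: linked_refl.
pose f1 : configuration m k := f + conf_single z (g z - f z).
apply: (@linked_trans (v, f1)); last first.
  apply: IH => w ws; rewrite conf_addE conf_singleE.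
  case: eqP => [->|/eqP wz]; first by rewrite addrC subrK.
  by rewrite addr0 fg // inE negb_or wz.
apply: (linked_trans (linked_tree f v z)).
by apply: (@linked_trans (z, f1)); [exact: linked_lamp|exact: linked_tree].
Qed.

Definition ldist x y : nat := gdist (@lamp_gens m k) x y.

Local Notation conn := lamp_conn.
Local Notation sym := lamp_adj_sym.

Lemma ldistxx x : ldist x x = 0%N. Proof. exact: (gdistxx conn). Qed.
Lemma ldist_triangle x y z : (ldist x z <= ldist x y + ldist y z)%N.
Proof. exact: (gdist_triangle conn). Qed.
Lemma ldistC x y : ldist x y = ldist y x. Proof. exact: (gdistC conn sym). Qed.
Lemma ldistM z x y : ldist (z * x)%g (z * y)%g = ldist x y.
Proof. exact: (gdistM conn). Qed.
Lemma ldist_adj x y : adj x y -> (ldist x y <= 1)%N. Proof. exact: (gdist_adj conn). Qed.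

Definition llen x := ldist 1%g x.

Lemma ldist_mulr x y : ldist x (x * y)%g = llen y.
Proof. by rewrite /llen -(ldistM x 1%g) mulg1. Qed.

Lemma llenM x y : (llen (x * y)%g <= llen x + llen y)%N.
Proof. by rewrite -(ldist_mulr x y) ldist_triangle. Qed.

Lemma llenV x : llen x^-1%g = llen x.
Proof. by rewrite /llen -(ldistM x 1%g) mulg1 mulgV ldistC. Qed.

Lemma lamp_step_tree x y : adj x y -> x.1 = y.1 \/ tree_adj x.1 y.1.
Proof. by move=> /lamp_adjE[[_ t]|[-> _ _]]; [right|left]. Qed.

Lemma flen_ldist x y : (flen y.1 <= flen x.1 + ldist x y)%N.
Proof.
have H : (flen y.1 - flen x.1 <= ldist x y)%N.
  apply: (@gdist_ge _ _ conn (fun x y => flen y.1 - flen x.1)%N) => [?|*|u v].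
  - by rewrite subnn.
  - by lia.
  - by move=> /lamp_step_tree[->|/flen_adj]; lia.
by lia.
Qed.

Lemma flen_llen x : (flen x.1 <= llen x)%N.
Proof. by have := flen_ldist 1%g x; rewrite flen1. Qed.

(** A lamp changes only where the walker stands, and a path this short never reaches level j. *)
Lemma lamps_near x y (j : nat) : (forall u, (j <= flen u)%N -> x.2 u = 0) ->
  (flen x.1 + ldist x y < j)%N -> forall u, (j <= flen u)%N -> y.2 u = 0.
Proof.
rewrite /ldist; have [p [pp <- <-]] := gdistP conn x y.
elim: p x pp => [//|z p IH] x /= /andP[xz pz] x0 lt.
apply: IH => // [u ju|].
  have /lamp_adjE[[<- _]|[E ne _]] := xz; first exact: x0.
  rewrite -ne ?x0 //; apply/eqP => ux; move: lt; rewrite -ux => lt.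
  by lia.
by have := flen_ldist x z; have := ldist_adj xz; rewrite /ldist; atom_lia.
Qed.

(** * Cones of the tree and the cut vertex at their root *)

Section Cone.
Variable c : free_group k.

Definition cone : pred (free_group k) := fun u => prefix (val c) (val u).

Lemma cone_root : cone c. Proof. exact: prefix_refl. Qed.

Lemma cone_flen u : cone u -> (flen c <= flen u)%N.
Proof. exact: size_prefix. Qed.

Lemma cone_adj u v : tree_adj u v -> cone u -> ~~ cone v -> u = c.
Proof.
rewrite /cone => /tree_adjP[] [a E].
  by rewrite E => cu; rewrite -cats1 (prefix_catl _ cu).
rewrite E prefixE => /eqP H; rewrite prefixE => nv.
apply: val_inj; rewrite E -H take_oversize // size_rcons leqNgt; apply/negP => lt.
by case/eqP: nv; rewrite -{2}H -cats1 takel_cat.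
Qed.

(** Retractions onto the two sides of c: the other side is collapsed to c and its lamps are replaced
    by those of [f]. The lamp at c counts as inside. *)
Definition outer_part f x : lamplighter m k :=
  (if cone x.1 then c else x.1, conf_mix cone f x.2).
Definition inner_part f x : lamplighter m k :=
  (if cone x.1 then x.1 else c, conf_mix cone x.2 f).

(* The two sides of the cut vertex [c] see disjoint sets of steps. *)
Lemma ldist_split f g x y :
  (ldist (outer_part f x) (outer_part f y) + ldist (inner_part g x) (inner_part g y)
     <= ldist x y)%N.
Proof.
apply: (@gdist_ge _ _ conn (fun x y => ldist (outer_part f x) (outer_part f y) +
    ldist (inner_part g x) (inner_part g y))%N) => [u|u v w|[u a] [v b]].
- by rewrite !ldistxx.
- have := ldist_triangle (outer_part f u) (outer_part f v) (outer_part f w).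
  by have := ldist_triangle (inner_part g u) (inner_part g v) (inner_part g w); lia.
move=> /lamp_adjE /= [[-> uv]|[-> ab d]].
  rewrite /outer_part /inner_part /=.
  have tree_step h : (ldist (u, h) (v, h) <= 1)%N.
    by apply: ldist_adj; apply/lamp_adjE; left.
  have [cu|cu] := boolP (cone u); have [cv|cv] := boolP (cone v).
  - by rewrite ldistxx add0n tree_step.
  - have -> : u = c by apply: cone_adj uv cu cv.
    by rewrite ldistxx addn0 -(cone_adj uv cu cv) tree_step.
  - have E := cone_adj (tree_adj_sym uv) cv cu.
    by rewrite E ldistxx addn0 -E tree_step.
  - by rewrite ldistxx addn0 tree_step.
have [cv|cv] := boolP (cone v).
  have -> : outer_part f (v, a) = outer_part f (v, b).
    rewrite /outer_part /=; congr pair; apply/fsfunP => w; rewrite !conf_mixE.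
    by case: ifPn => // cw; apply: ab; apply: contraNneq cw => ->.
  rewrite ldistxx add0n; apply: ldist_adj; apply/lamp_adjE; right.
  rewrite /= cv; split=> // [w wv|]; rewrite !conf_mixE ?cv //.
  by case: ifPn => // cw; apply: ab.
have -> : inner_part g (v, a) = inner_part g (v, b).
  rewrite /inner_part /=; congr pair; apply/fsfunP => w; rewrite !conf_mixE.
  by case: ifPn => // cw; apply: ab; apply: contraNneq cv => <-.
rewrite ldistxx addn0; apply: ldist_adj; apply/lamp_adjE; right.
rewrite /= (negPf cv); split=> // [w wv|]; rewrite !conf_mixE ?(negPf cv) //.
by case: ifPn => // cw; apply: ab.
Qed.

(** At the cut state the walker stands at c with the lamps outside the cone finished and those
    inside not begun. Filling outer parts with the lamps of x and inner parts with those of y turns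
    the images of x and y into x, the cut state and y, so [ldist_split] gives the lower bound. *)
Lemma ldist_cut x y : ~~ cone x.1 -> cone y.1 ->
  ldist x y = (ldist x (c, conf_mix cone x.2 y.2) +
    ldist (c, conf_mix cone x.2 y.2) y)%N.
Proof.
move=> /negPf nx cy; apply/eqP; rewrite eqn_leq ldist_triangle /=.
apply: leq_trans (ldist_split x.2 y.2 x y); rewrite /outer_part /inner_part nx cy.
have mixid f : conf_mix cone f f = f.
  by apply/fsfunP => u; rewrite conf_mixE; case: ifP.
by rewrite !mixid -!surjective_pairing.
Qed.

(** Leaving the cone takes more than |x| - |c| steps, and no lamp outside it can change before
    that. *)
Lemma cone_stay x y : cone x.1 -> (ldist x y + flen c <= flen x.1)%N ->
  cone y.1 /\ forall u, ~~ cone u -> x.2 u = y.2 u.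
Proof.
rewrite /ldist; have [p [pp <- <-]] := gdistP conn x y.
elim: p x pp => [//|z p IH] x /= /andP[xz pz] cx lt.
have lz : (size p + flen c <= flen z.1)%N.
  by have := flen_ldist z x; rewrite ldistC; have := ldist_adj xz; rewrite /ldist; atom_lia.
have cz : cone z.1.
  apply: contraT => cz; have [E|t] := lamp_step_tree xz; first by rewrite -E cx in cz.
  by move: lt; rewrite (cone_adj t cx cz); lia.
have [cl H] := IH z pz cz lz; split=> // u cu; rewrite -H //.
have /lamp_adjE[[-> _]//|[_ ne _]] := xz.
by apply: ne; apply: contraNneq cu => ->.
Qed.

End Cone.

End LamplighterMetric.

(** * Tracking a sequence with linear rates *)

Section GeodesicThrough.
Variables (G : groupType) (S : {pred G}).
Hypothesis conn : forall g h : G, exists n, reach S n g h.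
Hypothesis adj_sym : forall g h, cayley_adj S g h -> cayley_adj S h g.

Local Notation d := (gdist S).

(** Concatenated shortest paths reach p_j after exactly d(p_0, p_j) steps, so no portion before that
    can be shortened. *)
Lemma geodesic_through (p : nat -> G) :
  (forall j, d (p 0%N) (p j.+1) = (d (p 0%N) (p j) + d (p j) (p j.+1))%N) ->
  (forall j, (j <= d (p 0%N) (p j))%N) ->
  exists v : nat -> G, (forall i j, (i <= j)%N -> d (v i) (v j) = (j - i)%N) /\
    forall j, v (d (p 0%N) (p j)) = p j.
Proof.
move=> add unb.
have [q Hq] := choice (fun j => gdistP conn (p j) (p j.+1)).
pose P := fix P j := if j is i.+1 then P i ++ q i else [::].
have [pP lP sP] : [/\ forall j, path (cayley_adj S) (p 0%N) (P j),
    forall j, last (p 0%N) (P j) = p j & forall j, size (P j) = d (p 0%N) (p j)].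
  have H j : [/\ path (cayley_adj S) (p 0%N) (P j),
    last (p 0%N) (P j) = p j & size (P j) = d (p 0%N) (p j)].
    elim: j => [|j [pj lj sj]]; first by rewrite /= (gdistxx conn).
    have [pq lq sq] := Hq j; rewrite /= cat_path last_cat size_cat pj lj pq lq sj sq.
    by rewrite add.
  by split=> j; have [] := H j.
have Pext i j : (i <= j)%N -> exists s, P j = P i ++ s.
  move=> /subnKC <-; elim: (j - i)%N => [|n [s Es]].
    by exists [::]; rewrite addn0 cats0.
  by exists (s ++ q (i + n)%N); rewrite addnS /= Es catA.
(* By [unb] the path [P t] has at least t edges, so position t exists on it; by [Pext] any other
   long enough piece gives the same vertex. *)
pose v t := nth (p 0%N) (p 0%N :: P t) t.
have vE j t : (t <= size (P j))%N -> v t = nth (p 0%N) (p 0%N :: P j) t.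
  move=> tj; rewrite /v; have [le|/ltnW le] := leqP t j.
    have [s ->] := Pext _ _ le; rewrite -cat_cons nth_cat /= ltnS.
    by rewrite sP unb.
  have [s ->] := Pext _ _ le; rewrite -cat_cons nth_cat /= ltnS.
  by rewrite tj.
have vS t : (d (v t) (v t.+1) <= 1)%N.
  have le : (t.+1 <= size (P t.+1))%N by rewrite sP.
  rewrite (vE t.+1) // ?(ltnW le) // (vE t.+1) //; apply: gdist_adj => //.
  by have /(pathP (p 0%N)) := pP t.+1; apply.
have vle i j : (i <= j)%N -> (d (v i) (v j) <= j - i)%N.
  move=> ij; rewrite -{1}(subnKC ij); elim: (j - i)%N => [|n IH].
    by rewrite addn0 gdistxx.
  rewrite addnS; apply: leq_trans (gdist_triangle conn _ (v (i + n)%N) _) _.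
  by rewrite -[n.+1]addn1 leq_add.
have vN j : v (d (p 0%N) (p j)) = p j.
  by rewrite (vE j) ?sP // -sP nth_last /= lP.
exists v; split=> // i j ij; apply/eqP; rewrite eqn_leq vle //=.
have := gdist_triangle conn (p 0%N) (v i) (p j).
have := gdist_triangle conn (v i) (v j) (p j).
have := vle _ _ (unb j); rewrite vN.
have := vle 0%N i isT; rewrite {1}/v /= subn0.
have := unb j; move: ij.
move: (d (v i) _) (d (v j) _) (d _ (v i)) (d (v i) _) => *; lia.
Qed.

End GeodesicThrough.

Definition asymptotic (R : realType) (a : nat -> R) (l : R) : Prop :=
  forall e : R, 0 < e -> exists N, forall n, (N <= n)%N -> `|a n - l * n%:R| <= e * n%:R.

Section Tracking.
Variables (R : realType) (m k : nat) (g : nat -> lamplighter m k).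
Variables (l A L : R).
Let w := walk g.
Let a n := flen (w n).1.
Let s n := llen (g n).
Hypothesis l0 : 0 < l.
Hypothesis A0 : 0 < A.
Hypothesis a_asymp : asymptotic (fun n => (a n)%:R) l.
Hypothesis w_asymp : asymptotic (fun n => (llen (w n))%:R) A.
Hypothesis s_asymp : asymptotic (fun n => \sum_(i < n) (s i)%:R) L.

Lemma walk0 : walk g 0 = 1%g.
Proof. by rewrite /walk big_ord0. Qed.

Lemma walkS n : walk g n.+1 = (walk g n * g n)%g.
Proof. by rewrite /walk big_ord_recr. Qed.

Lemma ldist_walkS n : ldist (walk g n) (walk g n.+1) = llen (g n).
Proof. by rewrite walkS ldist_mulr. Qed.

Lemma ldist_walk_le i n : (i <= n)%N ->
  ((ldist (w i) (w n))%:R : R) <= \sum_(j < n) (s j)%:R - \sum_(j < i) (s j)%:R.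
Proof.
move=> /subnKC <-; elim: (n - i)%N => [|j IH].
  by rewrite addn0 subrr /w ldistxx.
rewrite addnS big_ord_recr /= addrAC.
apply: le_trans (lerD IH (lexx (s (i + j)%N)%:R)).
by rewrite -natrD ler_nat /s -ldist_walkS ldist_triangle.
Qed.

(** A step is the difference of consecutive partial sums, both equal to L n up to o(n). *)
Lemma steps_small (e : R) : 0 < e -> exists N, forall n, (N <= n)%N -> ((s n)%:R : R) <= e * n%:R.
Proof.
move=> e0; have e4 : 0 < e / 4 by rewrite divr_gt0.
have [N HN] := s_asymp e4.
have [M HM] : exists M : nat, (`|L| + e) / (e / 4) < M%:R.
  exists (Num.truncn ((`|L| + e) / (e / 4))).+1; exact: truncnS_gt.
exists (N + M)%N => n Nn.
have := HN n ltac:(lia); have := HN n.+1 ltac:(lia).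
rewrite big_ord_recr /= -natr1 !ler_distl => /andP[_ h1] /andP[h2 _].
have : M%:R <= n%:R :> R by rewrite ler_nat; lia.
move: HM; rewrite ltr_pdivrMr // => HM Mn.
have : M%:R * (e / 4) <= n%:R * (e / 4) by rewrite ler_pM2r.
have : 0 <= e * n%:R by rewrite mulr_ge0 // ltW.
have := ler_norm L; lra.
Qed.

(** From time n on, every step starts so deep that [cone_stay] applies to the prefix of length j. *)
Definition settled (j n : nat) := forall i, (n <= i)%N -> (j + s i <= a i)%N.

Lemma settledW i j n : (i <= j)%N -> settled j n -> settled i n.
Proof. by move=> ij H t nt; apply: leq_trans (H t nt); rewrite leq_add2r. Qed.

Lemma settled_ex j : exists n, settled j n.
Proof.
have l4 : 0 < l / 4 by rewrite divr_gt0.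
have [N1 H1] := a_asymp l4; have [N2 H2] := steps_small l4.
pose M := Num.truncn (j%:R / (l / 2)).
exists (N1 + N2 + M.+1)%N => i Ni.
rewrite -(ler_nat R) natrD.
have := H1 i ltac:(lia); have := H2 i ltac:(lia).
have : M.+1%:R <= i%:R :> R by rewrite ler_nat; lia.
have : j%:R / (l / 2) < M.+1%:R := truncnS_gt _.
rewrite ltr_pdivrMr ?divr_gt0 // ler_distl => h1 h2 h3 /andP[h4 _].
have : M.+1%:R * (l / 2) <= i%:R * (l / 2) by rewrite ler_pM2r ?divr_gt0.
lra.
Qed.

Let settle_time : {n : nat -> nat & forall j, settled j (n j)} :=
  choice settled_ex.
Let tm := projT1 settle_time.
Let tmP j : settled j (tm j) := projT2 settle_time j.

Lemma prefix_reduced j n : reduced (take j (val (w n).1)).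
Proof. by apply: reduced_take; exact: valP. Qed.

Let c' j n := free_word (prefix_reduced j n).

Let settled_cone j n i : settled j n -> (n <= i)%N ->
  [/\ flen (c' j n) = j, cone (c' j n) (w i).1 &
    forall u, ~~ cone (c' j n) u -> (w n).2 u = (w i).2 u].
Proof.
move=> st /subnKC <-.
have fc : flen (c' j n) = j.
  by rewrite /flen size_takel //; have := st n (leqnn n); rewrite /a /flen; lia.
elim: (i - n)%N => [|t [_ IH1 IH2]].
  by rewrite addn0; split=> //; rewrite /cone prefix_take.
have := st (n + t)%N (leq_addr _ _).
rewrite addnS => h; have [] := @cone_stay _ _ (c' j n) (w (n + t)) (w (n + t).+1) IH1.
  by rewrite ldist_walkS fc addnC.
by move=> h1 h2; split=> // u cu; rewrite IH2 ?h2.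
Qed.

Let c j := c' j (tm j).

Lemma flen_settled_prefix j : flen (c j) = j.
Proof. by have [] := settled_cone (@tmP j) (leqnn _). Qed.

Lemma cone_eq (u v z : free_group k) : flen u = flen v -> cone u z -> cone v z -> u = v.
Proof.
rewrite /cone !prefixE /flen => E /eqP h1 /eqP h2.
by apply: val_inj; rewrite -h1 -h2 E.
Qed.

(** Two settling times give the same prefix and the same frozen lamps, as seen by comparing both
    with a common later time. *)
Lemma settledP j n : settled j n -> cone (c j) (w n).1 /\
  forall u, ~~ cone (c j) u -> (w n).2 u = (w (tm j)).2 u.
Proof.
move=> st; pose M := maxn n (tm j).
have [f1 c1 e1] := settled_cone st (leq_maxl n (tm j)).
have [f2 c2 e2] := settled_cone (@tmP j) (leq_maxr n (tm j)).
have E : c' j n = c j by apply: cone_eq c1 c2; rewrite f1 f2.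
have [_ cn _] := settled_cone st (leqnn n); rewrite -E; split=> // u cu.
by rewrite e1 // e2 // -/(c j) -E.
Qed.

Lemma cone_le i j u : (i <= j)%N -> cone (c j) u -> cone (c i) u.
Proof.
move=> ij cu; have [ci _] := settledP (settledW ij (@tmP j)).
have [cj _] := settledP (@tmP j).
have E : val (c i) = take i (val (c j)).
  move: ci cj; rewrite /cone !prefixE -!/(flen _) !flen_settled_prefix => /eqP <- /eqP <-.
  by rewrite take_takel.
by apply: prefix_trans cu; rewrite E prefix_take.
Qed.

Let p j : lamplighter m k := (c j, conf_mix (cone (c j)) 0 (w (tm j)).2).

Lemma milestone0 : p 0%N = 1%g.
Proof.
have c0 : c 0%N = 1%g by apply: flen0; rewrite flen_settled_prefix.
rewrite /p c0; congr pair; apply/fsfunP => u.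
by rewrite conf_mixE /cone /= prefix0s conf_zeroE.
Qed.

Lemma ncone1 j : (0 < j)%N -> ~~ cone (c j) 1%g.
Proof. by move=> j0; apply/negP => /cone_flen; rewrite flen_settled_prefix flen1 leqNgt j0. Qed.

Lemma ldist_milestone_cut (x y : lamplighter m k) j : ~~ cone (c j) x.1 -> cone (c j) y.1 ->
  (forall u, cone (c j) u -> x.2 u = 0) ->
  (forall u, ~~ cone (c j) u -> y.2 u = (w (tm j)).2 u) ->
  ldist x y = (ldist x (p j) + ldist (p j) y)%N.
Proof.
move=> nx cy x0 ye; rewrite (ldist_cut nx cy).
suff -> : conf_mix (cone (c j)) x.2 y.2 = (p j).2 by [].
by apply/fsfunP => u; rewrite !conf_mixE; case: ifPn => cu; rewrite ?conf_zeroE ?x0 ?ye.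
Qed.

Lemma milestone_add j : ldist (p 0%N) (p j.+1) = (ldist (p 0%N) (p j) + ldist (p j) (p j.+1))%N.
Proof.
(* The cone of c_0 is the whole tree, so the cut argument only starts at the next milestone. *)
rewrite milestone0; case: j => [|j]; first by rewrite milestone0 ldistxx.
have jj := leqnSn j.+1.
apply: ldist_milestone_cut => [|/=|u _|u cu].
- exact: ncone1.
- by apply: cone_le jj _; apply: cone_root.
- by rewrite conf_zeroE.
- rewrite conf_mixE ifN; last by apply: contra cu; apply: cone_le.
  by have [_ ->] := settledP (settledW jj (@tmP j.+2)).
Qed.

Lemma milestone_unbounded j : (j <= ldist (p 0%N) (p j))%N.
Proof. by rewrite milestone0 -{1}(flen_settled_prefix j); exact: flen_llen (p j). Qed.

Lemma llen_settled j n : settled j n ->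
  llen (w n) = (ldist (p 0%N) (p j) + ldist (p j) (w n))%N.
Proof.
move=> st; rewrite milestone0; case: j st => [|j] st; first by rewrite milestone0 ldistxx.
have [h1 h2] := settledP st.
by apply: ldist_milestone_cut => // [|u _]; [exact: ncone1|rewrite conf_zeroE].
Qed.

Lemma ldist_settled j i n : (0 < j)%N -> settled j n ->
  (forall t, (t < i)%N -> (a t + s t < j)%N) ->
  (ldist (p j) (w n) <= ldist (w i) (w n))%N.
Proof.
move=> j0 st small; have [h1 h2] := settledP st.
have [fi zi] : (flen (w i).1 < j)%N /\ forall u, (j <= flen u)%N -> (w i).2 u = 0.
  elim: i small => [|i IH] small.
    by rewrite /w walk0; split=> // u _; rewrite conf_zeroE.
  have [|IH1 IH2] := IH; first by move=> t ti; apply: small; rewrite ltnW.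
  have lt := small i (leqnn _).
  have lt' : (flen (w i).1 + ldist (w i) (w i.+1) < j)%N by rewrite ldist_walkS.
  split; last exact: lamps_near lt'.
  exact: leq_ltn_trans (flen_ldist _ _) lt'.
rewrite (@ldist_milestone_cut (w i) (w n) j) ?leq_addl // => [|u /cone_flen].
  by apply/negP => /cone_flen; rewrite flen_settled_prefix leqNgt fi.
by rewrite flen_settled_prefix => /zi.
Qed.

Lemma ball_bound N : exists B, forall t, (t < N)%N -> (a t + s t < B)%N.
Proof.
exists (\sum_(t < N) (a t + s t)).+1 => t tN.
by rewrite ltnS (bigD1 (Ordinal tN)) //= leq_addr.
Qed.

Lemma tracking : exists v : nat -> lamplighter m k,
  (forall i j, (i <= j)%N -> ldist (v i) (v j) = (j - i)%N) /\
  forall e : R, 0 < e -> exists N, forall n, (N <= n)%N ->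
    (ldist (w n) (v (Num.truncn (A * n%:R))))%:R <= e * n%:R.
Proof.
have [v [vgeo vp]] := geodesic_through (@lamp_conn m k) milestone_add milestone_unbounded.
exists v; split=> // e e0.
have vdist i j : (ldist (v i) (v j))%:R <= `|i%:R - j%:R| :> R.
  by rewrite (@ray_dist _ _ (@lamp_conn m k) (@lamp_adj_sym m k) R v vgeo).
have L0 : 0 <= `|L| := normr_ge0 L.
(* x = 1/K is the fraction of time by which one goes back. The final error is at most 2 d(p_j, w_n)
   + x n + 1 with d(p_j, w_n) at most (|L| + 2) x n, hence (2|L| + 5) x n + 1. Half of e n pays for
   the first term, half for the rounding error 1. *)
pose K := (Num.truncn (2 * (2 * `|L| + 5) / e)).+2.
have K0 : (0 : R) < K%:R by rewrite ltr0n.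
pose x : R := K%:R^-1.
have x0 : 0 < x by rewrite invr_gt0.
have x1 : x <= 1 by rewrite invf_le1 // ler1n.
have Kx : 2 * (2 * `|L| + 5) * x < e.
  rewrite /x ltr_pdivrMr // [e * _]mulrC -ltr_pdivrMr //.
  by apply: lt_trans (truncnS_gt _) _; rewrite ltr_nat.
have d0 : 0 < l * x / 8 by rewrite divr_gt0 // mulr_gt0.
have [N1 H1] := a_asymp d0; have [N2 H2] := steps_small d0.
have [N3 H3] := w_asymp x0; have [N4 H4] := s_asymp x0.
have [B HB] := ball_bound (N1 + N2).
have lx : 0 < l * x by rewrite mulr_gt0.
have big (c0 : R) (b : R) : 0 < b -> exists N, forall n, (N <= n)%N -> c0 < b * n%:R.
  move=> b0; exists (Num.truncn (c0 / b)).+1 => n Nn.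
  rewrite mulrC -ltr_pdivrMr //; apply: lt_le_trans (truncnS_gt _) _.
  by rewrite ler_nat.
have lx2 : 0 < l * (1 - x / 2) by rewrite mulr_gt0 // subr_gt0; lra.
have [N5 H5] := big (B%:R + 1) _ lx2.
have lx4 : 0 < l * x / 4 by rewrite divr_gt0.
have [N6 H6] := big (2 * l + 1) _ lx4.
have e2 : 0 < e / 2 by rewrite divr_gt0.
have [N7 H7] := big 1 _ e2.
exists (N1 + N2 + N3 + N4 * 2 + N5 + N6 + N7)%N => n Nn.
have [[n1 n2 n3] [n4 n5 n6 n7]] : [/\ (N1 <= n)%N, (N2 <= n)%N & (N3 <= n)%N] /\
    [/\ (N4 * 2 <= n)%N, (N5 <= n)%N, (N6 <= n)%N & (N7 <= n)%N].
  by move: Nn; clear; do !split; lia.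
(* This level is halfway between l (1 - x) n, about |y_i| for the time i below, and l n, about
   |y_n|. Errors of l x / 8 per unit of time, in position and in step length, leave room on both
   sides. *)
pose j := Num.truncn (l * (1 - x / 2) * n%:R).
have n0 : 0 <= n%:R :> R by [].
have /andP[j1 j2] : j%:R <= l * (1 - x / 2) * n%:R < j.+1%:R.
  by apply: truncn_itv; rewrite mulr_ge0 // ltW.
have h5 := H5 n n5; have h6 := H6 n n6; have h7 := H7 n n7.
have {}j2 : l * (1 - x / 2) * n%:R < j%:R + 1 by rewrite natr1.
have jB : (B <= j)%N by rewrite -(ler_nat R); lra.
pose i := (n - n %/ K)%N.
have i_le : i%:R <= n%:R - x * n%:R + 1 :> R.
  have : (n < (n %/ K).+1 * K)%N by rewrite ltn_ceil.
  rewrite -(ltr_nat R) natrM -ltr_pdivrMr // -/x mulrC -natr1.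
  by rewrite /i natrB ?leq_div //; lra.
have i_ge : n%:R - x * n%:R <= i%:R :> R.
  have : (n %/ K * K <= n)%N by rewrite leq_divM.
  rewrite -(ler_nat R) natrM -ler_pdivlMr // -/x mulrC.
  by rewrite /i natrB ?leq_div //; lra.
have ni : (i <= n)%N by rewrite leq_subr.
have st : settled j n.
  move=> t nt; rewrite -(ler_nat R) natrD.
  have := H1 t (leq_trans n1 nt); have := H2 t (leq_trans n2 nt).
  rewrite ler_distl => h2 /andP[h1 _].
  have nt' : n%:R <= t%:R :> R by rewrite ler_nat.
  have : l * (1 - x / 4) * n%:R <= l * (1 - x / 4) * t%:R.
    by rewrite ler_wpM2l // mulr_ge0 ?subr_ge0 //; lra.
  have : 0 <= l * x * n%:R by rewrite mulr_ge0 // ltW.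
  lra.
have small t : (t < i)%N -> (a t + s t < j)%N.
  move=> ti; have [lt|ge] := ltnP t (N1 + N2).
    exact: leq_trans (HB t lt) jB.
  rewrite -(ltr_nat R) natrD.
  have := H1 t (leq_trans (leq_addr _ _) ge); have := H2 t (leq_trans (leq_addl _ _) ge).
  rewrite ler_distl => h2 /andP[_ h1].
  have ti' : t%:R <= i%:R :> R by rewrite ler_nat ltnW.
  have lx5 : 0 <= l + l * x / 4 by lra.
  have : (l + l * x / 4) * t%:R <= (l + l * x / 4) * (n%:R - x * n%:R + 1).
    by rewrite ler_wpM2l //; lra.
  have : 0 <= l * x * x * n%:R by rewrite !mulr_ge0 // ltW.
  have : l * x <= l by rewrite ger_pMr.
  lra.
have j0 : (0 < j)%N.
  rewrite -(ltr_nat R); have : 0 <= B%:R :> R by []; lra.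
have D := ldist_settled j0 st small.
have := llen_settled st => /(congr1 (fun n : nat => n%:R : R)); rewrite natrD => ll.
have Dle : (ldist (p j) (w n))%:R <= (`|L| + 2) * (x * n%:R) :> R.
  apply: le_trans (_ : (ldist (w i) (w n))%:R <= _); first by rewrite ler_nat.
  apply: le_trans (ldist_walk_le ni) _.
  (* K is at least 2, so i is at least n/2; hence the bound 2 N4 on n. *)
  have iN4 : (N4 <= i)%N.
    by have := @leq_div2l n 2 K isT isT; move: n4; rewrite /i; clear; lia.
  have N4n : (N4 <= n)%N by apply: leq_trans ni.
  have := H4 n N4n; have := H4 i iN4.
  rewrite !ler_distl => /andP[h4 _] /andP[_ h4'].
  have in' : i%:R <= n%:R :> R by rewrite ler_nat.
  have : L * (n%:R - i%:R) <= `|L| * (n%:R - i%:R).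
    by rewrite ler_wpM2r ?ler_norm // subr_ge0.
  have : `|L| * (n%:R - i%:R) <= `|L| * (x * n%:R) by rewrite ler_wpM2l //; lra.
  have : x * i%:R <= x * n%:R by rewrite ler_pM2l.
  lra.
have [h3 h3'] : A * n%:R - x * n%:R <= (llen (w n))%:R /\ 
    (llen (w n))%:R <= A * n%:R + x * n%:R :> R.
  by apply/andP; rewrite -ler_distl; apply: H3.
set t := Num.truncn _.
have /andP[t1 t2] : t%:R <= A * n%:R < t.+1%:R.
  by apply: truncn_itv; rewrite mulr_ge0 // ltW.
have {}t2 : A * n%:R < t%:R + 1 by rewrite natr1.
have : (ldist (w n) (v t) <= ldist (p j) (w n) + ldist (p j) (v t))%N.
  by rewrite [ldist (p j) (w n)]ldistC ldist_triangle.
rewrite -(vp j) -(ler_nat R) natrD => tri.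
have := vdist (gdist (lamp_gens m k) (p 0%N) (p j)) t.
have := ler0n R (ldist (p j) (w n)).
move: ll Dle tri; rewrite (vp j) /ldist.
move: (gdist _ _ _)%:R (gdist _ (p j) (w n))%:R (gdist _ (p j) (v t))%:R => Nj D1 D2.
move=> ll Dle tri D10 D2le.
have : `|Nj - t%:R| <= D1 + x * n%:R + 1.
  by rewrite ler_distl; apply/andP; split; lra.
have : 2 * (2 * `|L| + 5) * x * n%:R <= e * n%:R by rewrite ler_wpM2r // ltW.
lra.
Qed.

End Tracking.

(** * The shift on the sequence space *)

Section Shift.
Context d (T : measurableType d) (R : realType).
Variables (mu : probability T R) (P : probability (sequence_space T) R).
Hypothesis hP : is_power_measure mu P.
Local Notation Omega := (sequence_space T).
Local Open Scope ereal_scope.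

Definition shiftn (n : nat) (w : Omega) : Omega := fun i => w (n + i)%N.

Definition box (n : nat) (A : nat -> set T) : set Omega :=
  [set w | forall i, (i < n)%N -> A i (w i)].

Definition boxes : set (set Omega) :=
  [set C | exists n A, (forall i, measurable (A i)) /\ C = box n A].

Lemma measurable_coordinate i : measurable_fun [set: Omega] (fun w : Omega => w i).
Proof.
move=> _ A mA; rewrite setTI; apply: sub_sigma_algebra.
by exists i, A.
Qed.

Lemma measurable_to_sequence d' (X : measurableType d') (f : X -> Omega) :
  (forall i, measurable_fun setT (fun x => f x i)) -> measurable_fun setT f.
Proof.
move=> mf; have H := @measurability _ _ X Omega setT f (coordinate_sets (T := T)) erefl.
apply: H.
move=> _ [_ [i [A [mA ->]]] <-]; exact: mf.
Qed.

Lemma measurable_shiftn n : measurable_fun setT (shiftn n).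
Proof. by apply: measurable_to_sequence => i; exact: measurable_coordinate. Qed.

Lemma measurable_box n A : (forall i, measurable (A i)) -> measurable (box n A).
Proof.
move=> mA; rewrite (_ : box n A = \bigcap_(i in `I_n) ((fun w : Omega => w i) @^-1` A i)).
  apply: bigcap_measurableType => i _.
  by rewrite -[X in measurable X]setTI; apply: measurable_coordinate.
by apply/seteqP; split => w H i /H.
Qed.

Lemma boxes_measurable : boxes `<=` measurable.
Proof. by move=> _ [n [A [mA ->]]]; exact: measurable_box. Qed.

Lemma boxesT : boxes setT.
Proof. by exists 0%N, (fun _ => setT); split=> //; apply/seteqP; split. Qed.

Lemma boxesI : setI_closed boxes.
Proof.
move=> _ _ [n [A [mA ->]]] [n' [A' [mA' ->]]].
exists (maxn n n'), (fun i => (if (i < n)%N then A i else setT) `&`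
  (if (i < n')%N then A' i else setT)); split.
  by move=> i; apply: measurableI; case: ifP.
apply/seteqP; split => [w [h h'] i _|w h]; first by split; case: ifPn => // /[dup]; auto.
split => i ltn; have := h i; rewrite ltn leq_max ltn ?orbT /= => /(_ isT) [] //.
Qed.

Lemma boxes_generate E : measurable E -> <<s boxes >> E.
Proof.
move: E; apply: smallest_sub; first exact: smallest_sigma_algebra.
move=> _ [i [A [mA ->]]]; apply: sub_sigma_algebra.
exists i.+1, (fun j => if j == i then A else setT); split.
  by move=> j; case: ifP.
apply/seteqP; split => [w Aw j _|w /(_ i)]; first by case: eqP => // ->.
by rewrite eqxx; apply.
Qed.

Lemma sequence_measure_unique (m1 m2 : {measure set Omega -> \bar R}) :
  m1 setT < +oo -> (forall B, boxes B -> m1 B = m2 B) ->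
  forall E, measurable E -> m1 E = m2 E.
Proof.
move=> fin agree E /boxes_generate.
apply: (@g_sigma_algebra_measure_unique _ _ _ boxes boxes_measurable (fun _ => setT)) => //.
- by move=> _; exact: boxesT.
- by rewrite bigcup_const //; exists 0%N.
- exact: boxesI.
Qed.

Lemma box_prob n A : (forall i, measurable (A i)) ->
  P (box n A) = \prod_(i < n) mu (A i).
Proof. exact: hP. Qed.


HB.instance Definition _ n := isMeasurableFun.Build _ _ _ _ (shiftn n) (measurable_shiftn n).


Lemma prob_scale E : measurable E -> {r : {nonneg R} | P E = r%:num%:E}.
Proof.
move=> mE; have r0 : (0 <= fine (P E))%R by apply: fine_ge0.
by exists (NngNum r0); rewrite /= fineK // fin_num_measure.
Qed.

(** With B the whole space this is the law of the shifted sequence; with n = 0 it is the restriction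
    of P to B. *)
Lemma restr_shift_measure n B : measurable B ->
  exists m : {measure set Omega -> \bar R},
    forall E, m E = P (B `&` shiftn n @^-1` E).
Proof.
move=> mB; unshelve refine (ex_intro _
  (pushforward (mrestr P mB) (shiftn n) : {measure set Omega -> \bar R}) _).
  exact: measurable_shiftn.
by move=> E; rewrite setIC.
Qed.

(** Both sides are finite measures in E, and they agree on boxes because a box followed by a shifted
    box is again a box. *)
Lemma box_shift_indep n A E : (forall i, measurable (A i)) -> measurable E ->
  P (box n A `&` shiftn n @^-1` E) = P (box n A) * P E.
Proof.
move=> mA mE; have mB := measurable_box n mA.
have [r Er] := prob_scale mB.
have [m1 Em1] := restr_shift_measure n mB.
rewrite -Em1 Er -[RHS]/(mscale r P E).
apply: (@sequence_measure_unique m1 (mscale r P)) E mE => [|_ [n' [A' [mA' ->]]]].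
  rewrite Em1; apply: le_lt_trans (ltry 1); apply: probability_le1.
  by apply: measurableI => //; rewrite preimage_setT.
rewrite Em1 -[RHS]/(r%:num%:E * P (box n' A')) -Er !box_prob //.
pose A2 i := if (i < n)%N then A i else A' (i - n)%N.
have -> : box n A `&` shiftn n @^-1` box n' A' = box (n + n') A2.
  apply/seteqP; split => [w [h h'] i lti|w h].
    rewrite /A2; case: ltnP => ni; first exact: h.
    by have := h' (i - n)%N; rewrite /shiftn subnKC //; apply; lia.
  split=> [i lti|i lti]; first by have := h i; rewrite /A2 lti; apply; lia.
  have := h (n + i)%N; rewrite /A2 ltn_add2l [(n + i < n)%N]ltnNge leq_addr /= addKn; exact.
rewrite box_prob; last by move=> i; rewrite /A2; case: ifP.
rewrite big_split_ord /=; congr (_ * _); apply: eq_bigr => i _; rewrite /A2 /=.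
  by rewrite ltn_ord.
by rewrite ltnNge leq_addr /= addKn.
Qed.

Lemma shift_invariant E : measurable E -> P (shiftn 1 @^-1` E) = P E.
Proof.
move=> mE; have := @box_shift_indep 1 (fun _ => setT) E (fun _ => measurableT) mE.
have -> : box 1 (fun _ => setT) = setT by apply/seteqP; split.
by rewrite setTI probability_setT mul1e.
Qed.

(** An invariant event equals its n-th preimage, so it is independent of every box, hence of every
    event, itself included. *)
Lemma shift_zero_one E : measurable E -> shiftn 1 @^-1` E = E -> P E = 0 \/ P E = 1.
Proof.
move=> mE invE.
have invn n : shiftn n @^-1` E = E.
  elim: n => [|n IH]; first by apply/seteqP; split.
  by rewrite -[LHS]/(shiftn 1 @^-1` (shiftn n @^-1` E)) IH invE.
have [r Er] := prob_scale mE.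
have [m1 Em1] := restr_shift_measure 0 mE.
have agree F : measurable F -> m1 F = mscale r P F.
  apply: sequence_measure_unique => [|_ [n [A [mA ->]]]].
    by rewrite Em1 preimage_setT setIT; apply: le_lt_trans (ltry 1); apply: probability_le1.
  rewrite Em1 -[RHS]/(r%:num%:E * P (box n A)) -Er muleC -box_shift_indep // invn setIC.
  by congr (P (_ `&` _)).
have sq : P E = P E * P E.
  by rewrite {2}Er -[RHS]/(mscale r P E) -agree // Em1 invn setIid.
move: sq; rewrite Er -EFinM => -[] sq.
have : (r%:num * (r%:num - 1) = 0)%R by rewrite mulrBr mulr1 -sq subrr.
by move=> /eqP; rewrite mulf_eq0 subr_eq0 => /orP[] /eqP ->; [left|right].
Qed.

Lemma integral_shift (f : Omega -> \bar R) : measurable_fun [set: Omega] f ->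
  (forall w, 0 <= f w) -> \int[P]_w f (shiftn 1 w) = \int[P]_w f w.
Proof.
move=> mf f0; have [m1 Em1] := restr_shift_measure 1 (measurableT : measurable [set: Omega]).
rewrite -[RHS](@eq_measure_integral _ _ _ setT P m1) //; last first.
  by move=> A mA _; rewrite Em1 setTI shift_invariant.
rewrite -[LHS](@ge0_integral_pushforward _ _ _ _ _ _ (measurable_shiftn 1) P setT f) //.
by apply: eq_measure_integral => A mA _; rewrite Em1 setTI.
Qed.

End Shift.

(** * Kingman's subadditive ergodic theorem *)

(* Cut [0, n) greedily: a good [i] is followed by a block on which [a] is
   nonpositive, every other [i] (or one too close to [n]) costs [B i]. *)
Lemma covering (R : realType) (a : nat -> nat -> R) (B : nat -> R) (bad : nat -> bool) N :
  (forall i j l, (i <= j <= l)%N -> a i l <= a i j + a j l) ->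
  (forall i, a i i <= 0) -> (forall i, a i i.+1 <= B i) -> (forall i, 0 <= B i) ->
  (forall i, ~~ bad i -> exists p, (0 < p <= N)%N /\ a i (i + p)%N <= 0) ->
  forall n, a 0%N n <= \sum_(0 <= i < n) (if bad i || (n < i + N)%N then B i else 0).
Proof.
move=> sub a0 aB B0 good n.
suff H t s : (s + t = n)%N ->
    a s n <= \sum_(s <= i < n) (if bad i || (n < i + N)%N then B i else 0).
  exact: (H n 0%N).
have [M] := ubnP t; elim: M t s => // M IH [|t] s tM st.
  by rewrite -st addn0 big_geq.
have sn : (s < n)%N by lia.
have [bs|] := boolP (bad s || (n < s + N)%N).
  rewrite big_ltn // bs; apply: le_trans (sub s s.+1 n _) _; first by lia.
  by rewrite lerD //; apply: (IH t); lia.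
rewrite negb_or -leqNgt => /andP[gs sN].
have [p [/andP[p0 pN] ap]] := good s gs.
apply: le_trans (sub s (s + p)%N n _) _; first by lia.
rewrite (@big_cat_nat _ _ _ (s + p)%N) /=; [|by lia|by lia].
apply: lerD; last by apply: (IH (t.+1 - p)%N); lia.
by apply: le_trans ap _; apply: sumr_ge0 => i _; case: ifP.
Qed.

Lemma tail_sum_le (R : realType) (c : R) n N : 0 <= c ->
  \sum_(0 <= i < n) (if (n < i + N)%N then c else 0) <= N%:R * c.
Proof.
move=> c0; rewrite big_nat_rev /=.
have H p : \sum_(0 <= i < p) (if (i < N)%N then c else 0) = (minn p N)%:R * c.
  elim: p => [|p IH]; first by rewrite big_nil min0n mul0r.
  rewrite big_nat_recr //= IH; case: ltnP => pN.
    by rewrite (minn_idPl pN) -natr1 mulrDl mul1r.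
  by rewrite addr0 (minn_idPr (leqW pN)).
apply: le_trans (_ : (minn n N)%:R * c <= _); last first.
  by rewrite ler_wpM2r // ler_nat geq_minr.
rewrite -H big_nat_cond [leRHS]big_nat_cond; apply: ler_sum => i /andP[/andP[_ lti] _].
case: ifPn => h; first by rewrite ifT //; lia.
by case: ifP.
Qed.

Section Expectation.
Context d (T : measurableType d) (R : realType).
Variables (mu : probability T R) (P : probability (sequence_space T) R).
Hypothesis hP : is_power_measure mu P.
Local Notation Omega := (sequence_space T).

Definition Ex (X : Omega -> R) : \bar R := (\int[P]_w (X w)%:E)%E.

Definition nnrv (X : Omega -> R) :=
  measurable_fun [set: Omega] X /\ forall w, 0 <= X w.

Lemma nnrv_EFin X : nnrv X -> measurable_fun [set: Omega] (fun w => (X w)%:E) /\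
  forall w, [set: Omega] w -> (0 <= (X w)%:E)%E.
Proof. by move=> [mX X0]; split=> [|w _]; [exact/measurable_EFinP|rewrite lee_fin]. Qed.

Lemma Ex_ge0 X : nnrv X -> (0 <= Ex X)%E.
Proof. by move=> [_ X0]; apply: integral_ge0 => w _; rewrite lee_fin. Qed.

Lemma nnrv_shiftn X n : nnrv X -> nnrv (X \o @shiftn _ T n).
Proof.
move=> [mX X0]; split=> [|w]; last exact: X0.
by apply: measurableT_comp => //; exact: measurable_shiftn.
Qed.

Lemma Ex_shiftn X n : nnrv X -> Ex (X \o @shiftn _ T n) = Ex X.
Proof.
move=> nX; elim: n => [//|n IH].
have [mX X0] := nnrv_EFin (nnrv_shiftn n nX).
rewrite -IH /Ex -[RHS](integral_shift hP) // => w; exact: X0.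
Qed.

Lemma Ex_le X Y : nnrv X -> nnrv Y -> (forall w, X w <= Y w) -> (Ex X <= Ex Y)%E.
Proof.
move=> /nnrv_EFin[mX X0] /nnrv_EFin[mY Y0] XY.
by apply: ge0_le_integral => // w _; rewrite lee_fin.
Qed.

Lemma ExD X Y : nnrv X -> nnrv Y -> Ex (fun w => X w + Y w) = (Ex X + Ex Y)%E.
Proof.
by move=> /nnrv_EFin[mX X0] /nnrv_EFin[mY Y0]; rewrite /Ex -ge0_integralD.
Qed.

Lemma nnrvD X Y : nnrv X -> nnrv Y -> nnrv (fun w => X w + Y w).
Proof.
by move=> [mX X0] [mY Y0]; split=> [|w]; [exact: measurable_funD|rewrite addr_ge0].
Qed.

Lemma nnrv_cst (c : R) : 0 <= c -> nnrv (fun _ => c).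
Proof. by move=> c0; split=> // w. Qed.

Lemma Ex_cst (c : R) : Ex (fun _ => c) = c%:E.
Proof.
transitivity (c%:E * P [set: Omega])%E; first exact: integral_cst.
by rewrite probability_setT mule1.
Qed.

Lemma nnrv_sum n (X : nat -> Omega -> R) : (forall i, nnrv (X i)) ->
  nnrv (fun w => \sum_(0 <= i < n) X i w).
Proof.
move=> nX; split=> [|w]; last by apply: sumr_ge0 => i _; have [] := nX i.
by apply: measurable_sum => i; have [] := nX i.
Qed.

Lemma Ex_sum n (X : nat -> Omega -> R) : (forall i, nnrv (X i)) ->
  Ex (fun w => \sum_(0 <= i < n) X i w) = (\sum_(0 <= i < n) Ex (X i))%E.
Proof.
move=> nX; elim: n => [|n IH].
  by rewrite big_nil -[RHS](Ex_cst 0); congr Ex; apply/funext => w; rewrite big_nil.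
rewrite big_nat_recr //= -IH -ExD //; last exact: nnrv_sum.
by congr Ex; apply/funext => w; rewrite big_nat_recr.
Qed.

Definition cocycle (b : nat -> Omega -> R) :=
  forall n p w, b (n + p)%N w <= b n w + b p (shiftn n w).

Definition badset (b : nat -> Omega -> R) N : set Omega :=
  [set w | forall p, (p < N)%N -> 0 < b p.+1 w].

Lemma measurable_badset b N : (forall n, measurable_fun [set: Omega] (b n)) ->
  measurable (badset b N).
Proof.
move=> mb; rewrite (_ : badset b N = \bigcap_(p in `I_N) (b p.+1 @^-1` `]0, +oo[)).
  apply: bigcap_measurableType => p _.
  by rewrite -[X in measurable X]setTI; apply: mb.
apply/seteqP; split => w H p /H; by rewrite /= in_itv /= andbT.
Qed.

(** * A maximal inequality from the covering argument *)

Section Maximal.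
Variables (b : nat -> Omega -> R) (B : Omega -> R).
Hypothesis mb : forall n, measurable_fun [set: Omega] (b n).
Hypothesis cb : cocycle b.
Hypothesis b0 : forall w, b 0%N w <= 0.
Hypothesis bB : forall w, b 1%N w <= B w.
Hypothesis nB : nnrv B.
Hypothesis finB : (Ex B < +oo)%E.
Hypothesis good : {ae P, forall w, exists p, (0 < p)%N /\ b p w <= 0}.

Let BN N w := B w * \1_(badset b N) w.

Let nBN N : nnrv (BN N).
Proof.
have [mB B0] := nB; split=> [|w]; last by rewrite mulr_ge0 // indicE.
by apply: measurable_funM => //; apply: measurable_indic; apply: measurable_badset.
Qed.

Let BN_small (e : R) : 0 < e -> exists N, (Ex (BN N) <= e%:E)%E.
Proof.
move=> e0; have [mB B0] := nnrv_EFin nB.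
have [|||||_ _] := @dominated_convergence _ Omega R P setT measurableT
  (fun N w => (BN N w)%:E) (cst 0%E) (fun w => (B w)%:E).
- by move=> N; have [] := nnrv_EFin (nBN N).
- exact: measurable_cst.
- apply: filterS good => w [p [p0 bp]] _.
  apply: cvg_near_cst; exists p => // N /= pN.
  rewrite /BN indicE memNset ?mulr0 // => H.
  by have := H p.-1; rewrite prednK // ltNge bp => /(_ pN).
- apply/integrableP; split=> //.
  rewrite (_ : (fun _ => _) = (fun w => (B w)%:E)) //.
  by apply/funext => w; rewrite gee0_abs // lee_fin; case: nB.
- apply: aeW => w N _; have [_ B1] := nB; have [_ B2] := nBN N.
  by rewrite gee0_abs lee_fin // /BN ler_piMr // indicE lern1 leq_b1.
rewrite integral0 => cv.
have [fin cv'] := (fine_cvgP _ _).1 cv.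
have [N _ HN] := filterI fin (cvgr_lt _ cv' _ e0).
have [finN ltN] := HN N (leqnn N).
by exists N; rewrite -[Ex _](fineK finN) lee_fin ltW.
Qed.

(** The covering bound is integrated: [badset] costs at most e per index once N is large, by
    dominated convergence, and the last N indices cost N times the mean of [B]. As b has no sign, it
    is split as u - v to keep all integrands nonnegative. *)
Lemma maximal (u v : nat -> Omega -> R) (e : R) : 0 < e ->
  (forall n, nnrv (u n)) -> (forall n, nnrv (v n)) ->
  (forall n w, b n w = u n w - v n w) ->
  exists C : R, forall n, (Ex (u n) <= Ex (v n) + (e * n%:R + C)%:E)%E.
Proof.
move=> e0 nu nv buv; have [N HN] := BN_small e0.
have finEB : Ex B \is a fin_num by rewrite ge0_fin_numE //; exact: Ex_ge0.
exists (N%:R * fine (Ex B)) => n.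
pose X i w := if (n < i + N)%N then B (shiftn i w) else BN N (shiftn i w).
have nX i : nnrv (X i).
  by rewrite /X; case: (n < i + N)%N; [exact: (nnrv_shiftn i nB)|exact: (nnrv_shiftn i (nBN N))].
have pointwise w : u n w <= v n w + \sum_(0 <= i < n) X i w.
  rewrite -lerBlDl -buv.
  have H := @covering R (fun i j => b (j - i)%N (shiftn i w)) (fun i => B (shiftn i w))
    (fun i => shiftn i w \in badset b N) N.
  have := H _ _ _ _ _ n; rewrite subn0.
  have -> : shiftn 0 w = w by [].
  move=> {}H; apply: le_trans (H _ _ _ _ _) _ => {H}.
  - move=> i j l /andP[ij jl]; have := cb (j - i)%N (l - j)%N (shiftn i w).
    have -> : (j - i + (l - j) = l - i)%N by lia.
    have -> // : shiftn (j - i)%N (shiftn i w) = shiftn j w.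
    by apply/funext => t; rewrite /shiftn; congr w; lia.
  - by move=> i; rewrite subnn.
  - by move=> i; rewrite subSnn.
  - by move=> i; case: nB.
  - move=> i /negP nb; apply: contrapT => H; apply: nb; rewrite inE => p pN.
    rewrite ltNge; apply/negP => bp; apply: H; exists p.+1; split=> //.
    by rewrite addKn.
  apply: ler_sum => i _; rewrite /X /BN indicE; case: ifPn => [/orP[]|].
  - by move=> ->; rewrite mulr1; case: ifP.
  - by move=> ->.
  - by rewrite negb_or => /andP[/negPf -> /negPf ->]; rewrite mulr0.
apply: le_trans (Ex_le _ _ pointwise) _ => //.
  by apply: nnrvD => //; apply: nnrv_sum.
rewrite ExD //; last exact: nnrv_sum.
apply: leeD => //; rewrite Ex_sum //.
apply: le_trans (_ : (\sum_(0 <= i < n) (e + (if (n < i + N)%N then fine (Ex B) else 0))%:E <= _)%E).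
  apply: lee_sum => i _; rewrite /X; case: (n < i + N)%N.
    rewrite [X in (X <= _)%E](Ex_shiftn i nB) EFinD fineK //.
    by rewrite leeDr // lee_fin ltW.
  by rewrite addr0 [X in (X <= _)%E](Ex_shiftn i (nBN N)).
rewrite sumEFin lee_fin big_split /= sumr_const_nat subn0 mulr_natr lerD //.
have EB0 : 0 <= fine (Ex B) by apply/fine_ge0/Ex_ge0.
exact: (tail_sum_le _ _ EB0).
Qed.

End Maximal.

Lemma ae_prob0 (E : set Omega) : measurable E -> P E = 0%E -> {ae P, forall w, ~ E w}.
Proof. by move=> mE PE; exists E; split=> // w /= /contrapT. Qed.

Lemma ae_prob1 (E : set Omega) : measurable E -> P E = 1%E -> {ae P, forall w, E w}.
Proof.
move=> mE PE; exists (~` E); split=> //; first exact: measurableC.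
by rewrite probability_setC // PE subee.
Qed.

Lemma natr_inv_small (e : R) : 0 < e -> exists j : nat, j.+1%:R^-1 < e.
Proof.
move=> e0; exists (Num.truncn e^-1).
by rewrite invf_plt ?posrE ?ltr0n // truncnS_gt.
Qed.

Lemma natr_large (c b : R) : 0 < b -> exists N : nat, forall n, (N <= n)%N -> c <= b * n%:R.
Proof.
move=> b0; exists (Num.truncn (c / b)).+1 => n Nn.
rewrite mulrC -ler_pdivrMr //; apply/ltW/(lt_le_trans (truncnS_gt _)).
by rewrite ler_nat.
Qed.

(** * Zero-one alternative for linear lower bounds *)

Section Dichotomy.
Variables (u : nat -> Omega -> R) (D : Omega -> R).
Hypothesis mu_ : forall n, measurable_fun [set: Omega] (u n).
Hypothesis uD : forall n w, `|u n.+1 w - u n (shiftn 1 w)| <= D w.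

(** The event liminf u_n / n < c, strictness being expressed by 1/(j+1). *)
Definition low (c : R) : set Omega := [set w | exists j : nat,
  forall N, exists n, (N <= n)%N /\ u n w <= (c - j.+1%:R^-1) * n%:R].

Lemma measurable_low c : measurable (low c).
Proof.
rewrite (_ : low c = \bigcup_j \bigcap_N \bigcup_(n in [set n | (N <= n)%N])
  (u n @^-1` `]-oo, (c - j.+1%:R^-1) * n%:R])).
  apply: bigcupT_measurable => j; apply: bigcapT_measurable => N.
  apply: bigcup_measurable => n _.
  by rewrite -[X in measurable X]setTI; apply: mu_.
apply/seteqP; split => w.
  move=> [j H]; exists j => // N _; have [n [Nn un]] := H N.
  by exists n => //=; rewrite in_itv.
move=> [j _ H]; exists j => N; have [n Nn] := H N I.
by rewrite /= in_itv /= => un; exists n.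
Qed.

(** A shift changes u by at most D and the index by one, which the gap between 1/(j+1) and 1/(j+2)
    absorbs for large n. *)
Lemma low_invariant c : shiftn 1 @^-1` low c = low c.
Proof.
have inv_lt j : j.+2%:R^-1 < j.+1%:R^-1 :> R by rewrite ltf_pV2 ?posrE ?ltr0n // ltr_nat.
have inv_le1 j : j.+1%:R^-1 <= 1 :> R by rewrite invf_le1 ?ltr0n // ler1n.
have inv_ge0 j : 0 <= j.+1%:R^-1 :> R by rewrite invr_ge0.
apply/seteqP; split => w [j H]; exists j.+1 => N.
- have d0 : 0 < j.+1%:R^-1 - j.+2%:R^-1 :> R by rewrite subr_gt0.
  have [M HM] := natr_large (D w + `|c| + 1) d0.
  have [n [Nn un]] := H (N + M)%N; exists n.+1; split; first by lia.
  have := uD n w; rewrite ler_distl => /andP[_ h].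
  have := HM n ltac:(lia).
  have := ler_norm (- c); rewrite normrN.
  rewrite -[n.+1%:R]natr1 mulrDr mulr1; have := inv_le1 j.+1.
  by move: h un; move: j.+1%:R^-1 j.+2%:R^-1 => a a'; lra.
- have d0 : 0 < j.+1%:R^-1 - j.+2%:R^-1 :> R by rewrite subr_gt0.
  have [M HM] := natr_large (D w + `|c| + 1) d0.
  have [[|n] [Nn un]] := H (N + M).+1 => //; exists n; split; first by lia.
  have := uD n w; rewrite ler_distl => /andP[h _].
  have := HM n ltac:(lia); have := ler_norm c.
  move: un; rewrite -[n.+1%:R]natr1 mulrDr mulr1; have := inv_ge0 j; have := inv_le1 j.
  by move: h; move: j.+1%:R^-1 j.+2%:R^-1 => a a'; lra.
Qed.

(* The alternative between the two almost sure events is the zero-one law for the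
   shift-invariant event [low c]. *)
Lemma dichotomy c :
  {ae P, forall w, forall e : R, 0 < e -> exists N, forall n, (N <= n)%N -> (c - e) * n%:R <= u n w} \/
  {ae P, forall w, exists p, (0 < p)%N /\ u p w <= c * p%:R}.
Proof.
have [P0|P1] := shift_zero_one hP (measurable_low c) (low_invariant c); [left|right].
  have := ae_prob0 (measurable_low c) P0; apply: filterS => w nl e e0.
  have [j je] := natr_inv_small e0.
  apply: contrapT => H; apply: nl; exists j => N; apply: contrapT => H2.
  apply: H; exists N => n Nn; rewrite leNgt; apply/negP => lt; apply: H2.
  exists n; split => //; apply: le_trans (ltW lt) _.
  by rewrite ler_wpM2r // lerB // ltW.
have := ae_prob1 (measurable_low c) P1; apply: filterS => w [j H].
have [n [n1 un]] := H 1%N; exists n; split => //; apply: le_trans un _.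
by rewrite ler_wpM2r // lerBlDr lerDl invr_ge0.
Qed.

End Dichotomy.

(** * The lower half of Kingman's theorem *)

Section Kingman.
Variable f : nat -> Omega -> R.
Hypothesis nf : forall n, nnrv (f n).
Hypothesis cf : cocycle f.
Hypothesis f0 : forall w, f 0%N w = 0.
Hypothesis ff : forall n w, `|f n.+1 w - f n (shiftn 1 w)| <= f 1%N w.
Hypothesis fin1 : (Ex (f 1%N) < +oo)%E.

Lemma Ex_fin n : (Ex (f n) < +oo)%E.
Proof.
elim: n => [|n IH].
  have -> : f 0%N = fun _ => 0 by apply/funext.
  by rewrite Ex_cst ltry.
apply: le_lt_trans (Ex_le (nf n.+1) _ (cf 1%N n)) _.
  by apply: nnrvD => //; exact: (nnrv_shiftn 1 (nf n)).
rewrite ExD //; last exact: (nnrv_shiftn 1 (nf n)).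
by rewrite lte_add_pinfty // [X in (X < _)%E](Ex_shiftn 1 (nf n)).
Qed.

Definition mean n := fine (Ex (f n)).

Lemma meanE n : Ex (f n) = (mean n)%:E.
Proof. by rewrite fineK // ge0_fin_numE ?Ex_fin //; exact: Ex_ge0. Qed.

Lemma mean_ge0 n : 0 <= mean n.
Proof. by apply/fine_ge0/Ex_ge0. Qed.

Definition rate := inf [set x | exists2 n, (0 < n)%N & x = mean n / n%:R].

Lemma rate_le n : rate * n%:R <= mean n.
Proof.
case: n => [|n]; first by rewrite mulr0 mean_ge0.
rewrite -ler_pdivlMr ?ltr0n //; apply: ge_inf; last by exists n.+1.
by exists 0 => _ [p _ ->]; rewrite divr_ge0 // mean_ge0.
Qed.

Lemma rate_ge x : (forall n, x * n%:R <= mean n) -> x <= rate.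
Proof.
move=> H; apply: lb_le_inf; first by exists (mean 1 / 1%:R); exists 1%N.
by move=> _ [n n0 ->]; rewrite ler_pdivlMr ?ltr0n.
Qed.

Lemma rate_ge0 : 0 <= rate.
Proof. by apply: rate_ge => n; rewrite mul0r mean_ge0. Qed.

Lemma rate_near e : 0 < e -> exists2 n, (0 < n)%N & mean n <= (rate + e) * n%:R.
Proof.
move=> e0; apply: contrapT => H.
suff : rate + e <= rate by rewrite leNgt ltrDl e0.
apply: rate_ge => -[|n]; first by rewrite mulr0 mean_ge0.
by rewrite leNgt; apply/negP => lt; apply: H; exists n.+1 => //; exact: ltW.
Qed.

(** [maximal] for f_n - c n bounds the mean of f_n by (c + e) n up to a constant. *)
Lemma mean_rate_bound c : 0 <= c ->
  {ae P, forall w, exists p, (0 < p)%N /\ f p w <= c * p%:R} -> rate <= c.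
Proof.
move=> c0 H; apply/ler_addgt0Pr => e e0.
have e2 : 0 < e / 2 by rewrite divr_gt0.
have mf n : measurable_fun [set: Omega] (f n) by have [] := nf n.
have [||||||||||C HC] := @maximal (fun n w => f n w - c * n%:R) (f 1%N) _ _ _ _ _ _ _
  f (fun n _ => c * n%:R) (e / 2) e2.
- by move=> n; apply: measurable_funB.
- move=> n p w; have := cf n p w; rewrite natrD mulrDr; lra.
- by move=> w; rewrite f0 mulr0 subrr.
- by move=> w; rewrite mulr1; lra.
- exact: nf.
- exact: fin1.
- by apply: filterS H => w [p [p0 fp]]; exists p; rewrite subr_le0.
- exact: nf.
- by move=> n; apply: nnrv_cst; rewrite mulr_ge0.
- by [].
have [N HN] := natr_large C e2.
have := HC N.+1; rewrite meanE Ex_cst -EFinD lee_fin => h1.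
have h2 := HN N.+1 (leqnSn N).
have n0 : 0 < N.+1%:R :> R by rewrite ltr0n.
have h3 : rate * N.+1%:R <= (c + e) * N.+1%:R.
  by apply: le_trans (rate_le _) _; lra.
by rewrite -(ler_pM2r n0).
Qed.

(** For c below the rate, [mean_rate_bound] excludes the second alternative of [dichotomy]. Letting
    c run through a sequence tending to the rate keeps the exceptional sets countable in number. *)
Lemma kingman_lower : {ae P, forall w, forall e : R, 0 < e ->
  exists N, forall n, (N <= n)%N -> (rate - e) * n%:R <= f n w}.
Proof.
have mf n : measurable_fun [set: Omega] (f n) by have [] := nf n.
have H j : {ae P, forall w, forall e : R, 0 < e ->
    exists N, forall n, (N <= n)%N -> (rate - j.+1%:R^-1 - e) * n%:R <= f n w}.
  set c := rate - _.
  (* For negative c the bound is just the nonnegativity of f. *)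
  have [neg|pos] := ltP c 0.
    apply: aeW => w e e0; exists 0%N => n _; have [_ fn0] := nf n.
    by apply: le_trans (fn0 w); rewrite mulr_le0_ge0 //; lra.
  have [//|H] := dichotomy mf ff c.
  have := mean_rate_bound pos H; rewrite /c lerBrDr gerDl leNgt.
  by rewrite invr_gt0 ltr0n.
have := ae_foralln H; apply: filterS => w Hw e e0.
have e2 : 0 < e / 2 by rewrite divr_gt0.
have [j je] := natr_inv_small e2.
have [N HN] := Hw j _ e2; exists N => n Nn; apply: le_trans (HN n Nn).
by rewrite ler_wpM2r //; move: je; move: j.+1%:R^-1 => a; lra.
Qed.

End Kingman.

(** * The upper half of Birkhoff's theorem *)

Section Birkhoff.
Variable F : Omega -> R.
Hypothesis nF : nnrv F.
Hypothesis finF : (Ex F < +oo)%E.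

Definition birkhoff n w := \sum_(0 <= i < n) F (shiftn i w).

Lemma nnrv_birkhoff n : nnrv (birkhoff n).
Proof. by apply: nnrv_sum => i; exact: (nnrv_shiftn i nF). Qed.

Lemma birkhoffD n p w : birkhoff (n + p) w = birkhoff n w + birkhoff p (shiftn n w).
Proof.
rewrite /birkhoff (@big_cat_nat _ _ _ n) ?leq_addr //=; congr (_ + _).
rewrite -{1}[n]add0n big_addn addKn; apply: eq_bigr => i _.
by congr F; apply/funext => j; rewrite /shiftn; congr w; rewrite addnA (addnC n).
Qed.

Lemma birkhoffS n w : birkhoff n.+1 w = F w + birkhoff n (shiftn 1 w).
Proof. by rewrite (birkhoffD 1) /birkhoff big_nat1. Qed.

Lemma Ex_birkhoff n : Ex (birkhoff n) = (fine (Ex F) * n%:R)%:E.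
Proof.
rewrite Ex_sum => [|i]; last exact: (nnrv_shiftn i nF).
under eq_bigr do rewrite [Ex _](Ex_shiftn _ nF).
rewrite -[Ex F]fineK ?ge0_fin_numE //; last exact: Ex_ge0.
by rewrite sumEFin sumr_const_nat subn0 mulr_natr.
Qed.

(** Mirror image of [mean_rate_bound]: in [maximal] the linear sequence c n is u, the Birkhoff sum
    is v, and the dominating function is the constant c. *)
Lemma birkhoff_upper_bound c : 0 <= c ->
  {ae P, forall w, exists p, (0 < p)%N /\ c * p%:R <= birkhoff p w} -> c <= fine (Ex F).
Proof.
move=> c0 H; apply/ler_addgt0Pr => e e0.
have e2 : 0 < e / 2 by rewrite divr_gt0.
have nS := nnrv_birkhoff.
have mS n : measurable_fun [set: Omega] (birkhoff n) by have [] := nS n.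
have [||||||||||C HC] := @maximal (fun n w => c * n%:R - birkhoff n w) (fun _ => c) _ _ _ _ _ _ _
  (fun n _ => c * n%:R) birkhoff (e / 2) e2.
- by move=> n; apply: measurable_funB.
- by move=> n p w; rewrite natrD mulrDr birkhoffD; lra.
- by move=> w; rewrite mulr0 /birkhoff big_nil subrr.
- by move=> w; rewrite mulr1; have [_ /(_ w)] := nS 1%N; lra.
- exact: nnrv_cst.
- by rewrite Ex_cst ltry.
- by apply: filterS H => w [p [p0 fp]]; exists p; rewrite subr_le0.
- by move=> n; apply: nnrv_cst; rewrite mulr_ge0.
- by [].
- by [].
have [N HN] := natr_large C e2.
have := HC N.+1; rewrite Ex_cst Ex_birkhoff -EFinD lee_fin => h1.
have h2 := HN N.+1 (leqnSn N).
have n0 : 0 < N.+1%:R :> R by rewrite ltr0n.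
have h3 : c * N.+1%:R <= (fine (Ex F) + e) * N.+1%:R by lra.
by rewrite -(ler_pM2r n0).
Qed.

Lemma birkhoff_upper : {ae P, forall w, forall e : R, 0 < e ->
  exists N, forall n, (N <= n)%N -> birkhoff n w <= (fine (Ex F) + e) * n%:R}.
Proof.
have EF0 : 0 <= fine (Ex F) by apply/fine_ge0/Ex_ge0.
have H j : {ae P, forall w, forall e : R, 0 < e ->
    exists N, forall n, (N <= n)%N -> birkhoff n w <= (fine (Ex F) + j.+1%:R^-1 + e) * n%:R}.
  set c := _ + _.
  have j0 : 0 < j.+1%:R^-1 :> R by rewrite invr_gt0 ltr0n.
  have [||K|K] := @dichotomy (fun n w => - birkhoff n w) F _ _ (- c).
  - by move=> n; apply: measurableT_comp => //; have [] := nnrv_birkhoff n.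
  - by move=> n w; rewrite birkhoffS opprD opprK addrNK normrN ger0_norm //; case: nF.
  - apply: filterS K => w Kw e e0; have [N HN] := Kw e e0; exists N => n Nn.
    by have := HN n Nn; lra.
  suff : c <= fine (Ex F) by rewrite /c gerDl leNgt j0.
  apply: birkhoff_upper_bound; first by rewrite /c addr_ge0 // ltW.
  by apply: filterS K => w [p [p0 hp]]; exists p; split=> //; lra.
have := ae_foralln H; apply: filterS => w Hw e e0.
have e2 : 0 < e / 2 by rewrite divr_gt0.
have [j je] := natr_inv_small e2.
have [N HN] := Hw j _ e2; exists N => n Nn; apply: le_trans (HN n Nn) _.
by rewrite ler_wpM2r //; move: je; move: j.+1%:R^-1 => a; lra.
Qed.

End Birkhoff.

End Expectation.

Section KingmanLimit.
Context d (T : measurableType d) (R : realType).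
Variables (mu : probability T R) (P : probability (sequence_space T) R).
Hypothesis hP : is_power_measure mu P.
Local Notation Omega := (sequence_space T).
Local Notation Ex := (Ex P).

Lemma birkhoff_mono (F : Omega -> R) i j w : (forall w, 0 <= F w) -> (i <= j)%N ->
  birkhoff F i w <= birkhoff F j w.
Proof.
move=> F0 /subnKC <-; rewrite birkhoffD lerDl.
by apply: sumr_ge0 => *; exact: F0.
Qed.

(** Birkhoff sums are an additive cocycle with rate the mean of F, so Kingman's lower half
    applies. *)
Lemma birkhoff_lower (F : Omega -> R) : nnrv F -> (Ex F < +oo)%E ->
  {ae P, forall w, forall e : R, 0 < e ->
    exists N, forall n, (N <= n)%N -> (fine (Ex F) - e) * n%:R <= birkhoff F n w}.
Proof.
move=> nF finF; have EF0 : 0 <= fine (Ex F) by apply/fine_ge0/Ex_ge0.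
have S1 w : birkhoff F 1 w = F w by rewrite /birkhoff big_nat1.
have K : {ae P, forall w, forall e : R, 0 < e -> exists N, forall n,
    (N <= n)%N -> (rate P (birkhoff F) - e) * n%:R <= birkhoff F n w}.
  apply: (kingman_lower hP (nnrv_birkhoff nF)).
  - by move=> n p w; rewrite birkhoffD.
  - by move=> w; rewrite /birkhoff big_nil.
  - by move=> n w; rewrite birkhoffS addrK S1 ger0_norm //; case: nF.
  - by have -> : birkhoff F 1 = F by apply/funext => w; rewrite S1.
apply: filterS K => w Kw e e0; have [N HN] := Kw e e0; exists N => n Nn.
apply: le_trans (HN n Nn); rewrite ler_wpM2r // lerB //.
apply: rate_ge => p; rewrite /mean (Ex_birkhoff hP nF finF) //=.
Qed.

Variable f : nat -> Omega -> R.
Hypothesis nf : forall n, nnrv (f n).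
Hypothesis cf : cocycle f.
Hypothesis f0 : forall w, f 0%N w = 0.
Hypothesis ff : forall n w, `|f n.+1 w - f n (shiftn 1 w)| <= f 1%N w.
Hypothesis fin1 : (Ex (f 1%N) < +oo)%E.

Lemma cocycle_birkhoff n p w :
  f (n + p)%N w <= f n w + (birkhoff (f 1%N) (n + p)%N w - birkhoff (f 1%N) n w).
Proof.
elim: p => [|p IH]; first by rewrite addn0 subrr addr0.
rewrite addnS -addn1; apply: le_trans (cf _ _ _) _.
by rewrite birkhoffD {2}/birkhoff big_nat1; have -> : shiftn 0 (shiftn (n + p)%N w) = shiftn (n + p)%N w by []; lra.
Qed.

(* Averaging the subadditive decompositions of [M + n] over the [n] possible
   positions of the first cut. *)
Lemma averaged_cuts n M w : (0 < n)%N ->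
  n%:R * f (M + n)%N w <= \sum_(0 <= r < n) f r w + birkhoff (f n) M w +
    n%:R * (birkhoff (f 1%N) (M + n)%N w - birkhoff (f 1%N) M w).
Proof.
case: n => // n _; pose Phi t := \sum_(0 <= r < n.+1) f (t + r)%N w.
have PhiS t : Phi t.+1 <= Phi t + f n.+1 (shiftn t w).
  rewrite /Phi big_nat_recr //= [X in _ <= X + _]big_nat_recl //= addn0.
  have -> : \sum_(0 <= i < n) f (t.+1 + i)%N w = \sum_(0 <= i < n) f (t + i.+1)%N w.
    by apply: eq_bigr => i _; rewrite addSnnS.
  by have := cf t n.+1 w; rewrite -addSnnS; lra.
have PhiM t : Phi t <= \sum_(0 <= r < n.+1) f r w + birkhoff (f n.+1) t w.
  elim: t => [|t IH]; first by rewrite /birkhoff big_nil addr0.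
  rewrite -addn1 birkhoffD {2}/birkhoff big_nat1 addn1.
  have -> : shiftn 0 (shiftn t w) = shiftn t w by [].
  by have := PhiS t; lra.
apply: le_trans (lerD (PhiM M) (lexx _)).
rewrite -[n.+1 in leLHS]subn0 !mulr_natl.
rewrite -{1}[n.+1]subn0 -sumr_const_nat -[X in _ *+ X]subn0 -sumr_const_nat -big_split /=.
rewrite big_nat_cond [leRHS]big_nat_cond; apply: ler_sum => r /andP[/andP[_ rn] _].
have := cocycle_birkhoff (M + r) (n.+1 - r) w.
have -> : (M + r + (n.+1 - r) = M + n.+1)%N by lia.
have := @birkhoff_mono (f 1%N) M (M + r) w (nf 1%N).2 (leq_addr _ _).
lra.
Qed.

Lemma filterS4 (U : Type) (F : set_system U) (FF : Filter F) (A B C D E : set U) :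
  (forall x, A x -> B x -> C x -> D x -> E x) -> F A -> F B -> F C -> F D -> F E.
Proof.
move=> ABCDE FA FB FC FD; apply: filterS (filterI (filterI FA FB) (filterI FC FD)).
by move=> x [[? ?] [? ?]]; apply: ABCDE.
Qed.

(** For the upper half, averaging over the cuts leaves a Birkhoff sum of f_n along the shift itself
    rather than its n-th power, so the ergodicity of the shift suffices. The boundary term is a
    difference of two Birkhoff sums of f_1 with the same slope, hence small against M; this is where
    Birkhoff's theorem is used from both sides. *)
Lemma kingman : {ae P, forall w, asymptotic (f ^~ w) (rate P f)}.
Proof.
have finn := Ex_fin hP nf cf f0 fin1.
have low := kingman_lower hP nf cf f0 ff fin1.
have up := ae_foralln (fun n => birkhoff_upper hP (nf n) (finn n)).
have up1 := birkhoff_upper hP (nf 1%N) fin1.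
have low1 := birkhoff_lower (nf 1%N) fin1.
apply: filterS4 low up up1 low1 => w {}low {}up {}up1 {}low1 e e0.
(* The four quarters of e go to the choice of n, the Birkhoff sum of f_n, the boundary term (as two
   eighths) and the constant [C]. *)
have e4 : 0 < e / 4 by rewrite divr_gt0.
have e8 : 0 < e / 8 by rewrite divr_gt0.
have [n n0 mn] := rate_near P nf e4.
have [N1 H1] := low e e0; have [N2 H2] := up n _ e4.
have [N3 H3] := up1 _ e8; have [N4 H4] := low1 _ e8.
set a1 := fine _ in H3 H4.
pose C := \sum_(0 <= r < n) f r w + n%:R * (n%:R * a1).
have [N5 H5] := natr_large C e4.
exists (N1 + N2 + N3 + N4 + N5 + n)%N => L LN.
rewrite ler_distl; apply/andP; split.
  by rewrite -mulrBl; apply: H1; lia.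
have [M EL] : exists M, L = (M + n)%N by exists (L - n)%N; lia.
have [h2 [h3 h4]] : (N2 <= M)%N /\ (N3 <= M + n)%N /\ (N4 <= M)%N by lia.
have h5 : (N5 <= L)%N by lia.
have := averaged_cuts M w n0.
have {}H2 := H2 M h2; have {}H3 := H3 (M + n)%N h3; have {}H4 := H4 M h4.
have {}H5 := H5 L h5.
rewrite -[fine _]/(mean P f n) in H2.
have M0 : 0 <= M%:R :> R by [].
have n1 : 1 <= n%:R :> R by rewrite ler1n.
have EL' : L%:R = M%:R + n%:R :> R by rewrite EL natrD.
have Ln : L%:R <= n%:R * L%:R :> R by rewrite ler_peMl.
have r0 := rate_ge0 P nf.
have mnM : mean P f n * M%:R <= (rate P f + e / 4) * n%:R * M%:R by rewrite ler_wpM2r.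
have eM : e / 4 * M%:R <= e / 4 * (n%:R * M%:R) by rewrite ler_pM2l // ler_peMl.
have eL : e / 4 * L%:R <= e / 4 * (n%:R * L%:R) by rewrite ler_pM2l.
have n_pos : 0 < n%:R :> R by rewrite ltr0n.
have H34 : n%:R * (birkhoff (f 1%N) (M + n)%N w - birkhoff (f 1%N) M w) <=
    n%:R * ((a1 + e / 8) * (M + n)%:R - (a1 - e / 8) * M%:R).
  by rewrite ler_pM2l // lerB.
rewrite -EL => key; rewrite -EL EL' in H34.
rewrite -(ler_pM2l n_pos).
have rn2 : 0 <= rate P f * (n%:R * n%:R) by rewrite !mulr_ge0.
have en2 : 0 <= e * (n%:R * n%:R) by rewrite !mulr_ge0 // ltW.
have enM : 0 <= e * (n%:R * M%:R) by rewrite !mulr_ge0 // ltW.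
rewrite EL' in H5 eL *.
move: key; rewrite /C in H5.
move: (f L w) (birkhoff _ _ w) (birkhoff (f 1%N) _ _) (birkhoff (f 1%N) _ _) H2 H34 => *.
lra.
Qed.

End KingmanLimit.

(** * Law of the walk on the free group *)

Section Esum.
Context (R : realType).
Local Open Scope ereal_scope.

Lemma esum_exchange (I J : choiceType) (a : I -> J -> \bar R) : (forall i j, 0 <= a i j) ->
  \esum_(i in [set: I]) \esum_(j in [set: J]) a i j =
  \esum_(j in [set: J]) \esum_(i in [set: I]) a i j.
Proof.
move=> a0; rewrite esum_esum // [RHS]esum_esum //.
apply: (reindex_esum _ _ (fun x : J * I => (x.2, x.1))); split=> //.
- by move=> [i j] [i' j'] _ _ [-> ->].
- by move=> [i j] _; exists (j, i).
Qed.

Lemma esumZ_le (I : choiceType) (c : R) (a : I -> \bar R) : (0 <= c)%R ->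
  (forall i, 0 <= a i) ->
  \esum_(i in [set: I]) (c%:E * a i) <= c%:E * \esum_(i in [set: I]) a i.
Proof.
move=> c0 a0; apply: ge_ereal_sup => _ [X [finX _] <-].
rewrite -ge0_mule_fsumr // lee_wpmul2l //.
by apply: esum_ge; exists X.
Qed.

Lemma esumZ (I : choiceType) (c : R) (a : I -> \bar R) : (0 <= c)%R ->
  (forall i, 0 <= a i) ->
  \esum_(i in [set: I]) (c%:E * a i) = c%:E * \esum_(i in [set: I]) a i.
Proof.
move=> c0 a0; apply/eqP; rewrite eq_le esumZ_le //=.
have [->|cn0] := eqVneq c 0%R.
  by rewrite mul0e esum_ge0 // => i _; rewrite mul0e.
have cp : (0 < c)%R by rewrite lt_neqAle eq_sym cn0.
have := @esumZ_le I c^-1 (fun i => c%:E * a i).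
rewrite invr_ge0 => /(_ c0) H.
have {H} : \esum_(i in [set: I]) a i <= c^-1%:E * \esum_(i in [set: I]) (c%:E * a i).
  apply: le_trans (H _); last by move=> i; rewrite mule_ge0.
  by apply: le_esum => i _; rewrite muleA -EFinM mulVf // mul1e.
have c0' : 0 <= c%:E by rewrite lee_fin.
move=> /(lee_wpmul2l c0').
by rewrite muleA -EFinM divff // mul1e.
Qed.

Lemma esum_seq_le (I : choiceType) (s : seq I) (a : I -> \bar R) : uniq s ->
  (forall i, 0 <= a i) -> \sum_(i <- s) a i <= \esum_(i in [set: I]) a i.
Proof.
move=> us a0; apply: esum_ge; exists [set` s] => //.
by rewrite fsbig_seq.
Qed.

Lemma reindex_esumT (I J : choiceType) (e : I -> J) (a : J -> \bar R) : bijective e ->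
  \esum_(j in [set: J]) a j = \esum_(i in [set: I]) a (e i).
Proof. by move=> be; apply: reindex_esum; rewrite setTT_bijective. Qed.

(** The values of X are numbered by [pickle], so that the partition becomes a sequence and countable
    additivity applies. *)
Lemma total_probability d (T : measurableType d) (P : probability T R) (I : countType)
    (X : T -> I) (A : set T) :
  measurable A -> (forall i, measurable (X @^-1` [set i])) ->
  P A = \esum_(i in [set: I]) P (A `&` X @^-1` [set i]).
Proof.
move=> mA mX; pose B n := A `&` [set w | choice.pickle (X w) = n].
have BE n : B n = if choice.unpickle n is Some i then
    (if choice.pickle i == n then A `&` X @^-1` [set i] else set0) else set0.
  apply/seteqP; split => w.
    by move=> [Aw <-]; rewrite choice.pickleK eqxx.
  by case: choice.unpickle => // i; case: eqP => // <- [Aw Xi]; split=> //=; move: Xi => /= ->.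
have mB n : measurable (B n).
  by rewrite BE; case: choice.unpickle => // i; case: eqP => // _; apply: measurableI.
have tB : trivIset setT B by move=> i j _ _ [w [[_ /= <-] [_ /= <-]]].
have -> : P A = \esum_(n in [set: nat]) P (B n).
  have -> : A = \bigcup_(n in [set: nat]) B n.
    apply/seteqP; split => w; last by move=> [n _ []].
    by move=> Aw; exists (choice.pickle (X w)).
  rewrite measure_bigcup // nneseries_esum //; congr esum.
  by apply/seteqP; split => n //= _; rewrite in_setT.
transitivity (\esum_(n in choice.pickle @` [set: I]) P (B n)).
  rewrite [RHS]esum_mkcond; apply: eq_esum => n _; case: ifPn => // nI.
  rewrite BE; case E: choice.unpickle => [i|]; last exact: measure0.
  case: eqP => [pi|_]; last exact: measure0.
  by move: nI; rewrite -pi mem_set //; exists i.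
rewrite esum_image; last by move=> i j _ _ /(pcan_inj choice.pickleK).
apply: eq_esum => i _; congr (P _); rewrite BE choice.pickleK eqxx //.
Qed.

End Esum.

Section Countability.
Variables m k : nat.

Definition conf_code (f : configuration m k) : seq (free_group k * 'Z_m) :=
  [seq (x, f x) | x <- finsupp f].

Lemma conf_code_inj : injective conf_code.
Proof.
have H (f g : configuration m k) x : conf_code f = conf_code g -> x \in finsupp f -> f x = g x.
  move=> E xf; have : (x, f x) \in conf_code f by apply: map_f.
  by rewrite E => /mapP[y _ [-> ->]].
move=> f g E; apply/fsfunP => x; have [xf|xf] := boolP (x \in finsupp f); first exact: H.
have [xg|xg] := boolP (x \in finsupp g); first by rewrite (H g f).
by rewrite !fsfun_dflt.
Qed.

(** Countability of the group lets an event about w_n be written as a countable union over the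
    values of the walk. *)
Definition lamp_code (x : lamplighter m k) : nat := choice.pickle (x.1, conf_code x.2).

Lemma lamp_code_inj : injective lamp_code.
Proof. by move=> [u f] [v g] /(pcan_inj choice.pickleK)[-> /conf_code_inj ->]. Qed.

End Countability.

Section WalkLaw.
Variables (m k : nat) (R : realType) (mu : probability (lamplighter m k) R).
Variable P : probability (sequence_space (lamplighter m k)) R.
Hypothesis hP : is_power_measure mu P.
Local Notation Omega := (sequence_space (lamplighter m k)).

Lemma walkD (g : Omega) n p : walk g (n + p) = (walk g n * walk (shiftn n g) p)%g.
Proof.
elim: p => [|p IH]; first by rewrite addn0 walk0 mulg1.
by rewrite addnS !walkS IH mulgA.
Qed.

Lemma measurable_walk n (A : set (lamplighter m k)) :
  measurable [set w : Omega | A (walk w n)].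
Proof.
elim: n A => [|n IH] A.
  have [A1|A1] := pselect (A 1%g).
    by rewrite (_ : [set _ | _] = setT) //; apply/seteqP; split => w //= _; rewrite walk0.
  by rewrite (_ : [set _ | _] = set0) //; apply/seteqP; split => w //=; rewrite walk0.
rewrite (_ : [set _ | _] = \bigcup_i
    [set w : Omega | lamp_code (walk w n) = i /\ A (walk w n * w n)%g]); last first.
  apply/seteqP; split => w /=; rewrite ?walkS; first by exists (lamp_code (walk w n)).
  by move=> [i _ []].
apply: bigcupT_measurable => i.
have [[x xi]|N] := pselect (exists x : lamplighter m k, lamp_code x = i); last first.
  rewrite (_ : [set _ | _] = set0) //; apply/seteqP; split => w //= [E _].
  by apply: N; exists (walk w n).
rewrite (_ : [set _ | _] = [set w : Omega | walk w n = x] `&`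
    (fun w : Omega => w n) @^-1` [set h | A (x * h)%g]).
  apply: measurableI; first exact: (IH [set x]).
  by rewrite -[X in measurable X]setTI; apply: measurable_coordinate.
apply/seteqP; split => w /= [].
  by rewrite -xi => /lamp_code_inj E Aw; rewrite E in Aw.
by move=> -> ?; split.
Qed.

Lemma measurable_fun_walk n (phi : lamplighter m k -> R) :
  measurable_fun [set: Omega] (fun w => phi (walk w n)).
Proof.
by move=> _ B mB; rewrite setTI; exact: (measurable_walk n (phi @^-1` B)).
Qed.

Definition at_time n (x : free_group k) : set Omega := [set w | (walk w n).1 = x].

Lemma measurable_at_time n x : measurable (at_time n x).
Proof. exact: (measurable_walk n [set y | y.1 = x]). Qed.

Lemma at_timeD n p x y : at_time n x `&` at_time (n + p) y =
  at_time n x `&` shiftn n @^-1` at_time p (x^-1 * y)%g.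
Proof.
apply/seteqP; split => w; rewrite /at_time /= => -[<-]; rewrite walkD /=.
  by move=> <-; split=> //=; rewrite mulKg.
by move=> E; split=> //=; rewrite E mulVKg.
Qed.

Lemma walk1 (w : Omega) : walk w 1 = w 0%N.
Proof. by rewrite /walk big_ord1. Qed.

(** The Markov property. The event [at_time n x] is not a box, so one splits by the first step and
    applies [box_shift_indep] to that step alone. *)
Lemma at_time_indep n x E : measurable E ->
  P (at_time n x `&` shiftn n @^-1` E) = (P (at_time n x) * P E)%E.
Proof.
elim: n x E => [|n IH] x E mE.
  have [->|x1] := eqVneq x 1%g.
    have -> : at_time 0 1%g = setT by apply/seteqP; split=> w //= _; rewrite /at_time /= walk0.
    by rewrite setTI probability_setT mul1e; congr (P _); apply/seteqP; split.
  have -> : at_time 0 x = set0.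
    by apply/seteqP; split=> w //=; rewrite /at_time /= walk0 => /eqP; rewrite eq_sym (negPf x1).
  by rewrite set0I measure0 mul0e.
pose A s : nat -> set (lamplighter m k) := fun _ => [set g | g.1 = s].
have mA s i : measurable (A s i) by [].
have step s F : measurable F ->
    P (at_time n.+1 x `&` shiftn n.+1 @^-1` F `&` at_time 1 s) =
    (P (box 1 (A s)) * (P (at_time n (s^-1 * x)%g) * P F))%E.
  move=> mF; rewrite -IH // -(box_shift_indep hP) //; last first.
    apply: measurableI; first exact: measurable_at_time.
    by rewrite -[X in measurable X]setTI; apply: measurable_shiftn.
  congr (P _); rewrite setIAC -[n.+1]add1n.
  rewrite [X in X `&` _]setIC at_timeD -setIA.
  congr (_ `&` _).
  apply/seteqP; split=> w; rewrite /at_time /= walk1.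
    by move=> ws [|//] _.
  by move=> /(_ 0%N isT).
have mX1 i : measurable ((fun w : Omega => (walk w 1).1) @^-1` [set i]).
  exact: (measurable_at_time 1 i).
have mS F : measurable F -> measurable (at_time n.+1 x `&` shiftn n.+1 @^-1` F).
  move=> mF; apply: measurableI; first exact: measurable_at_time.
  by rewrite -[X in measurable X]setTI; apply: measurable_shiftn.
rewrite (total_probability P (mS E mE) mX1).
have -> : P (at_time n.+1 x) = P (at_time n.+1 x `&` shiftn n.+1 @^-1` setT).
  by rewrite preimage_setT setIT.
rewrite (total_probability P (mS _ measurableT) mX1) muleC.
have [r Er] := prob_scale P mE; rewrite Er -esumZ //; apply: eq_esum => s _.
by rewrite !step // probability_setT mule1 Er muleA [RHS]muleC.
Qed.

End WalkLaw.

(** * Contraction of the convolution operator *)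

(** (a + t)^2 <= 2 a^2 + 2 t^2 with t the sum of the other four, then Cauchy-Schwarz for t. *)
Lemma sqr_sum5 (R : realFieldType) (a b c d e : R) :
  (a + b + c + d + e) ^+ 2 <=
  2 * a ^+ 2 + 8 * b ^+ 2 + 8 * c ^+ 2 + 8 * d ^+ 2 + 8 * e ^+ 2.
Proof.
rewrite -subr_ge0.
have -> : 2 * a ^+ 2 + 8 * b ^+ 2 + 8 * c ^+ 2 + 8 * d ^+ 2 + 8 * e ^+ 2 -
    (a + b + c + d + e) ^+ 2 =
  (a - b - c - d - e) ^+ 2 + 2 * ((b - c) ^+ 2 + (b - d) ^+ 2 + (b - e) ^+ 2 +
    (c - d) ^+ 2 + (c - e) ^+ 2 + (d - e) ^+ 2) by ring.
by rewrite addr_ge0 ?sqr_ge0 // mulr_ge0 // !addr_ge0 ?sqr_ge0.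
Qed.

(** [sqr_sum5] with the only index outside b, if any, singled out. Weight 8 would do for 12; with
    12, one heavy and four light weights add up to 20. *)
Lemma weighted_sqr_sum5 (R : realFieldType) (z : nat -> R) (b : nat -> bool) :
  (forall i j, (i < 5)%N -> (j < 5)%N -> i != j -> b i || b j) ->
  (\sum_(0 <= i < 5) z i) ^+ 2 <= \sum_(0 <= i < 5) (if b i then 12 else 2) * z i ^+ 2.
Proof.
move=> H; rewrite unlock /= !addr0 !addrA.
have := sqr_sum5 (z 0%N) (z 1%N) (z 2%N) (z 3%N) (z 4%N).
have := sqr_sum5 (z 1%N) (z 0%N) (z 2%N) (z 3%N) (z 4%N).
have := sqr_sum5 (z 2%N) (z 0%N) (z 1%N) (z 3%N) (z 4%N).
have := sqr_sum5 (z 3%N) (z 0%N) (z 1%N) (z 2%N) (z 4%N).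
have := sqr_sum5 (z 4%N) (z 0%N) (z 1%N) (z 2%N) (z 3%N).
have -> : z 1%N + z 0%N + z 2%N + z 3%N + z 4%N = z 0%N + z 1%N + z 2%N + z 3%N + z 4%N by ring.
have -> : z 2%N + z 0%N + z 1%N + z 3%N + z 4%N = z 0%N + z 1%N + z 2%N + z 3%N + z 4%N by ring.
have -> : z 3%N + z 0%N + z 1%N + z 2%N + z 4%N = z 0%N + z 1%N + z 2%N + z 3%N + z 4%N by ring.
have -> : z 4%N + z 0%N + z 1%N + z 2%N + z 3%N = z 0%N + z 1%N + z 2%N + z 3%N + z 4%N by ring.
have := sqr_ge0 (z 0%N); have := sqr_ge0 (z 1%N); have := sqr_ge0 (z 2%N).
have := sqr_ge0 (z 3%N); have := sqr_ge0 (z 4%N).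
move: (H 0%N 1%N isT isT isT) (H 0%N 2%N isT isT isT) (H 0%N 3%N isT isT isT)
  (H 0%N 4%N isT isT isT) (H 1%N 2%N isT isT isT) (H 1%N 3%N isT isT isT)
  (H 1%N 4%N isT isT isT) (H 2%N 3%N isT isT isT) (H 2%N 4%N isT isT isT)
  (H 3%N 4%N isT isT isT).
move: (z 0%N ^+ 2) (z 1%N ^+ 2) (z 2%N ^+ 2) (z 3%N ^+ 2) (z 4%N ^+ 2) (_ ^+ 2).
move=> q0 q1 q2 q3 q4 S.
by case: (b 0%N); case: (b 1%N); case: (b 2%N); case: (b 3%N); case: (b 4%N) => //=;
  do 10 (move=> _); lra.
Qed.

(** Squared deviations have the least sum when taken from the mean of the five values. *)
Lemma variance_sum5 (R : realFieldType) (z : nat -> R) (M : R) :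
  \sum_(0 <= i < 5) z i ^+ 2 - (\sum_(0 <= i < 5) z i) ^+ 2 / 5 <=
  \sum_(0 <= i < 5) (z i - M) ^+ 2.
Proof.
rewrite unlock /= -subr_ge0.
move: (z 0%N) (z 1%N) (z 2%N) (z 3%N) (z 4%N) => a b c d e.
set X := (X in 0 <= X).
have -> : X = 5 * (M - (a + b + c + d + e) / 5) ^+ 2 by rewrite /X; field.
by rewrite mulr_ge0 // sqr_ge0.
Qed.

Section Contraction.
Variables (k : nat) (R : realType).
Local Notation F := (free_group k).
Variables (kappa u v : F -> R).
Hypothesis kappa0 : forall g, 0 <= kappa g.
Hypothesis kappa1 : (\esum_(g in [set: F]) (kappa g)%:E = 1)%E.
Hypothesis u0 : forall x, 0 <= u x.
Hypothesis u1 : forall x, u x <= 1.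
Hypothesis vE : forall x, ((v x)%:E = \esum_(g in [set: F]) (kappa g * u (g^-1 * x)%g)%:E)%E.

Definition sqnorm (f : F -> R) : \bar R := (\esum_(x in [set: F]) (f x ^+ 2)%:E)%E.

Hypothesis fin_u : (sqnorm u < +oo)%E.

Variables (s : nat -> F) (a : nat) (beta : R).
Hypothesis ping : forall i, (i < 5)%N -> (a.*2 <= flen (s i))%N /\
  forall j, (j < 5)%N -> i != j ->
    (lcp (val (s i)) (val (s j)) < a)%N /\
    (lcp (val (s i)^-1%g) (val (s j)^-1%g) < a)%N.
Hypothesis beta0 : 0 < beta.
Hypothesis kappa_s : forall i, (i < 5)%N -> beta <= kappa (s i).

Let Z x i := u ((s i)^-1 * x)%g.
Let S x := \sum_(0 <= i < 5) Z x i.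
Let S2 x := \sum_(0 <= i < 5) Z x i ^+ 2.

Lemma sqnorm_translate (f : F -> R) g : sqnorm f = (\esum_(x in [set: F]) (f (g^-1 * x)%g ^+ 2)%:E)%E.
Proof.
rewrite /sqnorm (@reindex_esumT _ _ _ (fun x => g^-1 * x)%g) //.
by exists (fun x => g * x)%g => x; rewrite ?mulKg ?mulVKg.
Qed.

Let Q x := (\esum_(g in [set: F]) (kappa g * u (g^-1 * x)%g ^+ 2)%:E)%E.

Let s_inj i j : (i < 5)%N -> (j < 5)%N -> s i = s j -> i = j.
Proof.
move=> i5 j5 E; apply/eqP; apply: contraT => ij.
have [ai /(_ j j5 ij)[]] := ping i5; rewrite -E => h _.
have : (flen (s i) <= lcp (val (s i)) (val (s i)))%N by rewrite -prefix_lcp prefix_refl.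
by move: (flen _) (lcp _ _) ai h => *; lia.
Qed.

(* [Q - v^2] is the variance of [u (g^-1 x)] for [g] of law [kappa]; it is bounded
   below by its part carried by the five atoms [s i]. *)
Lemma jensen_gap x : exists q : R, Q x = q%:E /\
  v x ^+ 2 + beta * S2 x <= q + beta / 5 * S x ^+ 2.
Proof.
pose M := v x; pose z g := u (g^-1 * x)%g.
pose D := (\esum_(g in [set: F]) (kappa g * (z g - M) ^+ 2)%:E)%E.
have z0 g : 0 <= z g by exact: u0.
have M0 : 0 <= M.
  by rewrite -lee_fin vE esum_ge0 // => g _; rewrite lee_fin mulr_ge0.
have D0 : (0 <= D)%E by apply: esum_ge0 => g _; rewrite lee_fin mulr_ge0 ?sqr_ge0.
have Q0 : (0 <= Q x)%E by apply: esum_ge0 => g _; rewrite lee_fin mulr_ge0 ?sqr_ge0.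
have Q1 : (Q x <= 1)%E.
  rewrite -kappa1; apply: le_esum => g _; rewrite lee_fin ler_piMr //.
  by rewrite exprn_ile1.
(* The expanded square, with the negative cross term moved to the other side so that only
   nonnegative terms are summed. *)
have idE : (D + (2 * M * M)%:E = Q x + (M ^+ 2)%:E)%E.
  transitivity (\esum_(g in [set: F])
      ((kappa g * (z g - M) ^+ 2)%:E + (2 * M)%:E * (kappa g * z g)%:E))%E.
    rewrite esumD; first last.
    - by move=> g _; rewrite -EFinM lee_fin !mulr_ge0.
    - by move=> g _; rewrite lee_fin mulr_ge0 ?sqr_ge0.
    rewrite esumZ ?mulr_ge0 //; last by move=> g; rewrite lee_fin mulr_ge0.
    by rewrite -vE -EFinM.
  transitivity (\esum_(g in [set: F])
      ((kappa g * z g ^+ 2)%:E + (M ^+ 2)%:E * (kappa g)%:E))%E.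
    by apply: eq_esum => g _; rewrite -!EFinM -!EFinD; congr EFin; ring.
  rewrite esumD; first last.
  - by move=> g _; rewrite -EFinM lee_fin mulr_ge0 ?sqr_ge0.
  - by move=> g _; rewrite lee_fin mulr_ge0 ?sqr_ge0.
  by rewrite esumZ ?sqr_ge0 // kappa1 mule1.
have [q Eq] : exists q, Q x = q%:E.
  exists (fine (Q x)); rewrite fineK // ge0_fin_numE //.
  exact: le_lt_trans Q1 (ltry _).
exists q; split => //; move: idE; rewrite Eq.
have DS : ((beta * \sum_(0 <= i < 5) (Z x i - M) ^+ 2)%:E <= D)%E.
  apply: le_trans (_ : (\sum_(g <- [seq s i | i <- iota 0 5]) (kappa g * (z g - M) ^+ 2)%:E <= _)%E);
    last first.
    apply: (@esum_seq_le _ _ _ (fun g => (kappa g * (z g - M) ^+ 2)%:E)); last first.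
      by move=> g; rewrite lee_fin mulr_ge0 ?sqr_ge0.
    rewrite map_inj_in_uniq ?iota_uniq // => i j; rewrite !mem_iota !add0n.
    by move=> /andP[_ i5] /andP[_ j5]; exact: s_inj.
  rewrite big_map sumEFin lee_fin mulr_sumr -/(index_iota 0 5) big_nat_cond [leRHS]big_nat_cond.
  apply: ler_sum => i /andP[/andP[_ i5] _].
  by rewrite ler_wpM2r ?sqr_ge0 ?kappa_s.
move: DS; case: D D0 => [dd _|_|//]; last by move=> _; rewrite addye // -EFinD.
rewrite lee_fin -!EFinD => DS [] E.
have := variance_sum5 (Z x) M; rewrite -/(S x) -/(S2 x) => V.
have : beta * (S2 x - S x ^+ 2 / 5) <= beta * \sum_(0 <= i < 5) (Z x i - M) ^+ 2.
  by rewrite ler_pM2l.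
move: E DS; rewrite -/M; move: (\sum_(0 <= i < 5) (Z x i - M) ^+ 2) => W; lra.
Qed.

Let bad i (y : F) := (a <= lcp (val (s i)^-1%g) (val y))%N.

(* Ping-pong: for each [x], all the points [s_i^-1 x] but one at most start like
   [s_i^-1], while a given [y] starts like at most one of the [s_i^-1]. *)
Lemma ping_pong_sqr : (\esum_(x in [set: F]) (S x ^+ 2)%:E <= 20%:E * sqnorm u)%E.
Proof.
have step1 x : S x ^+ 2 <=
    \sum_(0 <= i < 5) (if bad i ((s i)^-1 * x)%g then 12 else 2) * Z x i ^+ 2.
  apply: weighted_sqr_sum5 => i j i5 j5 ij; apply: contraT; rewrite negb_or /bad -!ltnNge.
  move=> /andP[bi bj].
  (* The common prefix of s_t with x and that of s_t^-1 with s_t^-1 x have lengths adding up to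
     |s_t| >= 2a. *)
  have good t : (t < 5)%N -> (lcp (val (s t)^-1%g) (val ((s t)^-1 * x)%g) < a)%N ->
      (a <= lcp (val (s t)) (val x))%N.
    move=> t5; have [at2 _] := ping t5.
    have := flenVM (s t)^-1%g ((s t)^-1 * x)%g; rewrite invgK mulVKg flenV.
    have := flenVM (s t) x.
    by move: at2; move: (flen _) (flen _) (flen _) (lcp _ _) (lcp _ _) => *; lia.
  have [_ /(_ j j5 ij)[lt _]] := ping i5.
  have gj := good j j5 bj; rewrite lcpC in gj.
  by have := lcp_ultra (good i i5 bi) gj; rewrite leqNgt lt.
apply: le_trans (_ : (\esum_(x in [set: F]) \sum_(0 <= i < 5)
   ((if bad i ((s i)^-1 * x)%g then 12 else 2) * Z x i ^+ 2)%:E <= _)%E).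
  by apply: le_esum => x _; rewrite sumEFin lee_fin.
have nn i y : 0 <= (if bad i y then 12 else 2) * u y ^+ 2.
  by rewrite mulr_ge0 ?sqr_ge0 //; case: ifP.
rewrite esum_sum; last by move=> x i _ _; rewrite lee_fin; exact: nn.
rewrite (eq_bigr (fun i => \esum_(y in [set: F]) ((if bad i y then 12 else 2) * u y ^+ 2)%:E)%E); last first.
  move=> i _; rewrite [RHS](@reindex_esumT _ _ _ (fun x => (s i)^-1 * x)%g) //.
  by exists (fun x => s i * x)%g => x; rewrite ?mulKg ?mulVKg.
rewrite -esum_sum; last by move=> x i _ _; rewrite lee_fin; exact: nn.
rewrite -esumZ //; last by move=> x; rewrite lee_fin sqr_ge0.
apply: le_esum => y _; rewrite sumEFin -EFinM lee_fin -mulr_suml ler_wpM2r ?sqr_ge0 //.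
have excl i j : (i < 5)%N -> (j < 5)%N -> i != j -> bad i y -> bad j y -> False.
  move=> i5 j5 ij bi bj; have [_ /(_ j j5 ij)[_ lt]] := ping i5.
  by move: bj; rewrite /bad lcpC => /(lcp_ultra bi); rewrite leqNgt lt.
(* At most one weight is 12, so the five add up to at most 20. *)
rewrite unlock /=.
move: (excl 0%N 1%N isT isT isT) (excl 0%N 2%N isT isT isT) (excl 0%N 3%N isT isT isT)
  (excl 0%N 4%N isT isT isT) (excl 1%N 2%N isT isT isT) (excl 1%N 3%N isT isT isT)
  (excl 1%N 4%N isT isT isT) (excl 2%N 3%N isT isT isT) (excl 2%N 4%N isT isT isT)
  (excl 3%N 4%N isT isT isT).
case: (bad 0 y); case: (bad 1 y); case: (bad 2 y); case: (bad 3 y); case: (bad 4 y);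
  move=> e1 e2 e3 e4 e5 e6 e7 e8 e9 e10;
  first [by exfalso; auto | lra].
Qed.

(** [jensen_gap] is summed over x: [S2] sums to 5 |u|^2 and the square of [S] to at most 20 |u|^2,
    so the gain 5 beta exceeds the loss 20 beta / 5 by beta. *)
Lemma sqnorm_contraction : (sqnorm v + beta%:E * sqnorm u <= sqnorm u)%E.
Proof.
have U0 : (0 <= sqnorm u)%E by apply: esum_ge0 => x _; rewrite lee_fin sqr_ge0.
have V0 : (0 <= sqnorm v)%E by apply: esum_ge0 => x _; rewrite lee_fin sqr_ge0.
have b0 := ltW beta0.
have S20 x : 0 <= S2 x by apply: sumr_ge0 => i _; exact: sqr_ge0.
have Q0 x : (0 <= Q x)%E by apply: esum_ge0 => g _; rewrite lee_fin mulr_ge0 ?sqr_ge0.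
have sumQ : (\esum_(x in [set: F]) Q x = sqnorm u)%E.
  rewrite /Q esum_exchange; last by move=> x g; rewrite lee_fin mulr_ge0 ?sqr_ge0.
  transitivity (\esum_(g in [set: F]) (fine (sqnorm u))%:E * (kappa g)%:E)%E.
    apply: eq_esum => g _; rewrite fineK ?ge0_fin_numE // muleC (sqnorm_translate u g).
    rewrite -esumZ //; last by move=> x; rewrite lee_fin sqr_ge0.
  rewrite esumZ ?kappa1 ?mule1 ?fineK ?ge0_fin_numE //; exact: fine_ge0.
have sumS2 : (\esum_(x in [set: F]) (S2 x)%:E = 5%:E * sqnorm u)%E.
  transitivity (\esum_(x in [set: F]) \sum_(0 <= i < 5) (Z x i ^+ 2)%:E)%E.
    by apply: eq_esum => x _; rewrite sumEFin.
  rewrite esum_sum; last by move=> x i _ _; rewrite lee_fin sqr_ge0.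
  rewrite (eq_bigr (fun=> sqnorm u)); last by move=> i _; rewrite (sqnorm_translate u (s i)).
  rewrite -[sqnorm u]fineK ?ge0_fin_numE // sumEFin sumr_const_nat subn0.
  by rewrite -EFinM mulr_natl.
have : (\esum_(x in [set: F]) ((v x ^+ 2)%:E + beta%:E * (S2 x)%:E) <=
    \esum_(x in [set: F]) (Q x + (beta / 5)%:E * (S x ^+ 2)%:E))%E.
  apply: le_esum => x _; have [q [-> h]] := jensen_gap x.
  by rewrite -!EFinM -!EFinD lee_fin.
rewrite esumD; first last.
- by move=> x _; rewrite -EFinM lee_fin mulr_ge0.
- by move=> x _; rewrite lee_fin sqr_ge0.
rewrite esumD; first last.
- by move=> x _; rewrite -EFinM lee_fin mulr_ge0 ?sqr_ge0 // divr_ge0.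
- by move=> x _; exact: Q0.
rewrite sumQ esumZ // sumS2 esumZ; first last.
- by move=> x; rewrite lee_fin sqr_ge0.
- by rewrite divr_ge0.
have := ping_pong_sqr; rewrite -/(sqnorm v).
have b5 : (0 <= (beta / 5)%:E)%E by rewrite lee_fin divr_ge0.
move=> /(lee_wpmul2l b5).
have [r Er] : exists r, sqnorm u = r%:E.
  by exists (fine (sqnorm u)); rewrite fineK // ge0_fin_numE.
rewrite Er; move: (sqnorm v) V0 => V V0; move: (_%:E * \esum_(x in _) _)%E => W.
rewrite -!EFinM => WE VW; have {VW WE} := le_trans VW (leeD (lexx r%:E) WE).
by case: V V0 => [vv _|//|//]; rewrite -!EFinD !lee_fin; lra.
Qed.

End Contraction.

(** * Positivity of the drift *)

Lemma finite_lower_bound (R : realType) (c : nat -> R) n : (forall i, (i < n)%N -> 0 < c i) ->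
  exists2 b : R, 0 < b & forall i, (i < n)%N -> b <= c i.
Proof.
elim: n => [|n IH] H; first by exists 1.
have [|b b0 Hb] := IH; first by move=> i lt; apply: H; rewrite ltnW.
exists (Num.min b (c n)); first by rewrite lt_min b0 H.
move=> i; rewrite ltnS leq_eqVlt => /orP[/eqP ->|/Hb le]; first by rewrite ge_min lexx orbT.
by rewrite ge_min le.
Qed.

Section LengthCocycle.
Variables (m k : nat) (R : realType) (len : lamplighter m k -> nat).
Hypothesis len1 : len 1%g = 0%N.
Hypothesis lenM : forall x y, (len (x * y)%g <= len x + len y)%N.
Hypothesis lenV : forall x, len x^-1%g = len x.
Local Notation Omega := (sequence_space (lamplighter m k)).

Definition walk_len n (w : Omega) : R := (len (walk w n))%:R.

Lemma nnrv_walk_len n : nnrv (walk_len n).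
Proof. by split=> [|w //]; exact: (measurable_fun_walk n (fun x => (len x)%:R)). Qed.

Lemma cocycle_walk_len : cocycle walk_len.
Proof. by move=> n p w; rewrite /walk_len walkD -natrD ler_nat lenM. Qed.

Lemma walk_len0 w : walk_len 0 w = 0.
Proof. by rewrite /walk_len walk0 len1. Qed.

Lemma walk_len_shift n w : `|walk_len n.+1 w - walk_len n (shiftn 1 w)| <= walk_len 1 w.
Proof.
rewrite /walk_len -[n.+1]add1n walkD; set x := walk w 1; set y := walk _ n.
have h1 := lenM x y; have := lenM x^-1%g (x * y)%g; rewrite mulKg lenV => h2.
rewrite ler_distl; apply/andP; split.
  by rewrite lerBlDr -natrD ler_nat addnC.
by rewrite -natrD ler_nat addnC.
Qed.

End LengthCocycle.

Section Words.
Variable k : nat.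

Fixpoint short_words (r : nat) : seq (seq (letter k)) :=
  if r is r'.+1 then [::] :: [seq a :: w | a <- enum {: letter k}, w <- short_words r']
  else [:: [::]].

Lemma mem_short_words r w : (size w <= r)%N -> w \in short_words r.
Proof.
elim: r w => [|r IH] [|a w] //= wr; rewrite inE; apply/orP; right.
by apply/allpairsP; exists (a, w); rewrite /= mem_enum IH.
Qed.

Lemma size_short_words r : (size (short_words r) <= #|{: letter k}|.+1 ^ r)%N.
Proof.
elim: r => //= r IH; rewrite size_allpairs -cardE expnS mulSn.
by rewrite -add1n leq_add ?expn_gt0 // leq_mul2l IH orbT.
Qed.

End Words.

Section Drift.
Variables (m k : nat) (R : realType) (mu : probability (lamplighter m k) R).
Variable P : probability (sequence_space (lamplighter m k)) R.
Hypothesis hP : is_power_measure mu P.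
Local Notation Omega := (sequence_space (lamplighter m k)).
Local Notation F := (free_group k).

Definition law n (x : F) : R := fine (P (at_time n x)).

Lemma lawE n x : (law n x)%:E = P (at_time n x).
Proof. by rewrite fineK // fin_num_measure //; exact: measurable_at_time. Qed.

Lemma law_ge0 n x : 0 <= law n x.
Proof. exact: fine_ge0. Qed.

Lemma law_le1 n x : law n x <= 1.
Proof. by rewrite -lee_fin lawE probability_le1 //; exact: measurable_at_time. Qed.

Lemma law_sum n : (\esum_(x in [set: F]) (law n x)%:E = 1)%E.
Proof.
rewrite -(probability_setT P) (@total_probability _ _ _ P _ (fun w : Omega => (walk w n).1)) //.
  by apply: eq_esum => x _; rewrite setTI lawE.
by move=> x; exact: (measurable_at_time n x).
Qed.

Lemma lawD N n x :
  ((law (N + n) x)%:E = \esum_(g in [set: F]) (law N g * law n (g^-1 * x)%g)%:E)%E.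
Proof.
rewrite lawE (@total_probability _ _ _ P _ (fun w : Omega => (walk w N).1)) //; first last.
- by move=> g; exact: (measurable_at_time N g).
- exact: measurable_at_time.
apply: eq_esum => g _; rewrite EFinM !lawE -(at_time_indep hP) ?measurable_at_time //.
  by rewrite setIC -at_timeD.
exact: measurable_at_time.
Qed.

Lemma law_mul_gt0 n p x y : 0 < law n x -> 0 < law p y -> 0 < law (n + p) (x * y)%g.
Proof.
move=> nx py; apply: lt_le_trans (_ : law n x * law p y <= _); first exact: mulr_gt0.
rewrite -lee_fin lawD.
apply: le_trans (_ : (\sum_(g <- [:: x]) (law n g * law p (g^-1 * (x * y))%g)%:E <= _)%E).
  by rewrite big_seq1 mulKg.
by apply: esum_seq_le => // g; rewrite lee_fin mulr_ge0 // law_ge0.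
Qed.

Lemma law0_gt0 : 0 < law 0 1%g.
Proof.
have E : at_time 0 1%g = [set: Omega].
  by apply/seteqP; split=> w //= _; rewrite /at_time /= walk0.
by rewrite -lte_fin lawE E probability_setT lte_fin.
Qed.

Lemma law_exp_gt0 n x : 0 < law 1 x -> 0 < law n (x ^+ n)%g.
Proof.
move=> x1; elim: n => [|n IH]; first exact: law0_gt0.
by rewrite expgS -add1n law_mul_gt0.
Qed.

Lemma law_supp g : supp mu g -> 0 < law 1 g.1.
Proof.
move=> sg; rewrite -lte_fin lawE.
have mg : measurable (box 1 (fun _ => [set g])) by apply: measurable_box.
apply: lt_le_trans (_ : P (box 1 (fun _ => [set g])) <= _)%E.
  by rewrite (box_prob hP) // big_ord1 lt_neqAle eq_sym sg measure_ge0.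
apply: le_measure; rewrite ?inE //; first exact: measurable_at_time.
by move=> w /(_ 0%N isT) /= E; rewrite /at_time /= walk1 E.
Qed.

Lemma sqnorm_law_le1 n : (sqnorm (law n) <= 1)%E.
Proof.
rewrite -(law_sum n); apply: le_esum => x _; rewrite lee_fin expr2 ler_piMr ?law_ge0 //.
exact: law_le1.
Qed.

Lemma sqnorm_law_ge0 n : (0 <= sqnorm (law n))%E.
Proof. by apply: esum_ge0 => x _; rewrite lee_fin sqr_ge0. Qed.

Hypothesis noncomm : exists g h, [/\ supp mu g, supp mu h & (g.1 * h.1 <> h.1 * g.1)%g].

Lemma law_contracts : exists (N : nat) (beta : R), [/\ (0 < N)%N, 0 < beta, beta <= 1 &
  forall n, (sqnorm (law (N + n)) + beta%:E * sqnorm (law n) <= sqnorm (law n))%E].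
Proof.
have [g [h [sg sh /ping_pong[n [a ping]]]]] := noncomm.
pose s i := (g.1 ^+ i * h.1 ^+ n * g.1 ^+ (4 - i))%g.
have pos i : (i < 5)%N -> 0 < law (n + 4) (s i).
  move=> i5; have -> : (n + 4 = i + n + (4 - i))%N by lia.
  by do !apply: law_mul_gt0; apply: law_exp_gt0; exact: law_supp.
have [beta b0 Hb] := finite_lower_bound pos.
exists (n + 4)%N, beta; split=> [||| p] //; first by rewrite addn4.
  exact: le_trans (Hb 0%N isT) (law_le1 _ _).
apply: (@sqnorm_contraction k R (law (n + 4)) (law p) _ _ _ _ _ _ _ s a beta) => //.
- by move=> x; exact: law_ge0.
- exact: law_sum.
- by move=> x; exact: law_ge0.
- by move=> x; exact: law_le1.
- by move=> x; exact: lawD.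
- exact: le_lt_trans (sqnorm_law_le1 _) (ltry _).
Qed.

(** A squared value is at most the squared norm, which shrinks by the factor 1 - beta every N
    steps. *)
Lemma law_decay : exists (N : nat) (beta : R), [/\ (0 < N)%N, 0 < beta, beta <= 1 &
  forall q x, law (N * q) x ^+ 2 <= (1 - beta) ^+ q].
Proof.
have [N [beta [N0 b0 b1 H]]] := law_contracts; exists N, beta; split => // q x.
have fin n : sqnorm (law n) = (fine (sqnorm (law n)))%:E.
  rewrite fineK // ge0_fin_numE ?sqnorm_law_ge0 //.
  exact: le_lt_trans (sqnorm_law_le1 _) (ltry _).
have : fine (sqnorm (law (N * q))) <= (1 - beta) ^+ q.
  elim: q => [|q IH]; first by rewrite -lee_fin -fin muln0 expr0 sqnorm_law_le1.
  have := H (N * q)%N; rewrite -mulnS (fin (N * q)%N) (fin (N * q.+1)%N) -EFinM -EFinD lee_fin => h.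
  rewrite exprS; apply: le_trans (_ : (1 - beta) * fine (sqnorm (law (N * q))) <= _).
    by lra.
  by rewrite ler_wpM2l // subr_ge0.
apply: le_trans; rewrite -lee_fin -fin.
apply: le_trans (_ : (\sum_(y <- [:: x]) (law (N * q) y ^+ 2)%:E <= _)%E).
  by rewrite big_seq1.
by apply: esum_seq_le => // y; rewrite lee_fin sqr_ge0.
Qed.

Definition tree_len : lamplighter m k -> nat := fun x => flen x.1.

Lemma ball_prob n r (M : R) : (forall x, law n x <= M) ->
  (P [set w : Omega | (flen (walk w n).1 <= r)%N] <= ((#|{: letter k}|.+1 ^ r)%:R * M)%:E)%E.
Proof.
move=> HM; have M0 : 0 <= M := le_trans (law_ge0 n 1%g) (HM 1%g).
have mW (Q : F -> Prop) : measurable [set w : Omega | Q (walk w n).1].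
  exact: (measurable_walk n (fun x => Q x.1)).
have H (L : seq (seq (letter k))) :
    (P [set w : Omega | val (walk w n).1 \in L] <= ((size L)%:R * M)%:E)%E.
  elim: L => [|u L IH].
    rewrite (_ : [set _ | _] = set0) ?measure0 ?mul0r //.
    by apply/seteqP; split => w.
  rewrite (_ : [set _ | _] = [set w : Omega | val (walk w n).1 = u] `|`
      [set w : Omega | val (walk w n).1 \in L]); last first.
    apply/seteqP; split => w /=; rewrite inE; first by move=> /orP[/eqP|]; [left|right].
    by case=> [->|->]; rewrite ?eqxx ?orbT.
  apply: le_trans (measureU2 _ (mW (fun x => val x = u)) (mW (fun x => val x \in L))) _.
  rewrite /= -natr1 mulrDl mul1r addrC EFinD leeD //.
  have [ru|ru] := boolP (reduced u).
    rewrite (_ : [set _ | _] = at_time n (free_word ru)) -?lawE ?lee_fin //.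
    by apply/seteqP; split => w /= E; [exact: val_inj|rewrite E].
  rewrite (_ : [set _ | _] = set0) ?measure0 ?lee_fin //.
  apply/seteqP; split => w //= E; move: ru; rewrite -E => /negP; apply; exact: (valP (walk w n).1).
apply: le_trans (_ : P [set w : Omega | val (walk w n).1 \in short_words k r] <= _)%E.
  apply: le_measure; rewrite ?inE.
  - exact: (mW (fun x => flen x <= r)%N).
  - exact: (mW (fun x => val x \in short_words k r)).
  - by move=> w /=; exact: mem_short_words.
apply: le_trans (H _) _; rewrite lee_fin ler_wpM2r // ler_nat.
exact: size_short_words.
Qed.

Let f := @walk_len m k R tree_len.

Hypothesis moment : (Ex P (f 1%N) < +oo)%E.

Let len1 : tree_len 1%g = 0%N. Proof. by []. Qed.
Let lenM x y : (tree_len (x * y)%g <= tree_len x + tree_len y)%N.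
Proof. exact: flenM. Qed.
Let lenV x : tree_len x^-1%g = tree_len x.
Proof. exact: flenV. Qed.

Let nf := @nnrv_walk_len m k R tree_len.
Let cf := @cocycle_walk_len m k R tree_len lenM.
Let f0 := @walk_len0 m k R tree_len len1.

Let fmeanE n : Ex P (f n) = (mean P f n)%:E.
Proof. exact: (meanE hP nf cf f0 moment). Qed.

Lemma mean_mul M n : mean P f (M * n) <= M%:R * mean P f n.
Proof.
elim: M => [|M IH].
  rewrite mul0r mul0n -lee_fin -fmeanE.
  by have -> : f 0%N = (fun=> 0) by [apply/funext => w; exact: f0]; rewrite Ex_cst.
rewrite mulSn -natr1 mulrDl mul1r addrC.
apply: le_trans (_ : mean P f n + mean P f (M * n) <= _); last by rewrite lerD2l.
rewrite -lee_fin EFinD -!fmeanE -(Ex_shiftn hP n (nf (M * n)%N)) -ExD //.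
  apply: Ex_le => //; last by move=> w; exact: cf.
  by apply: nnrvD => //; exact: nnrv_shiftn.
exact: nnrv_shiftn.
Qed.

(** [D] makes the decay beat the growth of balls: the ball of radius t has at most c^t points, each
    of probability at most (1 - beta)^((D+1) t) at time M t. So it has probability at most 1/2 for t
    > 0, and off it |y| exceeds t. *)
Lemma linear_mean : exists2 M : nat, (0 < M)%N & forall t : nat, t%:R / 2 <= mean P f (M * t).
Proof.
have [N [beta [N0 b0 b1 H]]] := law_decay.
pose c := #|{: letter k}|.+1.
have c0 : 0 < c%:R :> R by rewrite ltr0n.
have [D HD] : exists D : nat, c%:R * (1 - beta) ^+ D.+1 <= 1 / 2.
  have lt1 : `|1 - beta| < 1 by rewrite ger0_norm ?subr_ge0 // ltrBlDr ltrDl.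
  have e0 : 0 < 1 / 2 / c%:R :> R by rewrite divr_gt0.
  have [D _ HD] := cvgr_lt _ (cvg_expr lt1) _ e0; exists D.
  by have := HD D.+1 (leqnSn D); rewrite ltr_pdivlMr // mulrC => /ltW.
(* The factor 2 makes up for the square in [law_decay]. *)
exists (N * (2 * D.+1))%N; first by rewrite !muln_gt0 N0.
case=> [|t]; first by rewrite mul0r muln0; exact: (mean_ge0 P nf).
set n := (_ * t.+1)%N; set z := (1 - beta) ^+ (D.+1 * t.+1).
have z0 : 0 <= z by rewrite exprn_ge0 // subr_ge0.
have Hz x : law n x <= z.
  rewrite -ler_sqr ?nnegrE ?law_ge0 // /n -mulnA.
  by apply: le_trans (H _ _) _; rewrite /z -exprM -mulnA mulnC.
have PB : (P [set w : Omega | (flen (walk w n).1 <= t.+1)%N] <= (1 / 2)%:E)%E.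
  apply: le_trans (ball_prob t.+1 Hz) _; rewrite lee_fin natrX /z exprM -exprMn.
  apply: le_trans (_ : (1 / 2) ^+ t.+1 <= _).
    by rewrite lerXn2r ?nnegrE ?mulr_ge0 ?exprn_ge0 ?subr_ge0 ?divr_ge0.
  rewrite exprS ler_piMr ?divr_ge0 // exprn_ile1 ?divr_ge0 //; lra.
pose B := [set w : Omega | (flen (walk w n).1 <= t.+1)%N].
have mB : measurable B by exact: (measurable_walk n [set x | (flen x.1 <= t.+1)%N]).
have nB : nnrv (fun w => t.+1%:R * \1_B w : R).
  split=> [|w]; last by rewrite mulr_ge0 // indicE.
  by apply: measurable_funM => //; exact: measurable_indic.
have : (Ex P (fun=> t.+1%:R) <= Ex P (fun w => f n w + t.+1%:R * \1_B w)%R)%E.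
  apply: Ex_le; [exact: nnrv_cst|exact: nnrvD|move=> w].
  have [wB|wB] := boolP (w \in B).
    by rewrite indicE wB mulr1 lerDr; have [_] := nf n.
  rewrite indicE (negPf wB) mulr0 addr0 /f /walk_len ler_nat /tree_len.
  by rewrite ltnW // ltnNge; apply: contra wB => h; rewrite inE.
rewrite Ex_cst ExD // fmeanE.
have -> : Ex P (fun w => t.+1%:R * \1_B w)%R = (t.+1%:R%:E * P B)%E.
  rewrite /Ex; under eq_integral do rewrite EFinM.
  rewrite ge0_integralZl //.
  - by rewrite integral_indic // setIT.
  - by apply/measurable_EFinP; exact: measurable_indic.
have t0 : (0 <= t.+1%:R%:E :> \bar R)%E by rewrite lee_fin.
move=> h; have := le_trans h (leeD (lexx _) (lee_wpmul2l t0 PB)).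
by rewrite -EFinM -EFinD lee_fin; lra.
Qed.

(** Subadditivity bounds the mean at time M n by M times the mean at time n, which transfers linear
    growth from the multiples of M to all times. *)
Lemma drift_gt0 : 0 < rate P f.
Proof.
have [M M0 HM] := linear_mean.
have M0' : 0 < M%:R :> R by rewrite ltr0n.
apply: lt_le_trans (_ : 1 / 2 / M%:R <= _); first by rewrite !divr_gt0.
apply: rate_ge => n; rewrite mulrAC ler_pdivrMr //.
apply: le_trans (_ : mean P f (M * n) <= _).
  by apply: le_trans (HM n); rewrite mulrC mulrA mulr1.
by rewrite [leRHS]mulrC mean_mul.
Qed.

End Drift.

(** * The tracking theorem *)

Section Moment.
Variables (m k : nat) (R : realType) (mu : probability (lamplighter m k) R).
Variable P : probability (sequence_space (lamplighter m k)) R.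
Hypothesis hP : is_power_measure mu P.
Local Notation Omega := (sequence_space (lamplighter m k)).

Lemma first_step_law (f : lamplighter m k -> R) : (forall x, 0 <= f x) ->
  Ex P (fun w => f (w 0%N)) = (\int[mu]_x (f x)%:E)%E.
Proof.
move=> f0; have m0 := @measurable_coordinate _ (lamplighter m k) 0.
have mf : measurable_fun [set: lamplighter m k] (fun x => (f x)%:E) by [].
rewrite /Ex -(@ge0_integral_pushforward _ _ _ _ _ _ m0 P setT (fun x => (f x)%:E)) //; last first.
  by move=> x _; rewrite lee_fin.
apply: eq_measure_integral => A mA _.
have := @box_prob _ _ _ _ _ hP 1 (fun _ => A) (fun _ => mA).
rewrite big_ord1 => E; apply: etrans _ E; congr (P _); apply/seteqP; split => w /=.
  by move=> Aw [].
by move=> /(_ 0%N isT).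
Qed.

Lemma llen_moment : finite_first_moment mu -> (Ex P (@walk_len m k R (@llen m k) 1) < +oo)%E.
Proof.
move=> [x hx].
have [g0 Hg] := cayley_dist_act (@lamp_conn m k) (@lamp_adj_sym m k) x.
pose C : R := (llen g0 + llen g0)%:R + 2.
have C0 : 0 <= C by rewrite addr_ge0.
have le h : (llen h)%:R <= cayley_dist x (cayley_act h x) + C.
  have : (llen h <= llen g0 + ldist g0 (h * g0)%g + llen g0)%N.
    apply: leq_trans (ldist_triangle _ (h * g0)%g _) _; rewrite leq_add ?ldist_triangle //.
    by rewrite ldistC ldist_mulr.
  by rewrite -(ler_nat R) !natrD /C natrD; have := Hg h; rewrite /ldist; lra.
have d0 h : 0 <= cayley_dist x (cayley_act h x).
  exact: (cayley_dist_ge0 (@lamp_conn m k)).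
have -> : @walk_len m k R (@llen m k) 1 = (fun w => (llen (w 0%N))%:R).
  by apply/funext => w; rewrite /walk_len walk1.
rewrite (first_step_law (f := fun h => (llen h)%:R)) //.
apply: le_lt_trans (_ : \int[mu]_h ((cayley_dist x (cayley_act h x))%:E + C%:E) < _)%E.
  apply: ge0_le_integral => //.
  by move=> h _; rewrite -EFinD lee_fin.
rewrite ge0_integralD //; last by move=> h _; rewrite lee_fin.
have -> : (\int[mu]_(_ in [set: lamplighter m k]) C%:E = C%:E)%E.
  transitivity (C%:E * mu [set: lamplighter m k])%E; first exact: integral_cst.
  by rewrite probability_setT mule1.
by rewrite lte_add_pinfty // ltry.
Qed.

End Moment.

Theorem theorem25 (R : realType) (m k : nat) (hm : (2 <= m)%N) (hk : (2 <= k)%N)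
    (mu : probability (lamplighter m k) R)
    (hmoment : finite_first_moment mu)
    (hends : forall E : set (set (nat -> free_group k)),
       E `<=` is_end (k := k) -> E !=set0 -> finite_set E ->
       ~ fixes_ends (supp mu) E)
    (P : probability (sequence_space (lamplighter m k)) R)
    (hP : is_power_measure mu P) :
  exists2 A : R, 0 < A &
    forall x : lamplighter m k,
      {ae P, forall g : nat -> lamplighter m k,
        exists2 gamma : R -> cayley_point R (lamp_gens m k),
          geodesic_ray gamma &
          cayley_dist (cayley_act (walk g n) (Vertex x)) (gamma (A * n%:R))
            / n%:R @[n --> \oo] --> (0 : R)}.
Proof.
have conn := @lamp_conn m k; have sym := @lamp_adj_sym m k.
have noncomm := noncommuting_support hk hends.
pose wl := @walk_len m k R (@llen m k).
pose yl := @walk_len m k R (@tree_len m k).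
have llen1 : llen (1%g : lamplighter m k) = 0%N.
  exact: ldistxx.
have tlen1 : tree_len (1%g : lamplighter m k) = 0%N by [].
have tlenM (x y : lamplighter m k) : (tree_len (x * y)%g <= tree_len x + tree_len y)%N.
  exact: flenM.
have tlenV (x : lamplighter m k) : tree_len x^-1%g = tree_len x by exact: flenV.
have nwl := nnrv_walk_len R (@llen m k); have nyl := nnrv_walk_len R (@tree_len m k).
have wmom : (Ex P (wl 1%N) < +oo)%E by exact: (llen_moment hP hmoment).
have yw n w : yl n w <= wl n w.
  by rewrite /yl /wl /walk_len ler_nat; exact: (flen_llen (walk w n)).
have ymom : (Ex P (yl 1%N) < +oo)%E.
  exact: le_lt_trans (Ex_le P (nyl 1%N) (nwl 1%N) (yw 1%N)) wmom.
have cwl := cocycle_walk_len R (@llenM m k); have cyl := cocycle_walk_len R tlenM.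
have w0 := walk_len0 R llen1; have y0 := walk_len0 R tlen1.
have ws := walk_len_shift R (@llenM m k) (@llenV m k).
have ys := walk_len_shift R tlenM tlenV.
have l0 : 0 < rate P yl by exact: (drift_gt0 hP noncomm ymom).
have A0 : 0 < rate P wl.
  (* Projecting to the tree does not increase lengths, so A is at least the drift l. *)
  apply: lt_le_trans l0 _; apply: rate_ge => n; apply: le_trans (rate_le P nyl n) _.
  rewrite -lee_fin -(meanE hP nyl cyl y0 ymom) -(meanE hP nwl cwl w0 wmom).
  exact: (Ex_le P (nyl n) (nwl n) (yw n)).
exists (rate P wl) => // x.
have aw := kingman hP nwl cwl w0 ws wmom.
have ay := kingman hP nyl cyl y0 ys ymom.
have su := birkhoff_upper hP (nwl 1%N) wmom.
have sl := birkhoff_lower hP (nwl 1%N) wmom.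
apply: filterS4 aw ay su sl => g aw ay su sl.
have sg : asymptotic (fun n => \sum_(i < n) (llen (g i))%:R) (fine (Ex P (wl 1%N))).
  move=> e e0; have [N1 H1] := su e e0; have [N2 H2] := sl e e0.
  exists (N1 + N2)%N => n Nn.
  have -> : \sum_(i < n) (llen (g i))%:R = birkhoff (wl 1%N) n g.
    rewrite /birkhoff big_mkord; apply: eq_bigr => i _.
    by rewrite /wl /walk_len walk1 /shiftn addn0.
  have := H1 n (leq_trans (leq_addr _ _) Nn); have := H2 n (leq_trans (leq_addl _ _) Nn).
  by rewrite ler_distl mulrBl mulrDl => -> ->.
have [v [vgeo vtrack]] := tracking l0 A0 ay aw sg.
exists (cayley_ray conn vgeo : R -> _); first exact: (geodesic_cayley_ray conn sym vgeo).
apply/cvgrPdist_le => /= e e0.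
have e2 : 0 < e / 2 by rewrite divr_gt0.
(* |x| is the distance from w_n to w_n x, and 1 accounts for rounding A n down to a vertex of the
   ray. *)
have [N1 H1] := vtrack _ e2; have [N2 H2] := natr_large ((llen x)%:R + 1) e2.
exists (N1 + N2).+1 => // n /= Nn.
have n0 : 0 < n%:R :> R by rewrite ltr0n; apply: leq_trans Nn.
have h1 := H1 n (leq_trans (leq_addr _ _) (ltnW Nn)).
have h2 := H2 n (leq_trans (leq_addl _ _) (ltnW Nn)).
have t0 : 0 <= rate P wl * n%:R by rewrite mulr_ge0 // ltW.
rewrite sub0r normrN ger0_norm; last by rewrite divr_ge0 // (cayley_dist_ge0 conn).
rewrite ler_pdivrMr //.
apply: le_trans (cayley_dist_ray_le conn vgeo _ t0) _.
set t := Num.truncn _ in h1 *.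
have : (gdist (@lamp_gens m k) (walk g n * x)%g (v t) <= llen x + ldist (walk g n) (v t))%N.
  apply: leq_trans (gdist_triangle conn _ (walk g n) _) _.
  by rewrite leq_add2r -(ldist_mulr (walk g n) x) [leqRHS]ldistC.
by rewrite -(ler_nat R) natrD; lra.
Qed.
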